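(* Let $P$ be a simplicial poset with vertex set $V=\{x_1,\dots,x_n\}$, let $\ell$ be a positive integer, and let $\alpha=(\alpha_1,\dots,\alpha_n)\in\mathbb{Z}^n$. Set $B=\{i:-\ell<\alpha_i<0\}$, $C=\{i:\alpha_i=-\ell\}$, and $D=\{i:\alpha_i>0\}$. If $-\ell\le\alpha_i$ for all $i$, then for every $i$ $$\mathrm{Ext}_A^i(A/\mathfrak{m}_\ell,A_P)_\alpha\cong\bigoplus_{\substack{z\in P\\ \mathrm{supp}(z)=B\cup D}}\widetilde{H}^{\,i-|B|-|C|-1}\left([\hat 0,z_D]\times \mathrm{lk}_P(z)_{V\smallsetminus C}\right)$$ (as $\Bbbk$-vector spaces), and $\mathrm{Ext}_A^i(A/\mathfrak{m}_\ell,A_P)_\alpha=0$ otherwise (that is, if $\alpha_j<-\ell$ for some $j$). In particular, if $D\neq\emptyset$ then $\mathrm{Ext}_A^i(A/\mathfrak{m}_\ell,A_P)_\alpha=0$.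
   Context: Posets. A simplicial poset is a finite poset $(P,\preceq)$ with a least element $\hat 0$ such that every interval $[\hat 0,y]$, $y\in P$, is a Boolean lattice. The rank $\mathrm{rk}_P(y)$ is the maximal length of a chain from $\hat 0$ to $y$; elements of rank $1$ are called atoms or vertices and are labeled $x_1,\dots,x_n$. For $y\in P$, $\mathrm{supp}(y)=\{i: x_i\preceq y\}$. For $S\subseteq \mathrm{supp}(y)$, $y_S$ is the unique element with $y_S\preceq y$ and $\mathrm{supp}(y_S)=S$. The link is $\mathrm{lk}_P(y)=\{w\in P: y\preceq w\}$, a simplicial poset with least element $y$. The set $V$ is identified with $\{1,\dots,n\}$, and $\mathrm{lk}_P(z)_{V\smallsetminus C}=\{w\in\mathrm{lk}_P(z): \mathrm{supp}(w)\cap C=\emptyset\}$, where $\mathrm{supp}$ is the support in $P$. Products of posets carry the componentwise order; products of simplicial posets, links, and order ideals are simplicial posets. $\mathcal{M}(w,y)$ denotes the set of minimal upper bounds of $w$ and $y$ in $P$. Cohomology. Let $\Bbbk$ be a fixed infinite field. For a simplicial poset $Q$ with atoms $a_1,\dots,a_m$, $\widetilde C^i(Q)$ is the $\Bbbk$-vector space with basis the elements of $Q$ of rank $i+1$ (so $\widetilde C^{-1}(Q)=\Bbbk\hat 0$). An orientation is a partial order $\mathcal{O}$ on $\{1,\dots,m\}$ restricting to a total order on the support of every element. The coboundary $\delta:\widetilde C^i(Q)\to\widetilde C^{i+1}(Q)$ is $\delta(y)=\sum_{j\notin\mathrm{supp}(y)}(-1)^{u_j}\sum_{z\in\mathcal{M}(a_j,y)}z$,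 with $u_j=|\{k\in\mathrm{supp}(y): j<_{\mathcal{O}}k\}|$. $\widetilde H^i(Q)$ is the cohomology of this complex (independent of $\mathcal{O}$ up to isomorphism). Algebra. $A=\Bbbk[x_1,\dots,x_n]$, and $\mathfrak{m}_\ell=(x_1^\ell,\dots,x_n^\ell)$. The face ring is $A_P=\Bbbk[y:y\in P]/I_P$, where $I_P$ is generated by $\hat 0-1$ and, for each pair $w,y\in P$, by $wy$ if $\mathcal{M}(w,y)=\emptyset$ and by $wy-(w\wedge y)\sum_{z\in\mathcal{M}(w,y)}z$ if $\mathcal{M}(w,y)\ne\emptyset$. $A$ is $\mathbb{Z}^n$-graded by $\deg(x_i)=\mathbf{e}_i$, and $A_P$ is $\mathbb{Z}^n$-graded by $\deg(y)=\sum_{i\in\mathrm{supp}(y)}\mathbf{e}_i$; $A_P$ is viewed as a $\mathbb{Z}^n$-graded $A$-module, and $\mathrm{Ext}_A^i(A/\mathfrak{m}_\ell,A_P)$ has the induced $\mathbb{Z}^n$-grading, a homomorphism having degree $\alpha$ if it raises degrees by $\alpha$. The subscript $\alpha$ denotes the degree-$\alpha$ graded piece. *)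

(* Defs.v *)
(* The classical files come first, so that `[set x | P]`, `setX`, ... keep
   their finset meaning. *)
From HB Require Import structures.
From mathcomp Require Import boolp classical_sets functions cardinality.
From mathcomp Require Import all_boot all_order all_algebra.
From mathcomp Require Import mpoly.

Set Implicit Arguments.
Unset Strict Implicit.
Unset Printing Implicit Defensive.

Import Order.TTheory GRing.Theory Num.Theory.
Local Open Scope ring_scope.
Local Open Scope quotient_scope.

(** * Modules: submodules, quotients, subquotients, direct sums *)

(* The library's submodClosed is about semimodules and does not provide
   closure under opposite. *)
Record submodule (R : nzRingType) (V : lmodType R) := Submodule {
  submodule_pred :> V -> bool;
  submoduleP : submod_closed submodule_pred
}.
HB.instance Definition _ (R : nzRingType) (V : lmodType R) (Z : submodule V) :=
  GRing.isSubmodClosed.Build R V (submodule_pred Z) (submoduleP Z).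

Section Submodule.
Variables (R : nzRingType) (V : lmodType R) (Z : submodule V).

Inductive submod : predArgType := Submod v & v \in submodule_pred Z.
Definition submod_val (w : submod) : V := let: Submod v _ := w in v.

HB.instance Definition _ := [isSub of submod for submod_val].
HB.instance Definition _ := [Choice of submod by <:].
HB.instance Definition _ := [SubChoice_isSubZmodule of submod by <:].
HB.instance Definition _ := [SubZmodule_isSubLmodule of submod by <:].
End Submodule.

(* The library's quotient of abelian groups, with its module structure. *)
Section QuotientModule.
Variables (R : nzRingType) (V : lmodType R) (B : submodule V).

Definition quot_mod : Type :=
  @Quotient.quot V (Algebra.ZmodClosed.clone V (submodule_pred B) _).
HB.instance Definition _ := ZmodQuotient.on quot_mod.

Lemma quot_modE (u v : V) :
  (\pi_quot_mod u == \pi_quot_mod v) = (u - v \in submodule_pred B).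
Proof. by rewrite [RHS]Quotient.idealrBE. Qed.

Definition quot_scale (a : R) : quot_mod -> quot_mod :=
  lift_op1 quot_mod ( *:%R a).

Lemma pi_quot_scale a (v : V) :
  quot_scale a (\pi_quot_mod v) = \pi_quot_mod (a *: v).
Proof.
rewrite /quot_scale; unlock; apply/eqP; rewrite quot_modE -scalerBr.
by rewrite rpredZ // -quot_modE reprK.
Qed.

Fact quot_scaleA a b (v : quot_mod) :
  quot_scale a (quot_scale b v) = quot_scale (a * b) v.
Proof. by rewrite -[v]reprK !pi_quot_scale scalerA. Qed.

Fact quot_scale1 : left_id 1 quot_scale.
Proof. by move=> v; rewrite -[v]reprK pi_quot_scale scale1r. Qed.

Fact quot_scaleDr : right_distributive quot_scale +%R.
Proof.
move=> a u v; rewrite -[u]reprK -[v]reprK -raddfD !pi_quot_scale -raddfD.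
by rewrite scalerDr.
Qed.

Fact quot_scaleDl (v : quot_mod) : {morph quot_scale^~ v : a b / a + b}.
Proof.
by move=> a b; rewrite -[v]reprK !pi_quot_scale -raddfD scalerDl.
Qed.

HB.instance Definition _ := GRing.Zmodule_isLmodule.Build R quot_mod
  quot_scaleA quot_scale1 quot_scaleDr quot_scaleDl.
End QuotientModule.

Section Subquotient.
Variables (R : nzRingType) (V : lmodType R) (Z B : submodule V).

Definition subquot_rel : {pred submod Z} :=
  fun z => submod_val z \in submodule_pred B.

Fact subquot_rel_closed : submod_closed subquot_rel.
Proof.
by split=> [|a u v Bu Bv]; [exact: (submoduleP B).1|exact: (submoduleP B).2].
Qed.

(* Z / (Z \cap B) *)
Definition subquot : lmodType R :=
  quot_mod (Submodule subquot_rel_closed).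
End Subquotient.

Section Span.
Variables (R : nzRingType) (V : lmodType R) (G : V -> Prop).

Definition span : {pred V} := fun v =>
  `[< exists2 s : seq (R * V), (forall c, c \in s -> G c.2) &
        v = \sum_(c <- s) c.1 *: c.2 >].

Fact span_closed : submod_closed span.
Proof.
split=> [|a u v].
  by apply/asboolP; exists [::] => //; rewrite big_nil.
move=> /asboolP[s Gs ->] /asboolP[t Gt ->]; apply/asboolP.
exists ([seq (a * c.1, c.2) | c <- s] ++ t).
  move=> c; rewrite mem_cat => /orP[/mapP[e es ->]|/Gt //]; exact: Gs es.
rewrite big_cat big_map scaler_sumr; congr (_ + _).
by apply: eq_bigr => c _; rewrite scalerA.
Qed.
End Span.

Section Image.
Variables (R : nzRingType) (U V : lmodType R) (f : U -> V) (fL : linear f).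
Variable Z : submodule U.

Definition image_rel : {pred V} := fun v =>
  `[< exists2 u, u \in submodule_pred Z & v = f u >].

Fact image_closed : submod_closed image_rel.
Proof.
have [Z0 ZL] := submoduleP Z; split=> [|a v w].
  apply/asboolP; exists 0 => //.
  by have := fL (-1) 0 0; rewrite scaler0 addr0 scaleN1r addNr.
move=> /asboolP[u Zu ->] /asboolP[u' Zu' ->]; apply/asboolP.
by exists (a *: u + u'); [exact: ZL|rewrite fL].
Qed.

Definition image_submodule : submodule V := Submodule image_closed.
End Image.

(* V regarded as an R-module through phi. *)
Definition restrict (R S : nzRingType) (phi : {rmorphism R -> S})
  (V : lmodType S) : Type := V.

Section Restriction.
Variables (R S : nzRingType) (phi : {rmorphism R -> S}) (V : lmodType S).

HB.instance Definition _ := GRing.Zmodule.on (restrict phi V).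

Definition restrict_scale (a : R) (v : restrict phi V) : restrict phi V :=
  phi a *: (v : V).

Fact restrict_scaleA a b v :
  restrict_scale a (restrict_scale b v) = restrict_scale (a * b) v.
Proof. by rewrite /restrict_scale scalerA rmorphM. Qed.
Fact restrict_scale1 : left_id 1 restrict_scale.
Proof. by move=> v; rewrite /restrict_scale rmorph1 scale1r. Qed.
Fact restrict_scaleDr : right_distributive restrict_scale +%R.
Proof. by move=> a u v; rewrite /restrict_scale scalerDr. Qed.
Fact restrict_scaleDl v : {morph restrict_scale^~ v : a b / a + b}.
Proof. by move=> a b; rewrite /restrict_scale rmorphD scalerDl. Qed.

HB.instance Definition _ := GRing.Zmodule_isLmodule.Build R (restrict phi V)
  restrict_scaleA restrict_scale1 restrict_scaleDr restrict_scaleDl.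
End Restriction.

Section DirectSum.
Variables (R : nzRingType) (I : finType) (V : I -> lmodType R).

(* I is finite, so the direct sum is the product. *)
Definition dirsum : Type := forall i, V i.
HB.instance Definition _ := Choice.on dirsum.

Fact dirsum_addA : associative (fun u v : dirsum => (fun i => u i + v i) : dirsum).
Proof. by move=> u v w; apply: functional_extensionality_dep => i; exact: addrA. Qed.
Fact dirsum_addC : commutative (fun u v : dirsum => (fun i => u i + v i) : dirsum).
Proof. by move=> u v; apply: functional_extensionality_dep => i; exact: addrC. Qed.
Fact dirsum_add0 : left_id ((fun=> 0) : dirsum)
  (fun u v : dirsum => (fun i => u i + v i) : dirsum).
Proof. by move=> u; apply: functional_extensionality_dep => i; exact: add0r. Qed.
Fact dirsum_addN : left_inverse ((fun=> 0) : dirsum)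
  (fun u : dirsum => (fun i => - u i) : dirsum)
  (fun u v : dirsum => (fun i => u i + v i) : dirsum).
Proof. by move=> u; apply: functional_extensionality_dep => i; exact: addNr. Qed.
HB.instance Definition _ := GRing.isZmodule.Build dirsum
  dirsum_addA dirsum_addC dirsum_add0 dirsum_addN.

Definition dirsum_scale (a : R) (u : dirsum) : dirsum := fun i => a *: u i.
Fact dirsum_scaleA a b u :
  dirsum_scale a (dirsum_scale b u) = dirsum_scale (a * b) u.
Proof. by apply: functional_extensionality_dep => i; exact: scalerA. Qed.
Fact dirsum_scale1 : left_id 1 dirsum_scale.
Proof. by move=> u; apply: functional_extensionality_dep => i; exact: scale1r. Qed.
Fact dirsum_scaleDr : right_distributive dirsum_scale +%R.
Proof. by move=> a u v; apply: functional_extensionality_dep => i; exact: scalerDr. Qed.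
Fact dirsum_scaleDl u : {morph dirsum_scale^~ u : a b / a + b}.
Proof. by move=> a b; apply: functional_extensionality_dep => i; exact: scalerDl. Qed.
HB.instance Definition _ := GRing.Zmodule_isLmodule.Build R dirsum
  dirsum_scaleA dirsum_scale1 dirsum_scaleDr dirsum_scaleDl.
End DirectSum.

Definition lmod_iso (R : nzRingType) (U V : lmodType R) : Prop :=
  exists f : {linear U -> V}, bijective f.

Definition lmod_zero (R : nzRingType) (U : lmodType R) : Prop :=
  forall u : U, u = 0.

(** * Simplicial posets *)

(* Every interval [\bot, y] is isomorphic to the lattice of subsets of some
   {0, .., r-1}; the least element is part of finBPOrderType. *)
Definition simplicial_poset (d : Order.disp_t) (P : finBPOrderType d) : Prop :=
  forall y : P, exists r, exists2 f : {set 'I_r} -> P,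
    {mono f : E F / E \subset F >-> (E <= F)%O} &
    forall w : P, (w <= y)%O <-> exists E, w = f E.

(* A poset is given as a subset Q of a finite poset T, with its least element
   b; this covers intervals, links and products without changing types. *)
Section Poset.
Variables (d : Order.disp_t) (T : finPOrderType d) (Q : {set T}) (b : T).
Implicit Types (y z w a : T) (E : {set T}).

Definition is_chain y E : bool :=
  [&& E \subset Q, b \in E, y \in E, [forall u in E, (b <= u <= y)%O] &
      [forall u in E, forall v in E, (u <= v)%O || (v <= u)%O]].

Definition rank y : nat := \max_(E : {set T} | is_chain y E) #|E|.-1.

Definition atoms : {set T} := [set a in Q | rank a == 1%N].

Definition atoms_below y : {set T} := [set a in atoms | (a <= y)%O].

(* The set of minimal upper bounds in Q. *)
Definition mub w y : {set T} :=
  [set z in Q | [&& (w <= z)%O, (y <= z)%O &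
     [forall u in Q, [&& (w <= u)%O, (y <= u)%O & (u <= z)%O] ==> (u == z)]]].

(* The partial order is put on the atoms themselves, not on their labels. *)
Definition orientation (O : rel T) : Prop :=
  [/\ {in atoms, reflexive O},
      {in atoms &, antisymmetric O},
      {in atoms & &, transitive O} &
      {in Q, forall y, {in atoms_below y &, total O}}].

Section Cohomology.
Variables (K : fieldType) (O : rel T).

Definition basis_cochain y : {ffun T -> K^o} := [ffun t => (t == y)%:R].

Definition coboundary (c : {ffun T -> K^o}) : {ffun T -> K^o} :=
  \sum_(y in Q) c y *:
    \sum_(a in atoms | a \notin atoms_below y)
      (-1) ^+ #|[set e in atoms_below y | O a e && (a != e)]| *:
        \sum_(z in mub a y) basis_cochain z.

(* C^i, inside the space with basis T. *)
Definition cochain (i : int) (c : {ffun T -> K^o}) : Prop :=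
  forall y, c y != 0 -> y \in Q /\ (rank y)%:Z = i + 1.

Definition cocycles (i : int) : {pred {ffun T -> K^o}} := fun c =>
  `[< cochain i c /\ coboundary c = 0 >].

Definition coboundaries (i : int) : {pred {ffun T -> K^o}} := fun c =>
  `[< exists2 e, cochain (i - 1) e & c = coboundary e >].

Fact cochain0 i : cochain i 0.
Proof. by move=> y; rewrite ffunE eqxx. Qed.

Fact cochain_linear i (a : K) c e :
  cochain i c -> cochain i e -> cochain i (a *: c + e).
Proof.
move=> Cc Ce y; rewrite !ffunE => nz.
have [c0|/Cc//] := eqVneq (c y) 0; apply: Ce.
by apply: contra_neq nz => ->; rewrite c0 scaler0 addr0.
Qed.

Fact coboundary_linear : linear coboundary.
Proof.
move=> a c e; rewrite /coboundary scaler_sumr -big_split.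
by apply: eq_bigr => y _; rewrite !ffunE scalerDl scalerA.
Qed.

Fact coboundary0 : coboundary 0 = 0.
Proof. by apply: big1 => y _; rewrite ffunE scale0r. Qed.

Fact cocycles_closed i : submod_closed (cocycles i).
Proof.
split=> [|a c e]; first by apply/asboolP; split; [exact: cochain0|exact: coboundary0].
move=> /asboolP[Cc dc] /asboolP[Ce de]; apply/asboolP.
by split; [exact: cochain_linear|rewrite coboundary_linear dc de scaler0 addr0].
Qed.

Fact coboundaries_closed i : submod_closed (coboundaries i).
Proof.
split=> [|a c e].
  by apply/asboolP; exists 0; [exact: cochain0|rewrite coboundary0].
move=> /asboolP[c' Cc ->] /asboolP[e' Ce ->]; apply/asboolP.
by exists (a *: c' + e'); [exact: cochain_linear|rewrite coboundary_linear].
Qed.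

(* Indexed by all integers; zero for i < -1, where there are no cochains. *)
Definition reduced_cohomology (i : int) : lmodType K :=
  subquot (Submodule (cocycles_closed i)) (Submodule (coboundaries_closed i)).

End Cohomology.
End Poset.

Section Vertices.
Variables (d : Order.disp_t) (P : finBPOrderType d) (n : nat) (x : 'I_n -> P).

Definition vertex_labelling : Prop :=
  injective x /\
  forall y, y \in atoms [set: P] (\bot%O : P) <-> exists i, y = x i.

Definition supp (y : P) : {set 'I_n} := [set i | (x i <= y)%O].

(* y_S; meaningful for S \subset supp y. *)
Definition face (y : P) (S : {set 'I_n}) : P :=
  odflt \bot%O [pick w | (w <= y)%O && (supp w == S)].

Definition interval (y : P) : {set P} := [set w | (w <= y)%O].

(* The elements of the link of z whose support avoids C. *)
Definition link_minus (z : P) (C : {set 'I_n}) : {set P} :=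
  [set w | (z <= w)%O && [disjoint supp w & C]].

(* [0, z_D] x lk(z)_{V - C}, whose least element is (\bot, z). *)
Definition interval_link (z : P) (D C : {set 'I_n}) : {set P *p P}%type :=
  setX (interval (face z D)) (link_minus z C).
End Vertices.

(** * Z^n-gradings *)

Notation Zn n := {ffun 'I_n -> int}.

Section Gradings.
Variables (n : nat) (K : fieldType).

(* The polynomials all of whose monomials have degree beta, when the j-th
   variable has degree w j. *)
Section Polynomials.
Variables (N : nat) (w : 'I_N -> Zn n) (beta : Zn n).

Definition poly_piece_rel : {pred {mpoly K[N]}} := fun p =>
  all (fun m : 'X_{1..N} => \sum_j w j *+ m j == beta) (msupp p).

Fact poly_piece_closed : submod_closed poly_piece_rel.
Proof.
split=> [|a p q]; first by rewrite unfold_in /poly_piece_rel msupp0.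
move=> /allP Hp /allP Hq; apply/allP => m /msuppD_le.
by rewrite mem_cat => /orP[/msuppZ_le/Hp|/Hq].
Qed.

Definition poly_piece : submodule {mpoly K[N]} := Submodule poly_piece_closed.
End Polynomials.

Notation A := {mpoly K[n]}.
Notation overK M := (restrict (@mpolyC n K) M).

Definition Zn_unit (i : 'I_n) : Zn n := [ffun j => (j == i)%:R].

Definition gradA (beta : Zn n) : submodule A := poly_piece Zn_unit beta.

(* The homogeneous pieces of a Z^n-graded A-module. *)
Definition grading (M : lmodType A) := Zn n -> submodule (overK M).

(* The degree beta piece of A^r, its j-th basis vector having degree s j. *)
Definition free_piece r (s : 'I_r -> Zn n) (beta : Zn n) (u : 'rV[A]_r) :
  Prop := forall j, u 0 j \in submodule_pred (gradA (beta - s j)).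

(* Z^n-graded resolutions of M by graded free modules of finite rank; they
   exist for finitely generated M, as A is Noetherian. *)
Record graded_resolution (M : lmodType A) (gM : grading M) := {
  res_rank : nat -> nat;
  res_shift : forall p, 'I_(res_rank p) -> Zn n;
  res_d : forall p, {linear 'rV[A]_(res_rank p.+1) -> 'rV[A]_(res_rank p)};
  res_aug : {linear 'rV[A]_(res_rank 0) -> M};
  res_d_homog : forall p beta u,
    free_piece (@res_shift p.+1) beta u ->
    free_piece (@res_shift p) beta (res_d p u);
  res_aug_homog : forall beta u,
    free_piece (@res_shift 0) beta u ->
    (res_aug u : overK M) \in submodule_pred (gM beta);
  res_aug_surj : forall m, exists u, res_aug u = m;
  res_exact0 : forall u, res_aug u = 0 <-> exists v, res_d 0 v = u;
  res_exactS : forall p u,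
    res_d p u = 0 <-> exists v, res_d p.+1 v = u
}.

(* Ext_A^p(M, N)_alpha: the p-th cohomology of the degree alpha part
   Hom_A(F, N)_alpha of the complex Hom_A(F, N), for a resolution F of M. *)
Section Ext.
Variables (M : lmodType A) (gM : grading M) (F : graded_resolution gM).
Variables (N : lmodType A) (gN : grading N) (alpha : Zn n).
Notation Fr p := 'rV[A]_(res_rank F p).

Definition hom_deg p (f : Fr p -> overK N) : Prop :=
  linear (f : Fr p -> N) /\
  forall beta u, free_piece (@res_shift _ _ F p) beta u ->
    f u \in submodule_pred (gN (beta + alpha)).

Definition ext_cocycles p : {pred Fr p -> overK N} := fun f =>
  `[< hom_deg f /\ forall u, f (res_d F p u) = 0 >].

Definition ext_coboundaries p : {pred Fr p -> overK N} :=
  match p with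
  | 0%N => fun f => `[< f = 0 >]
  | q.+1 => fun f => `[< exists2 g : Fr q -> overK N, hom_deg g &
                          f = g \o res_d F q >]
  end.

Fact hom_deg0 p : @hom_deg p 0.
Proof.
split=> [a u v|beta u _]; last exact: (submoduleP _).1.
by rewrite /= scaler0 addr0.
Qed.

Fact hom_deg_linear p (a : K) (f g : Fr p -> overK N) :
  hom_deg f -> hom_deg g -> hom_deg (a *: f + g).
Proof.
move=> [fL fd] [gL gd]; split=> [c u v|beta u Fu]; last first.
  by apply: (submoduleP _).2; [exact: fd|exact: gd].
change (a%:MP *: (f : Fr p -> N) (c *: u + v) + (g : Fr p -> N) (c *: u + v) =
  c *: (a%:MP *: (f u : N) + g u) + (a%:MP *: (f v : N) + g v)).
rewrite fL gL !scalerDr !scalerA [c * _]mulrC -!addrA; congr (_ + _).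
by rewrite addrCA.
Qed.

Fact ext_cocycles_closed p : submod_closed (@ext_cocycles p).
Proof.
split=> [|a f g]; first by apply/asboolP; split; [exact: hom_deg0|].
move=> /asboolP[Hf df] /asboolP[Hg dg]; apply/asboolP.
split=> [|u]; first exact: hom_deg_linear.
by rewrite -[LHS]/(a *: f _ + g _) df dg scaler0 addr0.
Qed.

Fact ext_coboundaries_closed p : submod_closed (@ext_coboundaries p).
Proof.
case: p => [|q]; split=> [|a f g].
- by apply/asboolP.
- by move=> /asboolP-> /asboolP->; apply/asboolP; rewrite scaler0 addr0.
- by apply/asboolP; exists 0; [exact: hom_deg0|].
- move=> /asboolP[f' Hf ->] /asboolP[g' Hg ->]; apply/asboolP.
  by exists (a *: f' + g'); [exact: hom_deg_linear|].
Qed.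

Definition Ext p : lmodType K :=
  subquot (Submodule (@ext_cocycles_closed p))
          (Submodule (@ext_coboundaries_closed p)).

End Ext.

(** * A / m_l *)

Section PowerQuotient.
Variable l : nat.

Definition power_ideal : submodule A^o :=
  Submodule (span_closed (fun p : A^o => exists i, p = 'X_i ^+ l)).

Definition power_quot : lmodType A := quot_mod power_ideal.

Definition power_quot_proj (p : A) : overK power_quot :=
  \pi_(quot_mod power_ideal) (p : A^o).

Fact power_quot_proj_linear : linear power_quot_proj.
Proof.
move=> a p q; rewrite /power_quot_proj -mul_mpolyC raddfD; congr (_ + _).
by rewrite -[RHS]/(quot_scale a%:MP (\pi_(quot_mod power_ideal) (p : A^o)))
  pi_quot_scale.
Qed.

Definition power_quot_grading : grading power_quot :=
  fun beta => image_submodule power_quot_proj_linear (gradA beta).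
End PowerQuotient.

(** * The face ring *)

Section FaceRing.
Variables (d : Order.disp_t) (P : finBPOrderType d) (x : 'I_n -> P).

(* k[y : y \in P] *)
Notation S := {mpoly K[#|P|]}.
Definition face_var (y : P) : S := 'X_(enum_rank y).

(* Greatest lower bounds exist in a simplicial poset when there is an upper
   bound; \bot is a dummy value otherwise. *)
Definition glb (w y : P) : P :=
  odflt \bot%O [pick u | [&& (u <= w)%O, (u <= y)%O &
    [forall v, (v <= w)%O && (v <= y)%O ==> (v <= u)%O]]].

Definition face_relation (p : S) : Prop :=
  p = face_var \bot%O - 1 \/
  exists w y : P, if mub [set: P] w y == set0
    then p = face_var w * face_var y
    else p = face_var w * face_var y -
      face_var (glb w y) * \sum_(z in mub [set: P] w y) face_var z.

Definition face_ideal : {pred S} := span (face_relation : S^o -> Prop).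

Fact mub_bot (y z : P) : (z \in mub [set: P] \bot%O y) = (z == y).
Proof.
rewrite !inE /= le0x /=; apply/andP/eqP => [[yz /forall_inP H]|->]; last first.
  split=> //; apply/forall_inP => u _; apply/implyP => /and3P[_ yu uy].
  by apply/eqP/le_anti; rewrite uy yu.
by have := H y (finset.in_setT _); rewrite le0x lexx yz => /eqP.
Qed.

Fact glb_bot : glb \bot%O \bot%O = \bot%O.
Proof.
rewrite /glb; case: pickP => //= u /and3P[u0 _ _].
by apply/eqP; rewrite -lex0.
Qed.

(* I_P is proper: it vanishes at the point where \hat 0 = 1 and all other
   variables are 0. *)
Definition bot_point (j : 'I_#|P|) : K := (enum_val j == \bot%O :> P)%:R.

Fact meval_face_var y : (face_var y).@[bot_point] = (y == \bot%O)%:R.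
Proof. by rewrite mevalXU /bot_point enum_rankK. Qed.

Fact face_relation_bot p : face_relation p -> p.@[bot_point] = 0.
Proof.
case=> [->|[w [y]]]; first by rewrite mevalB meval1 meval_face_var eqxx subrr.
have mub0 z : z \in mub [set: P] w y -> (z == \bot%O) = (w == \bot%O) && (y == \bot%O).
  rewrite !inE => /andP[_ /and3P[wz yz /forall_inP H]].
  apply/eqP/andP => [z0|[/eqP w0 /eqP y0]].
    by rewrite -!lex0 -z0 wz yz.
  have := H \bot%O (finset.in_setT _); rewrite w0 y0 !lexx le0x /=.
  by move=> /eqP.
case: ifPn => [/eqP M0 ->|M0 ->].
  rewrite mevalM !meval_face_var -natrM mulnb.
  case: andP => // -[/eqP w0 /eqP y0].
  by have := mub_bot y y; rewrite -w0 M0 eqxx inE.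
rewrite mevalB !mevalM !meval_face_var raddf_sum /= -natrM mulnb.
under eq_bigr => z zM do rewrite meval_face_var (mub0 z zM).
case: andP => [[/eqP w0 /eqP y0]|_]; last first.
  by rewrite big1 // mulr0 subr0.
rewrite w0 y0 glb_bot eqxx (eq_bigl (pred1 (\bot%O : P))); last exact: mub_bot.
by rewrite big_pred1_eq mulr1 subrr.
Qed.

Fact face_ideal_closed : idealr_closed face_ideal.
Proof.
have [I0 IL] := @span_closed _ S^o face_relation; split=> //.
apply/negP => /asboolP[s Gs /(congr1 (meval bot_point))].
rewrite meval1 raddf_sum big_seq big1 => [/eqP|c /Gs Gc]; first by rewrite oner_eq0.
by rewrite /= mevalM (face_relation_bot Gc) mulr0.
Qed.

HB.instance Definition _ := isIdealr.Build S face_ideal face_ideal_closed.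

Definition face_ring : Type := {ideal_quot (Idealr.clone S face_ideal _)}.
HB.instance Definition _ := GRing.ComNzRing.on face_ring.
HB.instance Definition _ := NzRingQuotient.on face_ring.

Definition face_proj (p : S) : face_ring := \pi_face_ring p.
HB.instance Definition _ := GRing.RMorphism.copy face_proj \pi_face_ring.

(* The A-algebra structure of the face ring. *)
Definition face_structure (p : A) : face_ring :=
  face_proj (mmap (@mpolyC #|P| K) (fun i => face_var (x i)) p).
HB.instance Definition _ := GRing.RMorphism.copy face_structure
  (face_proj \o mmap (@mpolyC #|P| K) (fun i => face_var (x i))).

Definition face_module : lmodType A := restrict face_structure face_ring^o.

Definition face_weight (j : 'I_#|P|) : Zn n :=
  \sum_(i in supp x (enum_val j)) Zn_unit i.

Definition face_module_proj (p : S) : overK face_module := face_proj p.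

Fact face_module_proj_linear : linear face_module_proj.
Proof.
move=> a p q.
rewrite /face_module_proj -mul_mpolyC rmorphD rmorphM /=; congr (_ + _).
rewrite -[RHS]/(face_structure a%:MP * face_proj p) /face_structure.
by rewrite mmapC.
Qed.

Definition face_grading : grading face_module :=
  fun beta => image_submodule face_module_proj_linear
    (poly_piece face_weight beta).
End FaceRing.

End Gradings.

(* Main.v *)
From HB Require Import structures.
Require Import Defs.
From mathcomp Require Import boolp classical_sets functions cardinality.
From mathcomp Require Import all_boot all_order all_algebra.
From mathcomp Require Import mpoly.

Set Implicit Arguments.
Unset Strict Implicit.
Unset Printing Implicit Defensive.

Import Order.TTheory GRing.Theory Num.Theory.
Local Open Scope ring_scope.
Local Open Scope quotient_scope.

(** In a fixed degree, the Koszul resolution of [A / m_l] turns Ext into the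
    cohomology of an explicit complex of finite dimensional vector spaces. The
    theorem holds because this complex is, up to signs, the direct sum of the
    simplicial cochain complexes of the posets
    [[0, z_D] x lk(z)_(V - C)], one for each [z] with support [B :|: D].

    The face ring is understood first. Restriction to a face [w] ([Phi]) maps it
    to a polynomial ring, and straightening ([straighten]) writes every element
    as a combination of monomials supported on chains. A chain monomial is
    determined by its degree and its largest member, so the piece of degree
    [mu] >= 0 has a basis indexed by the faces whose support is that of [mu]
    ([face_grading_basis]); pieces with a negative coordinate vanish. In these
    coordinates, multiplication by ['X_i ^+ l] pulls functions back: the value of
    the product at a face [w] with support [i |: S] is the value of the given
    element at the face of [w] with support [S]. The record [face_coordinates]
    keeps these facts only.

    A Koszul cochain of degree [alpha] takes at the generator [s], a set of
    variables, a value of degree [alpha] plus [l] on [s]. This vanishes unless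
    [s] contains [B :|: C], and it vanishes always if some [alpha j] is less
    than [-l]. Otherwise the support of the degree consists of [B :|: D] and
    of the elements of [s] at which [alpha] is zero. So a coordinate of a
    cochain is given by [s] and a face [w]. The face [z] of [w] with support
    [B :|: D] and the face of [w] with support [s :&: D] determine an element of
    the product above, and every element of the product arises once
    ([interval_link_ex], [interval_link_unique]). The differentials agree
    because both remove one label at a time ([cochain_of_d]). The signs are
    adjusted by [esign], which also absorbs the choice of the orientation
    ([osign_coboundary]). This gives [koszul_ext_iso].

    The comparison theorem for graded resolutions ([Ext_resolution_iso]) replaces
    an arbitrary resolution by the Koszul one ([koszul_resolution]), whose
    exactness is proved by a contraction that divides by powers of the variables
    ([khomotopyP]). If [D] is not empty, then [[0, z_D]] is a Boolean lattice with
    at least one atom, the product is a cone, and its cohomology vanishes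
    ([cone_cohomology0]). *)

(** * Isomorphisms of subquotients *)

Section Subquotients.
Variable R : nzRingType.

(** First isomorphism theorem. *)
Lemma subquot_iso_of (V W : lmodType R) (Z B : submodule V)
    (g : submod Z -> W) :
    linear g -> (forall z, g z = 0 <-> submod_val z \in submodule_pred B) ->
    (forall w, exists z, g z = w) ->
  lmod_iso (subquot Z B) W.
Proof.
move=> gL gker gsurj.
have g0 : g 0 = 0 by have := gL (-1) 0 0; rewrite scaler0 addr0 scaleN1r addNr.
have gB u v : g (u - v) = g u - g v.
  have -> : u - v = -1 *: v + u by rewrite scaleN1r addrC.
  by rewrite gL scaleN1r addrC.
pose F (c : subquot Z B) : W := g (repr c).
have FE z : F (\pi_(quot_mod (Submodule (@subquot_rel_closed _ _ Z B))) z) = g z.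
  apply/eqP; rewrite -subr_eq0 -gB; apply/eqP/gker.
  set B' := Submodule _.
  have := quot_modE B' (repr (\pi_(quot_mod B') z)) z.
  by rewrite reprK eqxx => /esym.
have Flin : linear F.
  move=> a u v; rewrite -[u]reprK -[v]reprK !FE -gL.
  by rewrite -[a *: _]/(quot_scale a _) pi_quot_scale -raddfD FE.
pose FL := GRing.isLinear.Build _ _ _ _ F Flin.
exists (HB.pack_for {linear subquot Z B -> W} F FL).
have Finj : injective F.
  move=> u v /eqP; rewrite -[u]reprK -[v]reprK !FE -subr_eq0 -gB => /eqP/gker H.
  by apply/eqP; rewrite quot_modE.
have [h hP] := choice gsurj.
exists (fun w => \pi_(quot_mod (Submodule (@subquot_rel_closed _ _ Z B))) (h w)).
  by move=> u; apply: Finj; rewrite /= FE hP.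
by move=> w; rewrite /= FE hP.
Qed.

(** The hypotheses on [f] say that it maps cocycles to cocycles, detects
    coboundaries and reaches every class; no inverse on cocycles is asked for. *)
Lemma subquot_dirsum_iso (V : lmodType R) (I : finType) (V' : I -> lmodType R)
    (Z B : submodule V) (Z' B' : forall i, submodule (V' i))
    (f : forall i, V -> V' i) :
    (forall i, linear (f i)) ->
    (forall v, v \in submodule_pred Z -> forall i, f i v \in submodule_pred (Z' i)) ->
    (forall v, v \in submodule_pred Z ->
       (v \in submodule_pred B <-> forall i, f i v \in submodule_pred (B' i))) ->
    (forall w : forall i, V' i, (forall i, w i \in submodule_pred (Z' i)) ->
       exists2 v, v \in submodule_pred Z &
         forall i, f i v - w i \in submodule_pred (B' i)) ->
  lmod_iso (subquot Z B) (dirsum (fun i => subquot (Z' i) (B' i))).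
Proof.
move=> fL fZ fB fsurj.
pose pi' i (z : submod (Z' i)) : subquot (Z' i) (B' i) :=
  \pi_(quot_mod (Submodule (@subquot_rel_closed _ _ (Z' i) (B' i)))) z.
pose g0 i (z : submod Z) : submod (Z' i) :=
  Submod (fZ (submod_val z) (valP z) i).
pose g (z : submod Z) : dirsum (fun i => subquot (Z' i) (B' i)) :=
  fun i => pi' i (g0 i z).
apply: (@subquot_iso_of _ _ _ _ g).
- move=> a u v; apply: functional_extensionality_dep => i.
  rewrite -[RHS]/(quot_scale a (pi' i (g0 i u)) + pi' i (g0 i v)).
  rewrite pi_quot_scale -raddfD /g /pi'; congr (\pi _).
  by apply: val_inj; exact: fL.
- move=> z; rewrite (fB _ (valP z)); split=> [gz i|H].
    have /eqP : g z i = 0 by rewrite gz.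
    rewrite -[X in _ == X](raddf0 (\pi_(quot_mod (Submodule (@subquot_rel_closed _ _ (Z' i) (B' i)))))).
    by rewrite quot_modE subr0.
  apply: functional_extensionality_dep => i.
  apply/eqP; rewrite -[X in _ == X](raddf0 (\pi_(quot_mod (Submodule (@subquot_rel_closed _ _ (Z' i) (B' i)))))).
  by rewrite quot_modE subr0; exact: H.
- move=> w.
  have [v Zv face_elt] := fsurj (fun i => submod_val (repr (w i))) (fun i => valP (repr (w i))).
  exists (Submod Zv); apply: functional_extensionality_dep => i.
  rewrite -[w i]reprK /g; apply/eqP; rewrite quot_modE; exact: face_elt.
Qed.

Lemma subquot_iso (V V' : lmodType R) (Z B : submodule V) (Z' B' : submodule V')
    (f : V -> V') : linear f ->
    (forall v, v \in submodule_pred Z -> f v \in submodule_pred Z') ->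
    (forall v, v \in submodule_pred Z ->
       (v \in submodule_pred B <-> f v \in submodule_pred B')) ->
    (forall w, w \in submodule_pred Z' ->
       exists2 v, v \in submodule_pred Z & f v - w \in submodule_pred B') ->
  lmod_iso (subquot Z B) (subquot Z' B').
Proof.
move=> fL fZ fB fsurj.
pose pi' := \pi_(quot_mod (Submodule (@subquot_rel_closed _ _ Z' B'))).
pose g (z : submod Z) : subquot Z' B' := pi' (Submod (fZ (submod_val z) (valP z))).
apply: (@subquot_iso_of _ _ _ _ g).
- move=> a u v; rewrite -[a *: g u]/(quot_scale a (g u)).
  rewrite pi_quot_scale -raddfD /g; congr (\pi _).
  by apply: val_inj; exact: fL.
- move=> z; rewrite (fB _ (valP z)); split=> [/eqP|H].
    by rewrite -[X in _ == X](raddf0 pi') quot_modE subr0.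
  by apply/eqP; rewrite -[X in _ == X](raddf0 pi') quot_modE subr0.
- move=> w; have [v Zv face_elt] := fsurj _ (valP (repr w)).
  by exists (Submod Zv); rewrite -[w]reprK; apply/eqP; rewrite quot_modE.
Qed.

Lemma lmod_iso_trans (U V W : lmodType R) :
  lmod_iso U V -> lmod_iso V W -> lmod_iso U W.
Proof.
by move=> [f fb] [g gb]; exists (g \o f); exact: bij_comp.
Qed.

Lemma lmod_iso_zero (U V : lmodType R) :
  lmod_iso U V -> lmod_zero V -> lmod_zero U.
Proof.
move=> [f /bij_inj fI] V0 u; apply: fI.
by rewrite raddf0; exact: V0.
Qed.

Lemma subquot_zero (V : lmodType R) (Z B : submodule V) :
    {subset submodule_pred Z <= submodule_pred B} ->
  lmod_zero (subquot Z B).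
Proof.
move=> ZB u; rewrite -[u]reprK; apply/eqP.
rewrite -[X in _ == X](raddf0 (\pi_(quot_mod (Submodule (@subquot_rel_closed _ _ Z B))))).
by rewrite quot_modE subr0; apply: ZB; exact: (valP (repr u)).
Qed.

End Subquotients.

(** * Posets whose intervals are Boolean *)

Section Labelling.
Variables (d : Order.disp_t) (T : finPOrderType d) (Q : {set T}) (b : T).
Variables (n : nat) (tau : T -> {set 'I_n}).

(** The vertices below a common element carry distinct labels, and determine
    the element within any interval; two atoms without upper bound may share a
    label, as happens in a link. This form is common to a simplicial poset
    labelled by supports and to the products of an interval with a link. *)
Record boolean_labelling : Prop := BooleanLabelling {
  lab_bot : b \in Q;
  lab_bot_le : forall q, q \in Q -> (b <= q)%O;
  lab_bot0 : tau b = set0;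
  lab_mono : forall y q, y \in Q -> q \in Q -> (y <= q)%O -> tau y \subset tau q;
  lab_inj : forall y y' q, y \in Q -> y' \in Q -> q \in Q ->
    (y <= q)%O -> (y' <= q)%O -> tau y \subset tau y' -> (y <= y')%O;
  lab_surj : forall q (S : {set _}), q \in Q -> S \subset tau q ->
    exists y, [/\ y \in Q, (y <= q)%O & tau y = S]
}.

Hypothesis L : boolean_labelling.

Definition lface (q : T) (S : {set 'I_n}) : T :=
  odflt b [pick y | [&& y \in Q, (y <= q)%O & tau y == S]].

Lemma lfaceP q (S : {set _}) : q \in Q -> S \subset tau q ->
  [/\ lface q S \in Q, (lface q S <= q)%O & tau (lface q S) = S].
Proof.
move=> Qq /(lab_surj L Qq)[y [Qy yq yS]]; rewrite /lface.
case: pickP => [u /and3P[Qu uq /eqP uS]|/(_ y)] //=.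
by rewrite Qy yq yS eqxx.
Qed.

Lemma lab_eq y y' q : y \in Q -> y' \in Q -> q \in Q ->
  (y <= q)%O -> (y' <= q)%O -> tau y = tau y' -> y = y'.
Proof.
move=> Qy Qy' Qq yq y'q e; apply: le_anti.
by rewrite (lab_inj L Qy Qy' Qq) ?(lab_inj L Qy' Qy Qq) ?e.
Qed.

Lemma lface_eq y q : y \in Q -> q \in Q -> (y <= q)%O -> lface q (tau y) = y.
Proof.
move=> Qy Qq yq; have [Qf fq tf] := lfaceP Qq (lab_mono L Qy Qq yq).
exact: lab_eq Qf Qy Qq fq yq tf.
Qed.

Lemma lface_sub y q (S : {set _}) : y \in Q -> q \in Q -> (y <= q)%O -> S \subset tau y ->
  lface y S = lface q S.
Proof.
move=> Qy Qq yq Sy; have [Qf fq tf] := lfaceP Qy Sy.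
by rewrite -[in RHS]tf lface_eq // (le_trans fq).
Qed.

(** The members of a chain have distinct numbers of labels, which bounds its
    length; removing labels one by one gives a chain that attains the bound. *)
Lemma rank_labelling q : q \in Q -> rank Q b q = #|tau q|.
Proof.
move=> Qq; apply/eqP; rewrite eqn_leq; apply/andP; split.
  apply/bigmax_leqP => E /and5P[/subsetP EQ _ _ /forall_inP Eb /forall_inP Ech].
  pose f (u : T) : 'I_#|tau q|.+1 := inord #|tau u|.
  have Eq u : u \in E -> (u <= q)%O by move=> /Eb/andP[].
  have fE u : u \in E -> f u = #|tau u| :> nat.
    move=> Eu; rewrite inordK // ltnS subset_leq_card //.
    by apply: (lab_mono L) => //; [exact: EQ|exact: Eq].
  have fI : {in E &, injective f}.
    move=> u v Eu Ev /(congr1 val) /=; rewrite !fE // => e.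
    have /forall_inP/(_ v Ev) := Ech u Eu.
    wlog uv : u v Eu Ev e / (u <= v)%O.
      move=> H /orP[uv|vu]; first by apply: H => //; rewrite uv.
      by apply/esym; apply: H => //; rewrite vu.
    move=> _; have tuv := lab_mono L (EQ u Eu) (EQ v Ev) uv.
    apply: (lab_eq (EQ u Eu) (EQ v Ev) Qq) => //; try exact: Eq.
    by apply/eqP; rewrite eqEcard tuv e leqnn.
  rewrite -(card_in_imset fI) -subn1 leq_subLR add1n.
  by have := max_card [set f u | u in E]; rewrite card_ord.
suff [E [chE cE]] : exists E, is_chain Q b q E /\ #|E| = #|tau q|.+1.
  by apply: (@leq_trans #|E|.-1); [rewrite cE|exact: leq_bigmax_cond].
move: {2}#|_| (erefl #|tau q|) => m; elim: m q Qq => [|m IH] q Qq qm.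
  have q0 : q = b.
    apply: (lab_eq Qq (lab_bot L) Qq) => //; first exact: (lab_bot_le L).
    by rewrite (lab_bot0 L); apply: cards0_eq.
  exists [set q]; rewrite cards1 qm; split=> //.
  apply/and5P; split; rewrite ?sub1set ?in_set1 ?q0 ?eqxx ?(lab_bot L) //.
    by apply/forall_inP => u /set1P->; rewrite lexx.
  apply/forall_inP => u /set1P->.
  by apply/forall_inP => v /set1P->; rewrite lexx.
have /set0Pn[i iq] : tau q != set0 by rewrite -card_gt0 qm.
have [Qy yq ty] := lfaceP Qq (subsetDl (tau q) [set i]).
set y := lface q _ in Qy yq ty.
have ym : #|tau y| = m by rewrite ty; have := cardsD1 i (tau q); rewrite iq qm => -[].
have [E [/and5P[EQ bE yE /forall_inP Eb /forall_inP Ech] cE]] := IH y Qy ym.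
have qE : q \notin E.
  apply/negP => /Eb/andP[_ qy].
  have := subset_leq_card (lab_mono L Qq Qy qy); by rewrite qm ym ltnn.
exists (q |: E); rewrite cardsU1 qE cE ym qm; split=> //.
apply/and5P; split.
- by rewrite subUset sub1set Qq.
- by rewrite !inE bE orbT.
- by rewrite !inE eqxx.
- apply/forall_inP => u /setU1P[->|/Eb/andP[-> uy]]; last exact: le_trans yq.
  by rewrite (lab_bot_le L) ?lexx.
- apply/forall_inP => u uE; apply/forall_inP => v vE.
  case/setU1P: uE => [->|uE]; case/setU1P: vE => [->|vE].
  + by rewrite lexx.
  + by have /andP[_ vy] := Eb v vE; rewrite (le_trans vy yq) orbT.
  + by have /andP[_ uy] := Eb u uE; rewrite (le_trans uy yq).
  + by have /forall_inP := Ech u uE; apply.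
Qed.

Lemma atoms_labelling a : (a \in atoms Q b) = (a \in Q) && (#|tau a| == 1%N).
Proof. by rewrite inE; case: (boolP (a \in Q)) => // Qa; rewrite rank_labelling. Qed.

Lemma mub_labelling w y z : w \in Q -> y \in Q ->
  (z \in mub Q w y) =
    [&& z \in Q, (w <= z)%O, (y <= z)%O & tau z == tau w :|: tau y].
Proof.
move=> Qw Qy; rewrite inE; case: (boolP (z \in Q)) => //= Qz.
apply/and3P/and3P => [[wz yz /forall_inP H]|[wz yz /eqP tz]]; split=> //.
  have Sz : tau w :|: tau y \subset tau z.
    by rewrite subUset !(lab_mono L).
  have [Qf fz tf] := lfaceP Qz Sz.
  have /eqP <- : lface z (tau w :|: tau y) == z.
    have := H _ Qf; rewrite fz (lab_inj L Qw Qf Qz) ?(lab_inj L Qy Qf Qz) ?tf //.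
    - exact: subsetUr.
    - exact: subsetUl.
  by rewrite tf.
apply/forall_inP => u Qu; apply/implyP => /and3P[wu yu uz]; apply/eqP.
apply: (lab_eq Qu Qz Qz) => //; apply/eqP.
by rewrite eqEsubset (lab_mono L) // tz subUset !(lab_mono L).
Qed.

Definition lvertex q i := lface q [set i].

Lemma lvertexP q i : q \in Q -> i \in tau q ->
  [/\ lvertex q i \in atoms Q b, (lvertex q i <= q)%O & tau (lvertex q i) = [set i]].
Proof.
move=> Qq iq; rewrite atoms_labelling.
have [|Qf fq tf] := @lfaceP q [set i] Qq; first by rewrite sub1set.
by rewrite /lvertex Qf tf cards1.
Qed.

Lemma lvertex_atom a q : q \in Q -> a \in atoms Q b -> (a <= q)%O ->
  exists2 i, i \in tau q & a = lvertex q i.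
Proof.
move=> Qq; rewrite atoms_labelling => /andP[Qa /cards1P[i ai]] aq.
exists i; first by have := lab_mono L Qa Qq aq; rewrite ai sub1set.
by rewrite /lvertex -ai lface_eq.
Qed.

Lemma lvertex_inj q i j : q \in Q -> i \in tau q -> j \in tau q ->
  lvertex q i = lvertex q j -> i = j.
Proof.
move=> Qq iq jq e; have [_ _ ti] := lvertexP Qq iq.
have [_ _ tj] := lvertexP Qq jq.
by move: ti; rewrite e tj => /set1_inj.
Qed.

Lemma atoms_belowE q : q \in Q -> atoms_below Q b q = [set lvertex q i | i in tau q].
Proof.
move=> Qq; apply/setP => a; apply/idP/imsetP.
  by rewrite inE => /andP[Aa aq]; exact: lvertex_atom.
by move=> [i iq ->]; have [Aa aq _] := lvertexP Qq iq; rewrite inE Aa.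
Qed.

Definition lfacet q i := lface q (tau q :\ i).

Lemma lfacetP q i : q \in Q ->
  [/\ lfacet q i \in Q, (lfacet q i <= q)%O & tau (lfacet q i) = tau q :\ i].
Proof. by move=> Qq; apply: lfaceP => //; exact: subsetDl. Qed.

Lemma lvertex_facet q i j : q \in Q -> j \in tau q :\ i ->
  lvertex (lfacet q i) j = lvertex q j.
Proof.
move=> Qq jq; have [Qf fq tf] := lfacetP i Qq.
by apply: lface_sub; rewrite // tf sub1set.
Qed.

Section Coboundary.
Variables (K : fieldType) (O : rel T).

Lemma coboundary_out (c : {ffun T -> K^o}) q : q \notin Q -> coboundary Q b O c q = 0.
Proof.
move=> Qq; rewrite /coboundary sum_ffunE big1 // => y Qy.
rewrite ffunE sum_ffunE big1 ?scaler0 // => a _.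
rewrite ffunE sum_ffunE big1 ?scaler0 // => z; rewrite inE => /andP[Qz _].
by rewrite ffunE; case: eqP => // e; rewrite e Qz in Qq.
Qed.

(** The pairs formed by an atom and an element not above it that have [q] among
    their minimal upper bounds are the vertices of [q] with the opposite
    facets, one pair for each label. *)
Lemma coboundaryE (c : {ffun T -> K^o}) q : q \in Q ->
  coboundary Q b O c q = \sum_(i in tau q)
    (-1 : K) ^+ #|[set j in tau q :\ i | O (lvertex q i) (lvertex q j)]| *
      c (lfacet q i) :> K.
Proof.
move=> Qq; rewrite /coboundary sum_ffunE.
pose sg y a : K := (-1) ^+ #|[set e in atoms_below Q b y | O a e && (a != e)]|.
transitivity (\sum_(y in Q) \sum_(a in atoms Q b | a \notin atoms_below Q b y)
   (sg y a * c y) * (q \in mub Q a y)%:R).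
  apply: eq_bigr => y Qy; rewrite ffunE sum_ffunE scaler_sumr.
  apply: eq_bigr => a _; rewrite ffunE sum_ffunE.
  have -> : \sum_(z in mub Q a y) basis_cochain K z q = (q \in mub Q a y)%:R.
    case: (boolP (q \in mub Q a y)) => qm.
      rewrite (bigD1 q) //= ffunE eqxx big1 ?addr0 // => z /andP[_ zq].
      by rewrite ffunE eq_sym (negbTE zq).
    rewrite big1 // => z zm; rewrite ffunE; case: eqP => // e.
    by rewrite e zm in qm.
  by rewrite /= -[LHS]/(c y * (sg y a * _)) mulrA [c y * _]mulrC.
rewrite pair_big_dep /=.
pose h i := (lfacet q i, lvertex q i).
pose A := [set h i | i in tau q].
have AE p : (p \in A) = [&& p.1 \in Q, p.2 \in atoms Q b,
    p.2 \notin atoms_below Q b p.1 & q \in mub Q p.2 p.1].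
  apply/imsetP/and4P => [[i iq ->]|[]].
    have [Qf fq tf] := lfacetP i Qq.
    have [va vq tv] := lvertexP Qq iq.
    have Qv : lvertex q i \in Q by move: va; rewrite inE => /andP[].
    rewrite /= Qf va mub_labelling // Qq vq fq tv tf setUC setUC.
    rewrite setD1K // eqxx; split=> //; rewrite inE va /=.
    apply/negP => /(lab_mono L Qv Qf); rewrite tv tf sub1set.
    by rewrite !inE eqxx.
  case: p => y a /= Qy Aa; rewrite inE Aa /= => ay.
  have Qa : a \in Q by move: Aa; rewrite inE => /andP[].
  rewrite mub_labelling // => /and4P[_ aq yq /eqP tq].
  have [i iq ai] := lvertex_atom Qq Aa aq.
  have [_ _ ta] := lvertexP Qq iq; rewrite -ai in ta.
  have iy : i \notin tau y.
    apply: contra ay => iy; apply: (lab_inj L Qa Qy Qq) => //.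
    by rewrite ta sub1set.
  exists i => //; rewrite /h -ai; congr (_, _).
  rewrite /lfacet tq ta.
  have -> : (i |: tau y) :\ i = tau y by rewrite setU1K.
  by rewrite lface_eq.
have hI : {in tau q &, injective h}.
  by move=> i j iq jq [_ e]; exact: (lvertex_inj Qq).
transitivity (\sum_(p in A) sg p.1 p.2 * c p.1).
  rewrite [RHS](eq_bigl _ _ AE) big_mkcond [RHS]big_mkcond /=.
  apply: eq_bigr => p _.
  case: (p.1 \in Q) => //=; case: (p.2 \in atoms Q b) => //=.
  case: (p.2 \in atoms_below Q b p.1) => //=.
  by case: (q \in _); rewrite ?mulr1 ?mulr0.
rewrite big_imset //=; apply: eq_bigr => i iq; congr (_ * _).
have [Qf fq tf] := lfacetP i Qq; rewrite /sg; congr (_ ^+ _).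
rewrite atoms_belowE // tf.
rewrite -(@card_in_imset _ _ (lvertex q)); last first.
  move=> j k; rewrite !inE => /andP[/andP[_ jq] _] /andP[/andP[_ kq] _].
  exact: lvertex_inj.
congr #|pred_of_set _|; apply/setP => e; apply/idP/imsetP.
  rewrite inE => /andP[/imsetP[j jf ->]]; rewrite lvertex_facet // => /andP[Oij ij].
  by exists j => //; rewrite inE jf.
move=> [j]; rewrite inE => /andP[jf Oij] ->; rewrite inE Oij /=; apply/andP; split.
  by apply/imsetP; exists j => //; rewrite lvertex_facet.
apply/eqP => ij; move: jf; rewrite !inE => /andP[ji jq].
by rewrite (lvertex_inj Qq iq jq ij) eqxx in ji.
Qed.


Lemma sign_card (S : {set 'I_n}) (p : pred 'I_n) :
  (-1) ^+ #|[set j in S | p j]| = \prod_(j in S) (-1) ^+ p j :> K.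
Proof.
rewrite -prodr_const big_mkcond [RHS]big_mkcond /=; apply: eq_bigr => j _.
by rewrite inE; case: (j \in S); case: (p j).
Qed.

(** The sign of the permutation that sorts the vertices of [q], ordered by
    [O], by decreasing label. *)
Definition osign q : K := \prod_(i in tau q) \prod_(j in tau q | (i < j)%N)
  (-1) ^+ (O (lvertex q i) (lvertex q j)).

Lemma osign_sq q : osign q * osign q = 1.
Proof.
rewrite /osign -big_split big1 //= => i _; rewrite -big_split big1 //= => j _.
by rewrite -expr2 sqrr_sign.
Qed.

Definition ksign (i : 'I_n) (S : {set 'I_n}) : K :=
  (-1) ^+ #|[set j in S | (j < i)%N]|.

Hypothesis O_orientation : orientation Q b O.

Lemma orientation_lvertex q i j : q \in Q -> i \in tau q -> j \in tau q -> i != j ->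
  O (lvertex q i) (lvertex q j) = ~~ O (lvertex q j) (lvertex q i).
Proof.
move=> Qq iq jq ij; have [_ anti _ tot] := O_orientation.
have [ai bi _] := lvertexP Qq iq; have [aj bj _] := lvertexP Qq jq.
have := tot q Qq (lvertex q i) (lvertex q j).
rewrite inE ai bi inE aj bj => /(_ isT isT)/orP.
case: (boolP (O _ _)) => [Oij _|_ []//]; case: (boolP (O _ _)) => // Oji.
have /(lvertex_inj Qq iq jq)/eqP := anti _ _ ai aj (introT andP (conj Oij Oji)).
by rewrite (negbTE ij).
Qed.

(** Both sides compare the vertex [k] with every other vertex of [q]. Against a
    larger label the two signs on the left cancel; against a smaller one they
    are opposite, because [O] compares the two vertices in exactly one way. *)
Lemma osign_facet q k : q \in Q -> k \in tau q ->
  osign q * (-1) ^+ #|[set j in tau q :\ k | O (lvertex q k) (lvertex q j)]| =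
  osign (lfacet q k) * ksign k (tau q :\ k).
Proof.
move=> Qq kq; rewrite /ksign !sign_card /osign (big_setD1 k) //=.
have [Qf fq tf] := lfacetP k Qq; rewrite tf.
rewrite [X in X * _ * _]big_mkcondr [X in X * _ * _](big_setD1 k) //= ltnn mul1r.
rewrite -big_split -big_split -big_split; apply: eq_bigr => i iq /=.
have [ik i_q] : i != k /\ i \in tau q by move: iq; rewrite !inE => /andP.
have -> : \prod_(j in tau q | (i < j)%N) (-1) ^+ O (lvertex q i) (lvertex q j) =
  (if (i < k)%N then (-1) ^+ O (lvertex q i) (lvertex q k) else 1) *
  \prod_(j in tau q :\ k | (i < j)%N)
     (-1) ^+ O (lvertex (lfacet q k) i) (lvertex (lfacet q k) j) :> K.
  rewrite big_mkcondr (big_setD1 k) //=; congr (_ * _).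
  rewrite [RHS]big_mkcondr; apply: eq_bigr => j jq.
  by rewrite !lvertex_facet.
rewrite (orientation_lvertex Qq i_q kq ik).
case: (ltngtP i k) => [ki|ki|/val_inj e]; last by rewrite e eqxx in ik.
  rewrite mul1r mulrAC [RHS]mulrC; congr (_ * _).
  by case: (O _ _); rewrite /= ?mulr1 ?mul1r.
by rewrite mul1r mulr1 mulrAC -expr2 sqrr_sign mul1r.
Qed.

(** Scaling by [osign] turns the coboundary for [O] into the coboundary for the
    order of the labels, so that the orientation does not matter. *)
Lemma osign_coboundary (c : {ffun T -> K^o}) q : q \in Q ->
  osign q * coboundary Q b O c q = \sum_(k in tau q)
    ksign k (tau q :\ k) * (osign (lfacet q k) * c (lfacet q k)).
Proof.
move=> Qq; rewrite coboundaryE // mulr_sumr; apply: eq_bigr => k kq.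
by rewrite mulrA osign_facet // mulrA [ksign _ _ * _]mulrC.
Qed.

Lemma cochain_lab i (c : {ffun T -> K^o}) :
  cochain Q b i c <-> forall y, c y != 0 -> y \in Q /\ #|tau y|%:Z = i + 1.
Proof.
by split=> H y /H[Qy]; rewrite rank_labelling.
Qed.

Lemma ksign_sq k (S : {set 'I_n}) : ksign k S * ksign k S = 1.
Proof. by rewrite /ksign -expr2 sqrr_sign. Qed.

Lemma ksign_setU1 i k (S : {set 'I_n}) : k \notin S ->
  ksign i (k |: S) = (-1) ^+ (k < i)%N * ksign i S.
Proof.
by move=> kS; rewrite /ksign !sign_card big_setU1.
Qed.

(** The hypothesis makes [Q] a cone with apex [i0]. Transporting a cochain along
    the bijection that adds the label [i0] is, up to signs, a contracting
    homotopy. *)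
Lemma cone_cohomology0 (i0 : 'I_n) :
    (forall q, q \in Q -> i0 \notin tau q -> exists y, [/\ y \in Q, (q <= y)%O,
       tau y = i0 |: tau q & forall y', y' \in Q -> (q <= y')%O ->
         tau y' = i0 |: tau q -> y' = y]) ->
  forall i, lmod_zero (reduced_cohomology Q b K O i).
Proof.
move=> cone i; apply: subquot_zero => c /asboolP[/cochain_lab Cc dc].
have ex q : exists y, q \in Q -> i0 \notin tau q -> [/\ y \in Q, (q <= y)%O,
       tau y = i0 |: tau q & forall y', y' \in Q -> (q <= y')%O ->
         tau y' = i0 |: tau q -> y' = y].
  case: (boolP (q \in Q)) => Qq; last by exists q.
  case: (boolP (i0 \in tau q)) => iq; first by exists q.
  by have [y] := cone q Qq iq; exists y.
have [s sP] := choice ex.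
pose e : {ffun T -> K^o} := [ffun q => if (q \in Q) && (i0 \notin tau q) then
   (osign q : K) * (ksign i0 (tau q) * (osign (s q) * c (s q))) else 0].
apply/asboolP; exists e.
  apply/cochain_lab => q; rewrite ffunE; case: ifP; last by rewrite eqxx.
  move=> /andP[Qq iq]; have [Qs _ ts _] := sP q Qq iq.
  rewrite !mulf_eq0 !negb_or => /and4P[_ _ _ /Cc[_]].
  by rewrite ts cardsU1 iq intS addrC => /addIr <-; rewrite subrK.
apply/ffunP => q; case: (boolP (q \in Q)) => Qq; last first.
  rewrite coboundary_out //; apply/eqP; apply: contraNT Qq => /Cc[] //.
suff H : osign q * coboundary Q b O e q = osign q * c q.
  by rewrite -[LHS]mul1r -(osign_sq q) -mulrA -H mulrA osign_sq mul1r.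
rewrite osign_coboundary //; case: (boolP (i0 \in tau q)) => iq.
  rewrite (big_setD1 i0) //= big1 ?addr0; last first.
    move=> k; rewrite !inE => /andP[ki kq]; have [_ _ tf] := lfacetP k Qq.
    by rewrite ffunE tf !inE eq_sym ki iq andbF !mulr0.
  have [Qf fq tf] := lfacetP i0 Qq.
  have nf : i0 \notin tau (lfacet q i0) by rewrite tf !inE eqxx.
  rewrite ffunE Qf nf /=; have [_ _ _ /(_ q Qq fq)] := sP _ Qf nf.
  rewrite tf setD1K // => /(_ erefl) <-.
  by rewrite [osign _ * (osign _ * _)]mulrA osign_sq mul1r mulrA ksign_sq mul1r.
have [Qs qs ts su] := sP q Qq iq.
have := osign_coboundary c Qs; rewrite dc ffunE mulr0 ts big_setU1 //=.
have -> : lfacet (s q) i0 = q.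
  by rewrite /lfacet ts setU1K // lface_eq.
rewrite setU1K // => /esym/eqP; rewrite addrC addr_eq0 => /eqP H.
suff -> : \sum_(k in tau q)
    ksign k (tau q :\ k) * (osign (lfacet q k) * e (lfacet q k)) =
  - (ksign i0 (tau q) * \sum_(k in tau q) ksign k ((i0 |: tau q) :\ k) *
      (osign (lfacet (s q) k) * c (lfacet (s q) k))).
  by rewrite H mulrN opprK !mulrA ksign_sq mul1r.
rewrite mulr_sumr -sumrN; apply: eq_bigr => k kq.
have ki : k != i0 by apply: contraNneq iq => <-.
have [Qf fq tf] := lfacetP k Qq.
have nf : i0 \notin tau (lfacet q k) by rewrite tf !inE (negbTE iq) andbF.
rewrite ffunE Qf nf /=.
have -> : s (lfacet q k) = lfacet (s q) k.
  have [Qg gq tg] := lfacetP k Qs.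
  have [_ _ _ su'] := sP _ Qf nf; apply/esym/su' => //.
    apply: (lab_inj L Qf Qg Qs) => //; first exact: le_trans qs.
    by rewrite tf tg ts setSD // subsetUr.
  by rewrite tg ts tf; apply/setP => j; rewrite !inE; case: eqP => [->|]//=; rewrite (negbTE ki).
rewrite tf [osign (lfacet q k) * (osign _ * _)]mulrA osign_sq mul1r -mulNr !mulrA.
congr (_ * _ * _).
have -> : (i0 |: tau q) :\ k = i0 |: (tau q :\ k).
  by apply/setP => j; rewrite !inE; case: eqP => [->|]//=; rewrite (negbTE ki).
rewrite ksign_setU1 ?inE ?(negbTE iq) ?andbF //.
have -> : ksign i0 (tau q) = (-1) ^+ (k < i0)%N * ksign i0 (tau q :\ k).
  by rewrite -ksign_setU1 ?setD1K // !inE eqxx.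
rewrite mulNr mulrACA -signr_addb.
have -> : (k < i0)%N (+) (i0 < k)%N = true.
  by case: (ltngtP k i0) => // /val_inj e0; rewrite e0 eqxx in ki.
by rewrite expr1 mulN1r opprK mulrC.
Qed.

End Coboundary.
End Labelling.

(** * Simplicial posets, intervals and links *)

Section SimplicialPoset.
Variables (d : Order.disp_t) (P : finBPOrderType d).
Hypothesis P_simplicial : simplicial_poset P.

Lemma atom_cover (a u : P) : a \in atoms [set: P] \bot%O -> (u <= a)%O ->
  u = \bot%O \/ u = a.
Proof.
rewrite inE => /andP[_ /eqP ra] ua.
have [->|u0] := eqVneq u \bot%O; [by left|]; have [->|una] := eqVneq u a; [by right|].
have a0 : a != \bot%O by apply: contraNneq u0 => a0; rewrite -lex0 -a0.
suff : (2 <= rank [set: P] \bot%O a)%N by rewrite ra.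
pose E := \bot%O |: [set u; a].
have cE : #|E| = 3%N.
  by rewrite cardsU1 cards2 una !inE negb_or ![\bot%O == _]eq_sym u0 a0.
rewrite -[2%N]/(3.-1)%N -cE; apply: leq_bigmax_cond.
apply/and5P; split; rewrite ?subsetT // ?in_setU ?in_set1 ?eqxx ?orbT //.
  by apply/forall_inP => v; rewrite /E !inE => /or3P[]/eqP->; rewrite !le0x ?lexx ?ua.
apply/forall_inP => v vE; apply/forall_inP => w.
by move: vE; rewrite /E !inE => /or3P[]/eqP-> /or3P[]/eqP->;
  rewrite ?le0x ?lexx ?ua ?orbT.
Qed.

Lemma atom_neq0 (a : P) : a \in atoms [set: P] \bot%O -> a != \bot%O.
Proof.
rewrite inE => /andP[_ /eqP ra]; apply/eqP => a0; move: ra.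
suff -> : rank [set: P] \bot%O a = 0%N by [].
apply/eqP; rewrite -leqn0; apply/bigmax_leqP => E.
rewrite a0 => /and5P[_ _ _ /forall_inP Eb _].
rewrite -subn1 leq_subLR addn0 -(cards1 (\bot%O : P)) subset_leq_card //.
by apply/subsetP => u /Eb; rewrite lex0 inE => /andP[].
Qed.

Lemma cover_atom (a : P) : a != \bot%O ->
  (forall u, (u <= a)%O -> u = \bot%O \/ u = a) -> a \in atoms [set: P] \bot%O.
Proof.
move=> a0 acov; rewrite inE inE /=; apply/eqP/anti_leq/andP; split.
  apply/bigmax_leqP => E /and5P[_ _ _ /forall_inP Eb _].
  rewrite -subn1 leq_subLR addn1.
  have -> : 2%N = #|[set \bot%O; a]| by rewrite cards2 eq_sym a0.
  apply: subset_leq_card; apply/subsetP => u /Eb /andP[_ /acov[]->];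
  by rewrite !inE eqxx ?orbT.
have -> : 1%N = #|[set \bot%O; a]|.-1 by rewrite cards2 eq_sym a0.
apply: leq_bigmax_cond; apply/and5P; split; rewrite ?subsetT // ?in_setU ?in_set1 ?eqxx ?orbT //.
  by apply/forall_inP => v; rewrite !inE => /orP[]/eqP->; rewrite !le0x ?lexx.
apply/forall_inP => v vE; apply/forall_inP => w.
by move: vE; rewrite !inE => /orP[]/eqP-> /orP[]/eqP->; rewrite ?le0x ?lexx ?orbT.
Qed.

Variables (n : nat) (x : 'I_n -> P).
Hypothesis x_vertices : vertex_labelling x.

(** An interval is the image of a lattice of subsets, whose singletons go to the
    elements that cover [\bot], that is, to vertices. Hence a subset is
    recovered from the support of its image. *)
Lemma supp_labelling : boolean_labelling [set: P] \bot%O (supp x).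
Proof.
have [xI xA] := x_vertices.
have xat i : x i \in atoms [set: P] \bot%O by apply/xA; exists i.
split; rewrite ?inE //.
- apply/setP => i; rewrite !inE lex0; apply/negbTE; exact: atom_neq0.
- move=> y q _ _ yq; apply/subsetP => i; rewrite !inE => /le_trans; exact.
- move=> y y' q _ _ _ yq y'q /subsetP S.
  have [r [f fm fq]] := P_simplicial q.
  have [E Ey] := (fq y).1 yq; have [E' Ey'] := (fq y').1 y'q.
  have fat e : f [set e] \in atoms [set: P] \bot%O.
    have f0 : f set0 = \bot%O.
      have [E0 e0] := (fq \bot%O).1 (le0x _).
      by apply/eqP; rewrite -lex0 e0 fm sub0set.
    apply: cover_atom => [|u ue].
      apply/eqP => fe0; have : (f [set e] <= f set0)%O by rewrite fe0 f0.
      by rewrite fm subset0 -cards_eq0 cards1.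
    have : (u <= q)%O.
      by apply: le_trans ue _; apply/fq; exists [set e].
    move=> /fq[E1 uE]; move: ue; rewrite uE fm subset1.
    by case/orP => /eqP->; [right|left].
  rewrite Ey Ey' fm; apply/subsetP => e eE.
  have /xA[i fi] := fat e.
  have := S i; rewrite !inE -fi Ey Ey' !fm !sub1set; exact.
- move=> q S _ Sq.
  have [r [f fm fq]] := P_simplicial q.
  have f0 : f set0 = \bot%O.
    have [E0 e0] := (fq \bot%O).1 (le0x _).
    by apply/eqP; rewrite -lex0 e0 fm sub0set.
  have xf i : (x i <= q)%O -> exists e, x i = f [set e].
    move=> /fq[E xE].
    have /set0Pn[e eE] : E != set0.
      by apply: contraNneq (atom_neq0 (xat i)) => E0; rewrite xE E0 f0.
    exists e; have fe : (f [set e] <= x i)%O by rewrite xE fm sub1set.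
    case: (atom_cover (xat i) fe) => // fe0.
    have : (f [set e] <= f set0)%O by rewrite fe0 f0.
    by rewrite fm subset0 -cards_eq0 cards1.
  pose E := [set e | [exists i in S, f [set e] == x i]].
  exists (f E); split=> //; first by apply/fq; exists E.
  apply/setP => i; rewrite inE; apply/idP/idP => [xE|iS].
    have /xf[e xe] : (x i <= q)%O by apply: le_trans xE _; apply/fq; exists E.
    move: xE; rewrite xe fm sub1set inE => /exists_inP[j jS /eqP].
    by rewrite -xe => /xI->.
  have : i \in supp x q by apply: (subsetP Sq).
  rewrite inE => /xf[e xe]; rewrite xe fm sub1set inE.
  by apply/exists_inP; exists i => //; rewrite xe.
Qed.

Let L := supp_labelling.

Lemma suppS (y q : P) : (y <= q)%O -> supp x y \subset supp x q.
Proof. by apply: (lab_mono L); rewrite inE. Qed.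

Lemma supp_le (y y' q : P) : (y <= q)%O -> (y' <= q)%O ->
  (y <= y')%O = (supp x y \subset supp x y').
Proof.
move=> yq y'q; apply/idP/idP; first exact: suppS.
by apply: (lab_inj L) yq y'q; rewrite inE.
Qed.

Lemma supp_eq (y y' q : P) : (y <= q)%O -> (y' <= q)%O ->
  supp x y = supp x y' -> y = y'.
Proof. by apply: (lab_eq L); rewrite inE. Qed.

Lemma supp_bot : supp x \bot%O = set0.
Proof. exact: lab_bot0 L. Qed.

Lemma supp_vertex i : supp x (x i) = [set i].
Proof.
have [xI xA] := x_vertices.
apply/setP => j; rewrite !inE; apply/idP/eqP => [ji|->]; last exact: lexx.
have xat k : x k \in atoms [set: P] \bot%O by apply/xA; exists k.
case: (atom_cover (xat i) ji) => [j0|/xI//].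
by have := atom_neq0 (xat j); rewrite j0 eqxx.
Qed.

Lemma faceP (y : P) (S : {set 'I_n}) : S \subset supp x y ->
  (face x y S <= y)%O /\ supp x (face x y S) = S.
Proof.
have Ty : y \in [set: P] by rewrite inE.
move=> /(lab_surj L Ty)[w [_ wy ws]]; rewrite /face.
case: pickP => [u /andP[uy /eqP us]|/(_ w)] //=.
by rewrite wy ws eqxx.
Qed.

Lemma face_le (y : P) (S : {set 'I_n}) : S \subset supp x y -> (face x y S <= y)%O.
Proof. by case/faceP. Qed.

Lemma supp_face (y : P) (S : {set 'I_n}) : S \subset supp x y ->
  supp x (face x y S) = S.
Proof. by case/faceP. Qed.

Lemma face_eq (u y : P) : (u <= y)%O -> face x y (supp x u) = u.
Proof.
by move=> uy; have [fy fs] := faceP (suppS uy); exact: (supp_eq fy uy fs).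
Qed.

Lemma le_face (u y : P) (S : {set 'I_n}) : S \subset supp x y -> (u <= y)%O ->
  (u <= face x y S)%O = (supp x u \subset S).
Proof. by move=> /faceP[fy fs] uy; rewrite (supp_le uy fy) fs. Qed.

Lemma face_face (y : P) (S S' : {set 'I_n}) : S \subset S' -> S' \subset supp x y ->
  face x (face x y S') S = face x y S.
Proof.
move=> SS' S'y; have [fy fs] := faceP S'y.
have Sf : S \subset supp x (face x y S') by rewrite fs.
have [gf gs] := faceP Sf; have [hy hs] := faceP (subset_trans SS' S'y).
by apply: (supp_eq (le_trans gf fy) hy); rewrite gs.
Qed.

Lemma mubE (w y z : P) : (z \in mub [set: P] w y) =
  [&& (w <= z)%O, (y <= z)%O & supp x z == supp x w :|: supp x y].
Proof. by rewrite (mub_labelling L) ?inE. Qed.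

Lemma glbP (w y q : P) : (w <= q)%O -> (y <= q)%O ->
  supp x (glb w y) = supp x w :&: supp x y /\
  forall v, (v <= glb w y)%O = (v <= w)%O && (v <= y)%O.
Proof.
move=> wq yq; set S := supp x w :&: supp x y.
have Sq : S \subset supp x q by apply: subset_trans (subsetIl _ _) (suppS wq).
have [gq gs] := faceP Sq; set g := face x q S in gq gs.
have gv v : (v <= g)%O = (v <= w)%O && (v <= y)%O.
  apply/idP/andP => [vg|[vw vy]].
    split; apply: le_trans vg _; rewrite (supp_le gq) // gs.
      exact: subsetIl.
    exact: subsetIr.
  by rewrite le_face ?subsetI ?suppS // (le_trans vw wq).
suff -> : glb w y = g by [].
rewrite /glb; case: pickP => [u /and3P[uw uy /forallP H]|/(_ g)] /=.
  apply: le_anti; rewrite gv uw uy /=.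
  have := gv g; rewrite lexx => /esym gg.
  by have := H g; rewrite gg.
have := gv g; rewrite lexx => /esym/andP[-> ->] /=.
by move/negbT/negP; case; apply/forallP => v; rewrite gv; apply/implyP.
Qed.

Section IntervalLink.
Variables (z : P) (C D : {set 'I_n}).
Hypotheses (Dz : D \subset supp x z) (Cz : [disjoint supp x z & C]).

Notation Q := (interval_link x z D C).

(** The labels that [q] adds to the least element [(\bot, z)]; those of [D] come
    from the first component and those outside the support of [z] from the
    second. *)
Definition link_supp (q : (P *p P)%type) : {set 'I_n} :=
  supp x q.1 :|: (supp x q.2 :\: supp x z).

Lemma in_interval_link (q : (P *p P)%type) : (q \in Q) =
  [&& (q.1 <= face x z D)%O, (z <= q.2)%O & [disjoint supp x q.2 & C]].
Proof. by case: q => u w; rewrite inE /= !inE. Qed.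

Lemma interval_link_fst (q : (P *p P)%type) : q \in Q -> supp x q.1 \subset D.
Proof.
by rewrite in_interval_link => /and3P[/suppS]; rewrite supp_face.
Qed.

Lemma link_supp_in (q : (P *p P)%type) : q \in Q ->
  link_supp q :&: supp x z = supp x q.1.
Proof.
move=> /interval_link_fst/subset_trans/(_ Dz) qz.
apply/setP => i; rewrite !inE; have := subsetP qz i; rewrite !inE.
by case: (x i <= z)%O; rewrite /= ?andbT ?andbF ?orbF // => H; apply/esym/negP => /H.
Qed.

Lemma link_supp_out (q : (P *p P)%type) : q \in Q ->
  link_supp q :|: supp x z = supp x q.2.
Proof.
move=> Qq; have qz := subset_trans (interval_link_fst Qq) Dz.
move: Qq; rewrite in_interval_link => /and3P[_ /suppS zq _].
apply/setP => i; rewrite !inE; have := subsetP qz i; have := subsetP zq i.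
rewrite !inE; case: (x i <= z)%O => /=; rewrite ?orbT ?orbF; last first.
  by move=> _ H; case: (x i <= q.1)%O H => // /(_ isT).
by move=> /(_ isT)->.
Qed.

Lemma interval_link_labelling :
  boolean_labelling Q ((\bot%O, z) : (P *p P)%type) link_supp.
Proof.
split.
- by rewrite in_interval_link /= le0x lexx.
- move=> q; rewrite in_interval_link => /and3P[_ zq _].
  by rewrite Order.ProdOrder.leEprod /= le0x.
- by rewrite /link_supp /= supp_bot setDv set0U.
- move=> y q _ _; rewrite Order.ProdOrder.leEprod => /andP[y1 y2].
  by apply: setUSS; [exact: suppS|apply: setSD; exact: suppS].
- move=> y y' q Qy Qy' _; rewrite !Order.ProdOrder.leEprod.
  move=> /andP[y1 y2] /andP[y1' y2'] S.
  rewrite (supp_le y1 y1') (supp_le y2 y2').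
  by rewrite -(link_supp_in Qy) -(link_supp_in Qy') -(link_supp_out Qy)
    -(link_supp_out Qy') setSI ?setSU.
- move=> q S Qq Sq.
  have S1 : S :&: supp x z \subset supp x q.1.
    by rewrite -(link_supp_in Qq) setSI.
  have S2 : S :|: supp x z \subset supp x q.2.
    by rewrite -(link_supp_out Qq) setSU.
  have [f1 s1] := faceP S1; have [f2 s2] := faceP S2.
  exists (face x q.1 (S :&: supp x z), face x q.2 (S :|: supp x z)).
  move: Qq; rewrite !in_interval_link => /and3P[q1 q2 qC]; split.
  + rewrite /= (le_trans f1 q1) le_face // subsetUr s2.
    by apply: disjointWl qC.
  + by rewrite Order.ProdOrder.leEprod /= f1.
  + rewrite /link_supp /= s1 s2; apply/setP => i; rewrite !inE.
    by case: (i \in S); case: (x i <= z)%O.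
Qed.

(** A label of [D] can only be added in the first component, which ranges over
    all faces of [face x z D]. *)
Lemma interval_link_cone i0 q : i0 \in D -> q \in Q -> i0 \notin link_supp q ->
  exists y, [/\ y \in Q, (q <= y)%O, link_supp y = i0 |: link_supp q &
    forall y', y' \in Q -> (q <= y')%O -> link_supp y' = i0 |: link_supp q ->
      y' = y].
Proof.
move=> iD Qq iq; have q1 := interval_link_fst Qq.
have := Qq; rewrite in_interval_link => /and3P[qf qz qC].
have [fz fD] := faceP Dz.
have S1 : i0 |: supp x q.1 \subset supp x (face x z D).
  by rewrite fD subUset sub1set iD.
have [gf gs] := faceP S1.
set y := (face x (face x z D) (i0 |: supp x q.1), q.2) : (P *p P)%type.
have Qy : y \in Q by rewrite in_interval_link /= gf qz.
have ty : link_supp y = i0 |: link_supp q.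
  by rewrite /link_supp /= gs setUA.
exists y; split=> //.
  by rewrite Order.ProdOrder.leEprod /= lexx le_face // ?subsetUr.
move=> y' Qy'; rewrite Order.ProdOrder.leEprod => /andP[_ y2] t'.
have e1 : supp x y'.1 = supp x y.1.
  by rewrite -(link_supp_in Qy') -(link_supp_in Qy) t' ty.
have e2 : supp x y'.2 = supp x y.2.
  by rewrite -(link_supp_out Qy') -(link_supp_out Qy) t' ty.
move: (Qy'); rewrite in_interval_link => /and3P[y1f _ _].
rewrite [y']surjective_pairing [y]surjective_pairing; congr (_, _).
  exact: (supp_eq y1f gf e1).
exact/esym/(supp_eq y2 (lexx _))/esym.
Qed.

End IntervalLink.

(** The labels compare any two vertices below one element; distinct atoms with
    the same label have no upper bound and are left incomparable. *)
Lemma labelling_orientation (d' : Order.disp_t) (T : finPOrderType d')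
    (Q : {set T}) (b : T) (tau : T -> {set 'I_n}) : boolean_labelling Q b tau ->
  orientation Q b (fun a a' => (a == a') ||
    [exists i in tau a, [exists j in tau a', (i < j)%N]]).
Proof.
move=> LQ; have at1 a : a \in atoms Q b -> exists i, tau a = [set i].
  by rewrite (atoms_labelling LQ) => /andP[_ /cards1P].
have E a a' i j : tau a = [set i] -> tau a' = [set j] ->
    [exists i in tau a, [exists j in tau a', (i < j)%N]] = (i < j)%N.
  move=> -> ->; apply/exists_inP/idP => [[k /set1P-> /exists_inP[l /set1P->]]//|ij].
  by exists i; rewrite ?inE //; apply/exists_inP; exists j; rewrite ?inE.
split.
- by move=> a _; rewrite eqxx.
- move=> a a' /at1[i ai] /at1[j aj]; rewrite (E _ _ i j) // (E _ _ j i) //.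
  by case: eqP => //= _; rewrite eq_sym; case: eqP => //= _; case: ltngtP.
- move=> a' a a'' /at1[j aj] /at1[i ai] /at1[k ak].
  rewrite (E _ _ i j) // (E _ _ j k) // (E _ _ i k) //.
  case: (eqVneq a a') => [e _|_ /= ij].
    by rewrite e; have -> : i = j by apply: set1_inj; rewrite -ai -aj e.
  case: (eqVneq a' a'') => [e _|_ /= jk]; last by rewrite (ltn_trans ij jk) orbT.
  rewrite -e; have -> : k = j by apply: set1_inj; rewrite -ak -aj e.
  by rewrite ij orbT.
- move=> y Qy a a'; rewrite !inE => /andP[Aa ay] /andP[Aa' ay'].
  have Qa : a \in Q by case/andP: Aa.
  have Qa' : a' \in Q by case/andP: Aa'.
  have [|i ai] := at1 a; first by rewrite inE.
  have [|j aj] := at1 a'; first by rewrite inE.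
  rewrite (E _ _ i j) // (E _ _ j i) //.
  case: (ltngtP i j) => [||/val_inj e]; rewrite ?orbT //.
  by rewrite (lab_eq LQ Qa Qa' Qy ay ay') ?eqxx // ai aj e.
Qed.

End SimplicialPoset.

(** * Multigraded polynomials *)

Section Pieces.
Variables (n : nat) (K : fieldType).

Lemma poly_piece0 N (w : 'I_N -> Zn n) beta : 0 \in submodule_pred (poly_piece K w beta).
Proof. exact: (submoduleP (poly_piece K w beta)).1. Qed.

Lemma poly_pieceX N (w : 'I_N -> Zn n) (m : 'X_{1..N}) :
  'X_[m] \in submodule_pred (poly_piece K w (\sum_j w j *+ m j)).
Proof. by rewrite unfold_in /= /poly_piece_rel msuppX /= eqxx. Qed.

Lemma poly_piece1 N (w : 'I_N -> Zn n) : 1 \in submodule_pred (poly_piece K w 0).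
Proof.
have := poly_pieceX w 0%MM; rewrite mpolyX0 big1 // => j _.
by rewrite mnm0E mulr0n.
Qed.

Lemma poly_piece_var N (w : 'I_N -> Zn n) j : 'X_j \in submodule_pred (poly_piece K w (w j)).
Proof.
have := poly_pieceX w U_(j)%MM; rewrite (bigD1 j) //= big1 ?addr0.
  by rewrite mnm1E eqxx mulr1n.
by move=> i ij; rewrite mnm1E eq_sym (negbTE ij) mulr0n.
Qed.

Lemma poly_pieceM N (w : 'I_N -> Zn n) beta gamma p q :
  p \in submodule_pred (poly_piece K w beta) ->
  q \in submodule_pred (poly_piece K w gamma) ->
  p * q \in submodule_pred (poly_piece K w (beta + gamma)).
Proof.
move=> /allP Hp /allP Hq; apply/allP => m /msuppM_le /allpairsP[[m1 m2] /=].
move=> [/Hp/eqP<- /Hq/eqP<- ->]; apply/eqP; rewrite -big_split; apply: eq_bigr => j _.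
by rewrite mnmDE mulrnDr.
Qed.

Lemma poly_piece_prod N (w : 'I_N -> Zn n) I (r : seq I) (beta : I -> Zn n) p :
  (forall i, p i \in submodule_pred (poly_piece K w (beta i))) ->
  \prod_(i <- r) p i \in submodule_pred (poly_piece K w (\sum_(i <- r) beta i)).
Proof.
move=> pb; elim: r => [|i r IH]; first by rewrite !big_nil poly_piece1.
by rewrite !big_cons poly_pieceM.
Qed.

Lemma poly_pieceXn N (w : 'I_N -> Zn n) beta p k :
  p \in submodule_pred (poly_piece K w beta) ->
  p ^+ k \in submodule_pred (poly_piece K w (beta *+ k)).
Proof.
move=> pb; elim: k => [|k IH]; first by rewrite mulr0n expr0 poly_piece1.
by rewrite mulrS exprS poly_pieceM.
Qed.

Definition Zn_of (m : 'X_{1..n}) : Zn n := [ffun i => (m i)%:Z].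

Lemma Zn_ofD m1 m2 : Zn_of (m1 + m2)%MM = Zn_of m1 + Zn_of m2.
Proof. by apply/ffunP => i; rewrite !ffunE mnmDE. Qed.

Lemma Zn_of_inj : injective Zn_of.
Proof. by move=> m m' /ffunP e; apply/mnmP => i; have := e i; rewrite !ffunE => -[]. Qed.

Lemma sum_ffun_mul N (w : 'I_N -> Zn n) (m : 'X_{1..N}) i :
  (\sum_j w j *+ m j) i = \sum_j w j i *+ m j.
Proof.
rewrite sum_ffunE; apply: eq_bigr => j _.
by elim: (m j) => [|k IH]; rewrite ?mulr0n ?ffunE // !mulrS ffunE IH.
Qed.

Lemma Zn_unit_sum (m : 'X_{1..n}) : \sum_j (Zn_unit j : Zn n) *+ m j = Zn_of m.
Proof.
apply/ffunP => i; rewrite sum_ffun_mul !ffunE (bigD1 i) //= big1 ?addr0.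
  by rewrite ffunE eqxx -[RHS]natz.
by move=> j ji; rewrite ffunE eq_sym (negbTE ji) mul0rn.
Qed.

Lemma gradAX (m : 'X_{1..n}) : 'X_[m] \in submodule_pred (@gradA n K (Zn_of m)).
Proof. by rewrite -Zn_unit_sum poly_pieceX. Qed.

Lemma poly_piece_ind N (w : 'I_N -> Zn n) beta (Pr : {mpoly K[N]} -> Prop) :
  Pr 0 -> (forall a p q, Pr p -> Pr q -> Pr (a *: p + q)) ->
  (forall m : 'X_{1..N}, \sum_j w j *+ m j = beta -> Pr 'X_[m]) ->
  forall p, p \in submodule_pred (poly_piece K w beta) -> Pr p.
Proof.
move=> P0 PL PX p /allP Hp; rewrite [p]mpolyE big_seq.
elim/big_rec: _ => // m q /Hp/eqP mb Pq; apply: PL => //; exact: PX.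
Qed.

Lemma mpoly_ind_lin N (Pr : {mpoly K[N]} -> Prop) :
  Pr 0 -> (forall a p q, Pr p -> Pr q -> Pr (a *: p + q)) ->
  (forall m : 'X_{1..N}, Pr 'X_[m]) -> forall p, Pr p.
Proof.
by move=> P0 PL PX p; rewrite [p]mpolyE; elim/big_rec: _ => // m q _; apply: PL.
Qed.

End Pieces.

(** * The face ring *)

Section FaceRing.
Variables (n : nat) (K : fieldType).
Variables (d : Order.disp_t) (P : finBPOrderType d) (P_simplicial : simplicial_poset P).
Variables (x : 'I_n -> P) (x_vertices : vertex_labelling x).

Notation A := {mpoly K[n]}.
Notation S := {mpoly K[#|P|]}.
Notation FR := (face_ring K P).
Notation M := (Defs.restrict (@mpolyC n K) (face_module K x)).

Definition supp_mnm (y : P) : 'X_{1..n} := [multinom (i \in supp x y : nat) | i < n].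

Lemma face_weightE j i : face_weight x j i = (i \in supp x (enum_val j))%:R.
Proof.
rewrite /face_weight sum_ffunE; case: (boolP (i \in _)) => iy.
  rewrite (bigD1 i) //= ffunE eqxx big1 ?addr0 // => k /andP[_ ki].
  by rewrite ffunE eq_sym (negbTE ki).
rewrite big1 // => k ky; rewrite ffunE; case: eqP => // ik.
by rewrite ik ky in iy.
Qed.

Lemma face_weight_supp y : face_weight x (enum_rank y) = Zn_of (supp_mnm y).
Proof. by apply/ffunP => i; rewrite face_weightE enum_rankK ffunE mnmE natz. Qed.

(** Restriction to the face [w], whose own face ring is a polynomial ring: faces
    of [w] become the products of their vertices, the others vanish. *)
Definition restr_var (w : P) (j : 'I_#|P|) : A :=
  (enum_val j <= w)%O%:R *: 'X_[supp_mnm (enum_val j)].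

Definition restr (w : P) : S -> A := mmap (@mpolyC n K) (restr_var w).
HB.instance Definition _ w := GRing.RMorphism.copy (restr w)
  (mmap (@mpolyC n K) (restr_var w)).

Lemma restr_face_var w y : restr w (face_var K y) = (y <= w)%O%:R *: 'X_[supp_mnm y].
Proof.
by rewrite /restr /face_var mmapX mmap1U /restr_var enum_rankK.
Qed.

Lemma restrZ w a p : restr w (a *: p) = a *: restr w p.
Proof. by rewrite /restr mmapZ mul_mpolyC. Qed.

Lemma supp_mnmUI (y z q g : P) : supp x q = supp x y :|: supp x z ->
  supp x g = supp x y :&: supp x z ->
  (supp_mnm y + supp_mnm z = supp_mnm g + supp_mnm q)%MM.
Proof.
move=> Uq Ig; apply/mnmP => i; rewrite !mnmDE !mnmE Uq Ig !inE.
by case: (x i <= y)%O; case: (x i <= z)%O.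
Qed.

(** If [u] and [y] lie below [w], then exactly one of their minimal upper bounds
    does, and the product of two squarefree monomials is the product of their
    greatest common divisor and their least common multiple. *)
Lemma restr_relation w p : face_relation p -> restr w p = 0.
Proof.
case=> [->|[u [y]]].
  rewrite raddfB /= restr_face_var le0x scale1r rmorph1 [supp_mnm _](_ : _ = 0%MM).
    by rewrite mpolyX0 subrr.
  by apply/mnmP => i; rewrite mnmE mnm0E (supp_bot P_simplicial x_vertices) inE.
have ub q : q \in mub [set: P] u y -> (u <= q)%O && (y <= q)%O.
  by rewrite (mubE P_simplicial x_vertices) => /and3P[-> ->].
case: ifPn => [/eqP m0|m0] ->.
  rewrite rmorphM /= !restr_face_var -scalerAl -scalerAr scalerA -natrM mulnb.
  case: (boolP (_ && _)) => [/andP[uw yw]|_]; last by rewrite scale0r.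
  have Sw : supp x u :|: supp x y \subset supp x w.
    by rewrite subUset !(suppS P_simplicial x_vertices).
  have [fw fs] := faceP P_simplicial x_vertices Sw.
  suff : face x w (supp x u :|: supp x y) \in mub [set: P] u y by rewrite m0 inE.
  by rewrite (mubE P_simplicial x_vertices) !(le_face P_simplicial x_vertices) // subsetUl subsetUr fs /=.
rewrite raddfB /= !rmorphM /= raddf_sum /= !restr_face_var; apply/eqP; rewrite subr_eq0.
have /set0Pn[q0 q0m] := m0.
have [uq0 yq0] := andP (ub _ q0m).
have [gs gv] := glbP P_simplicial x_vertices uq0 yq0.
case: (boolP ((u <= w)%O && (y <= w)%O)) => [/andP[uw yw]|]; last first.
  move=> N; rewrite -scalerAl -scalerAr scalerA -natrM mulnb (negbTE N) scale0r.
  rewrite big1 ?mulr0 // => q /ub/andP[uq yq]; rewrite restr_face_var.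
  case: (boolP (q <= w)%O) => qw; last by rewrite scale0r.
  by rewrite (le_trans uq qw) (le_trans yq qw) in N.
have Sw : supp x u :|: supp x y \subset supp x w.
  by rewrite subUset !(suppS P_simplicial x_vertices).
have [fw fs] := faceP P_simplicial x_vertices Sw; set f := face _ _ _ in fw fs.
have fm : f \in mub [set: P] u y.
  by rewrite (mubE P_simplicial x_vertices) !(le_face P_simplicial x_vertices) // subsetUl subsetUr fs /=.
rewrite (bigD1 f) //= restr_face_var big1 ?addr0; last first.
  move=> q /andP[qm qf]; rewrite restr_face_var; case: (boolP (q <= w)%O) => qw; last by rewrite scale0r.
  case/eqP: qf; apply: (supp_eq P_simplicial x_vertices qw fw).
  by move: qm; rewrite (mubE P_simplicial x_vertices) => /and3P[_ _ /eqP->].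
have gw : (glb u y <= w)%O.
  by apply: le_trans uw; have := gv (glb u y); rewrite lexx => /esym/andP[].
by rewrite uw yw gw fw !scale1r -!mpolyXD (supp_mnmUI fs gs).
Qed.

Lemma restr_ideal w p : p \in @face_ideal K d P -> restr w p = 0.
Proof.
move=> /asboolP[s Gs ->]; rewrite raddf_sum big_seq big1 // => c /Gs Gc.
by rewrite /= rmorphM /= (restr_relation w Gc) mulr0.
Qed.

Lemma face_proj_eq (p q : S) : (face_proj p == face_proj q) = (p - q \in @face_ideal K d P).
Proof. by rewrite [RHS]Quotient.idealrBE. Qed.

(** Jointly injective ([face_grading_basis]), which reduces the linear algebra
    of the face ring to comparing coefficients of polynomials. *)
Definition Phi (w : P) (a : FR) : A := restr w (repr a).

Lemma PhiE w p : Phi w (face_proj p) = restr w p.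
Proof.
apply/eqP; rewrite -subr_eq0 /Phi -raddfB; apply/eqP/restr_ideal.
by rewrite -face_proj_eq /face_proj reprK.
Qed.

Lemma face_projK (a : FR) : face_proj (repr a) = a.
Proof. exact: reprK. Qed.

Lemma PhiM w a b : Phi w (a * b) = Phi w a * Phi w b.
Proof. by rewrite -[a]face_projK -[b]face_projK -rmorphM /= !PhiE rmorphM. Qed.

Lemma scaleME (k : K) (a : M) : k *: a = (face_proj k%:MP * (a : FR) : FR).
Proof.
rewrite -[LHS]/(face_structure x k%:MP * (a : FR)); congr (_ * _).
by rewrite /face_structure mmapC.
Qed.

Lemma Phi_linear w k a b :
  Phi w (face_proj k%:MP * a + b) = k *: Phi w a + Phi w b.
Proof.
rewrite -[a]face_projK -[b]face_projK -rmorphM -rmorphD !PhiE rmorphD.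
by rewrite mul_mpolyC /= restrZ.
Qed.

Lemma Phi0 w : Phi w 0 = 0.
Proof. by rewrite -(rmorph0 (@face_proj K d P)) PhiE rmorph0. Qed.

Lemma face_module_scale (p : A) (a : face_module K x) :
  p *: a = (face_structure x p * (a : FR) : FR).
Proof. by []. Qed.

Lemma Phi_var w i k (a : face_module K x) : (0 < k)%N ->
  Phi w ('X_i ^+ k *: a) = if i \in supp x w then 'X_i ^+ k * Phi w a else 0.
Proof.
move=> k_gt0; rewrite face_module_scale PhiM /face_structure PhiE !rmorphXn /=.
rewrite mmapX mmap1U restr_face_var inE.
have -> : supp_mnm (x i) = U_(i)%MM.
  by apply/mnmP => j; rewrite mnmE mnm1E (supp_vertex x_vertices) inE eq_sym.
case: (x i <= w)%O; first by rewrite scale1r.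
by rewrite scale0r expr0n eqn0Ngt k_gt0 /= mul0r.
Qed.

Lemma face_proj_ideal (p : S) : p \in @face_ideal K d P -> face_proj p = 0.
Proof.
by move=> pI; apply/eqP; rewrite -(rmorph0 (@face_proj K d P)) face_proj_eq subr0.
Qed.

Lemma face_proj_relation (p : S) : face_relation p -> face_proj p = 0.
Proof.
move=> rp; apply: face_proj_ideal; apply/asboolP; exists [:: (1, p)].
  by move=> c; rewrite inE => /eqP->.
by rewrite big_seq1 scale1r.
Qed.

Definition face_elt (y : P) : FR := face_proj (face_var K y).

Lemma face_elt_bot : face_elt \bot%O = 1.
Proof.
apply/eqP; rewrite -subr_eq0 -(rmorph1 (@face_proj K d P)) -rmorphB /=.
by rewrite face_proj_relation //; left.
Qed.

Lemma face_elt_mul (w y : P) : face_elt w * face_elt y =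
  face_elt (glb w y) * \sum_(z in mub [set: P] w y) face_elt z.
Proof.
have [m0|m0] := eqVneq (mub [set: P] w y) set0.
  rewrite [in RHS]m0 big_set0 mulr0 /face_elt -rmorphM.
  by apply: face_proj_relation; right; exists w, y; rewrite m0 eqxx.
apply/eqP; rewrite -subr_eq0 /face_elt -rmorphM /= -raddf_sum -rmorphM -rmorphB /=.
rewrite face_proj_relation //; right; exists w, y.
by rewrite (negbTE m0).
Qed.

Definition mon (s : seq P) : FR := \prod_(y <- s) face_elt y.

Definition mon_degree (s : seq P) : 'X_{1..n} := [multinom count (fun y => (x i <= y)%O) s | i < n].

Lemma mon_degree_cons y s : mon_degree (y :: s) = (supp_mnm y + mon_degree s)%MM.
Proof. by apply/mnmP => i; rewrite mnmDE !mnmE /= inE. Qed.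

(** The bound [t] allows a factor below it to be put in front of every chain. *)
Definition chain_sum (t : P) (mu : 'X_{1..n}) (a : FR) :=
  exists2 r : seq (seq P), (forall s, s \in r -> path <=%O t s /\ mon_degree s = mu) &
    a = \sum_(s <- r) mon s.

Lemma chain_sum_sum t mu (I : eqType) (r : seq I) (p : pred I) (F : I -> FR) :
  (forall i, p i -> chain_sum t mu (F i)) -> chain_sum t mu (\sum_(i <- r | p i) F i).
Proof.
move=> H; elim/big_rec: _ => [|i a /H[r1 H1 ->] [r2 H2 ->]].
  by exists [::]; rewrite ?big_nil.
exists (r1 ++ r2); last by rewrite big_cat.
by move=> s; rewrite mem_cat => /orP[/H1|/H2].
Qed.

Lemma chain_sum_mul t y mu a : (t <= y)%O -> chain_sum y mu a ->
  chain_sum t (supp_mnm y + mu)%MM (face_elt y * a).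
Proof.
move=> ty [r H ->]; exists [seq y :: s | s <- r].
  by move=> _ /mapP[s /H[ps <-] ->]; rewrite /= ty ps mon_degree_cons.
by rewrite big_map mulr_sumr; apply: eq_bigr => s _; rewrite /mon big_cons.
Qed.

Lemma chain_sum_le t t' mu a : (t <= t')%O -> chain_sum t' mu a -> chain_sum t mu a.
Proof.
move=> tt' [r H ->]; exists r => // s /H[ps ws]; split=> //.
by case: s ps {ws} => //= y s /andP[t'y ->]; rewrite (le_trans tt' t'y).
Qed.

(** Straightening: multiplying the smallest member of a chain by [y] first
    makes the factor [glb] lie below everything else, so that only the
    minimal upper bounds have to be multiplied into the rest of the chain. *)
Lemma straighten t y s : path <=%O t s -> (t <= y)%O ->
  chain_sum t (supp_mnm y + mon_degree s)%MM (face_elt y * mon s).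
Proof.
elim: s t y => [|z s IH] t y.
  move=> _ ty; apply: (chain_sum_mul ty); exists [:: [::]].
    by move=> s; rewrite inE => /eqP->.
  by rewrite big_seq1.
move=> /= /andP[tz zs] ty; rewrite /mon big_cons -/(mon s) mulrA face_elt_mul.
rewrite -mulrA mulr_suml mulr_sumr; apply: chain_sum_sum => w wm.
have [yw [zw /eqP sw]] : (y <= w)%O /\ (z <= w)%O /\ supp x w == supp x y :|: supp x z.
  by move: wm; rewrite (mubE P_simplicial x_vertices) => /and3P[].
have [gs gv] := glbP P_simplicial x_vertices yw zw.
have [gy gz] : (glb y z <= y)%O /\ (glb y z <= z)%O.
  by have := gv (glb y z); rewrite lexx => /esym/andP.
rewrite mon_degree_cons addmA (supp_mnmUI sw gs) -addmA.
apply: chain_sum_mul; first by rewrite gv ty.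
exact: chain_sum_le gz (IH z w zs zw).
Qed.

Lemma mon_chain_sum s : chain_sum \bot%O (mon_degree s) (mon s).
Proof.
elim: s => [|y s [r H E]].
  exists [:: [::]]; last by rewrite big_seq1.
  by move=> s; rewrite inE => /eqP->.
rewrite /mon big_cons -/(mon s) E mulr_sumr big_seq mon_degree_cons.
apply: chain_sum_sum => s' /H[ps' <-]; exact: straighten (le0x _).
Qed.

Definition supp_deg (mu : 'X_{1..n}) : {set 'I_n} := [set i | (0 < mu i)%N].

(** The unique chain monomial of degree [mu] with top [z]: its members are the
    faces of [z] carried by the superlevel sets of [mu]. *)
Definition chain_mon (z : P) (mu : 'X_{1..n}) : FR :=
  \prod_(t < mdeg mu) face_elt (face x z [set i | (t < mu i)%N]).

(** A chain is determined by its top [z] and its degree: its members have nested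
    supports, so that the labels of the member in position [t] are those that
    occur more than [t] times. Superlevel sets beyond the maximum are empty
    and contribute [face_elt \bot = 1], so any bound [N] will do. *)
Lemma mon_superlevel (z : P) (s : seq P) N : sorted >=%O s -> all (fun y => (y <= z)%O) s ->
  (forall i, (mon_degree s i <= N)%N) ->
  mon s = \prod_(t < N) face_elt (face x z [set i | (t < mon_degree s i)%N]).
Proof.
elim: s N => [|y s IH] N.
  move=> _ _ _; rewrite /mon big_nil big1 // => t _.
  have -> : [set i | (t < mon_degree [::] i)%N] = set0.
    by apply/setP => i; rewrite !inE mnmE ltn0.
  rewrite -(supp_bot P_simplicial x_vertices) (face_eq P_simplicial x_vertices) ?face_elt_bot //; exact: le0x.
move=> ys /= /andP[yz sz] bN.
have ss : sorted >=%O s by exact: path_sorted ys.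
have sy u : u \in s -> (u <= y)%O.
  have := order_path_min _ ys => /(_ _)/allP; apply.
  by move=> a b c /= ab bc; exact: le_trans bc ab.
have wS i : (0 < mon_degree s i)%N -> i \in supp x y.
  by rewrite mnmE -has_count => /hasP[u /sy uy iu]; rewrite inE (le_trans iu uy).
rewrite /mon big_cons -/(mon s).
have [y0|y0] := eqVneq y \bot%O.
  have w0 : mon_degree (y :: s) = mon_degree s.
    rewrite mon_degree_cons y0; apply/mnmP => i.
    by rewrite mnmDE mnmE (supp_bot P_simplicial x_vertices) inE.
  rewrite y0 face_elt_bot mul1r -y0 w0; apply: IH => // i.
  by rewrite -w0.
have /set0Pn[i0 i0y] : supp x y != set0.
  apply: contraNneq y0 => sy0; apply/eqP.
  by apply: (supp_eq P_simplicial x_vertices (lexx y) (le0x y)); rewrite sy0 (supp_bot P_simplicial x_vertices).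
have wE i : mon_degree (y :: s) i = ((i \in supp x y) + mon_degree s i)%N.
  by rewrite mon_degree_cons mnmDE mnmE.
case: N bN => [/(_ i0)|N bN]; first by rewrite wE i0y.
rewrite big_ord_recl /=; congr (_ * _).
  have -> : [set i | (0 < mon_degree (y :: s) i)%N] = supp x y.
    apply/setP => i; rewrite inE wE; case: (boolP (i \in supp x y)) => //= iy.
    by rewrite add0n; apply/negbTE; apply: contraNN iy; exact: wS.
  by rewrite (face_eq P_simplicial x_vertices).
rewrite (IH N) //; last first.
  move=> i; have := bN i; rewrite wE; have := wS i.
  by case: (i \in _); case: (mon_degree s i) => [|k] //= /(_ isT).
apply: eq_bigr => t _; congr (face_elt (face x z _)); apply/setP => i; rewrite !inE.
rewrite wE /= /bump /= add1n; have := wS i.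
by case: (i \in _); case: (mon_degree s i) => [|k] //= /(_ isT).
Qed.

Lemma leq_mdeg (mu : 'X_{1..n}) i : (mu i <= mdeg mu)%N.
Proof. by rewrite mdegE (bigD1 i) //= leq_addr. Qed.

Lemma mon_chain_top s : path <=%O \bot%O s ->
  mon s = chain_mon (last \bot%O s) (mon_degree s) /\ supp x (last \bot%O s) = supp_deg (mon_degree s).
Proof.
move=> ps; set z := last _ _.
have ss : sorted <=%O s by exact: path_sorted ps.
have sz y : y \in s -> (y <= z)%O.
  move: ps; rewrite /z; case: (lastP s) => // s' u.
  rewrite last_rcons => ps; rewrite mem_rcons inE => /predU1P[->//|ys'].
  have : sorted <=%O (rcons s' u) by exact: path_sorted ps.
  rewrite -[sorted _ _]rev_sorted rev_rcons /= => pu.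
  have /allP := order_path_min (fun a b c ab bc => le_trans bc ab) pu.
  by apply; rewrite mem_rev.
split.
  have wr : mon_degree (rev s) = mon_degree s by apply/mnmP => i; rewrite !mnmE count_rev.
  have -> : mon s = mon (rev s) by apply: perm_big; rewrite perm_sym perm_rev.
  rewrite /chain_mon -wr; apply: mon_superlevel; first by rewrite rev_sorted.
    by apply/allP => y; rewrite mem_rev; exact: sz.
  by move=> i; exact: leq_mdeg.
apply/setP => i; rewrite !inE mnmE -has_count; apply/idP/hasP => [iz|[y ys iy]].
  move: iz; rewrite /z; case: (s) => [|y s'] /= iz.
    by have := supp_bot P_simplicial x_vertices => /setP/(_ i); rewrite !inE iz.
  by exists (last y s') => //; exact: mem_last.
exact: le_trans iy (sz y ys).
Qed.

Lemma Phi_face_elt w y : Phi w (face_elt y) = (y <= w)%O%:R *: 'X_[supp_mnm y].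
Proof. by rewrite PhiE restr_face_var. Qed.

Lemma Phi1 w : Phi w 1 = 1.
Proof. by rewrite -(rmorph1 (@face_proj K d P)) PhiE rmorph1. Qed.

Lemma Phi_mon w s : Phi w (mon s) = (all (fun y => (y <= w)%O) s)%:R *: 'X_[mon_degree s].
Proof.
elim: s => [|y s IH].
  rewrite /mon big_nil Phi1 /= scale1r (_ : mon_degree [::] = 0%MM) ?mpolyX0 //.
rewrite /mon big_cons -/(mon s) PhiM IH Phi_face_elt -scalerAl -scalerAr scalerA.
by rewrite -natrM mulnb -mpolyXD mon_degree_cons.
Qed.

Lemma Phi_chain_mon w z mu : supp x z = supp_deg mu ->
  Phi w (chain_mon z mu) = (z <= w)%O%:R *: 'X_[mu].
Proof.
move=> zmu.
have Lz t : [set i | (t < mu i)%N] \subset supp x z.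
  by rewrite zmu; apply/subsetP => i; rewrite !inE; exact: leq_ltn_trans.
have -> : chain_mon z mu = mon [seq face x z [set i | (val t < mu i)%N] | t <- enum 'I_(mdeg mu)].
  by rewrite /mon big_map big_enum.
rewrite Phi_mon; set s := map _ _.
have ws : mon_degree s = mu.
  apply/mnmP => i; rewrite mnmE count_map.
  rewrite (eq_count (a2 := fun t : 'I_(mdeg mu) => (val t < mu i)%N)); last first.
    by move=> t /=; have := supp_face P_simplicial x_vertices (Lz t) => /setP/(_ i); rewrite !inE.
  rewrite -(count_map val (fun t => (t < mu i)%N)) val_enum_ord.
  rewrite -(subnKC (leq_mdeg mu i)) iotaD count_cat add0n.
  rewrite (_ : count _ (iota 0 _) = mu i); last first.
    rewrite -[RHS](size_iota 0); apply/eqP; rewrite -all_count; apply/allP => t.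
    by rewrite mem_iota.
  rewrite (_ : count _ _ = 0%N) ?addn0 //; apply/eqP; rewrite -leqn0 leqNgt -has_count.
  by apply/hasPn => t; rewrite mem_iota -leqNgt => /andP[].
rewrite ws; congr (_%:R *: _); congr nat_of_bool; apply/allP/idP => [H|zw y].
  have [z0|z0] := eqVneq z \bot%O; first by rewrite z0 le0x.
  have [i iz] : exists i, i \in supp x z.
    apply/set0Pn; apply: contraNneq z0 => sy0; apply/eqP.
    by apply: (supp_eq P_simplicial x_vertices (lexx z) (le0x z)); rewrite sy0 (supp_bot P_simplicial x_vertices).
  have mi : (0 < mdeg mu)%N.
    by apply: leq_trans (leq_mdeg mu i); move: iz; rewrite zmu inE.
  have := H z; apply; apply/mapP; exists (Ordinal mi); rewrite ?mem_enum //=.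
  by rewrite -/(supp_deg mu) -zmu (face_eq P_simplicial x_vertices).
by move=> /mapP[t _ ->]; exact: le_trans (face_le P_simplicial x_vertices (Lz t)) zw.
Qed.

Lemma face_gradingP beta (a : M) :
  reflect (exists2 p, p \in submodule_pred (poly_piece K (face_weight x) beta) &
     a = face_proj p) (a \in submodule_pred (face_grading K x beta)).
Proof. exact: asboolP. Qed.

Lemma monomial_mon (m : 'X_{1..#|P|}) : exists2 s,
  face_proj 'X_[m] = mon s & Zn_of (mon_degree s) = \sum_j face_weight x j *+ m j.
Proof.
rewrite mpolyXE_id rmorph_prod /=.
elim/big_rec2: _ => [|j a mu _ [s -> <-]].
  exists [::]; rewrite /mon ?big_nil //.
  by apply/ffunP => i; rewrite !ffunE mnmE.
rewrite rmorphXn /= -/(face_elt _) -[j]enum_valK -/(face_elt (enum_val j)).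
elim: (m _) => [|k [s' E W]]; first by exists s; rewrite ?expr0 ?mul1r ?mulr0n ?add0r.
exists (enum_val j :: s').
  by rewrite exprS -mulrA E /mon big_cons.
by rewrite mon_degree_cons Zn_ofD W mulrS face_weight_supp addrA.
Qed.

Lemma face_grading_ind mu (Pr : FR -> Prop) :
  Pr 0 -> (forall k a b, Pr a -> Pr b -> Pr (face_proj k%:MP * a + b)) ->
  (forall s, mon_degree s = mu -> Pr (mon s)) ->
  forall a : M, a \in submodule_pred (face_grading K x (Zn_of mu)) -> Pr a.
Proof.
move=> P0 PL PX _ /face_gradingP[p pm ->]; move: p pm.
apply: poly_piece_ind.
- by rewrite rmorph0.
- move=> k p q Pp Pq; have := PL k _ _ Pp Pq.
  by rewrite -rmorphM mul_mpolyC -rmorphD.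
- by move=> m mb; have [s -> ws] := monomial_mon m; apply/PX/Zn_of_inj; rewrite ws.
Qed.

Lemma face_grading_neg (beta : Zn n) i (a : M) : (beta i < 0)%R ->
  a \in submodule_pred (face_grading K x beta) -> a = 0.
Proof.
move=> bi /face_gradingP[p pb ->]; rewrite -[RHS](rmorph0 (@face_proj K d P)); congr face_proj.
move: p pb; apply: poly_piece_ind => // [k p q -> ->|m mb]; first by rewrite scaler0 addr0.
have [s _ ws] := monomial_mon m; move: bi.
by rewrite -mb -ws ffunE.
Qed.

Definition Zn_mnm (beta : Zn n) : 'X_{1..n} := [multinom `|beta i|%N | i < n].

Lemma Zn_mnmK (beta : Zn n) : (forall i, 0 <= beta i) -> Zn_of (Zn_mnm beta) = beta.
Proof. by move=> b0; apply/ffunP => i; rewrite ffunE mnmE gez0_abs. Qed.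

(** The coefficient on the face [w] of an element of degree [mu]. *)
Definition face_coef (w : P) (mu : 'X_{1..n}) (a : FR) : K := (Phi w a)@_mu.

Lemma face_coef0 w mu : face_coef w mu 0 = 0.
Proof. by rewrite /face_coef Phi0 mcoeff0. Qed.

Lemma face_coef_linear w mu k a b :
  face_coef w mu (face_proj k%:MP * a + b) = k * face_coef w mu a + face_coef w mu b.
Proof. by rewrite /face_coef Phi_linear mcoeffD mcoeffZ. Qed.

Lemma face_coef_mon w mu s : mon_degree s = mu ->
  face_coef w mu (mon s) = (all (fun y => (y <= w)%O) s)%:R.
Proof. by move=> <-; rewrite /face_coef Phi_mon mcoeffZ mcoeffX eqxx mulr1. Qed.

Lemma face_coef_chain_mon w z mu : supp x z = supp_deg mu ->
  face_coef w mu (chain_mon z mu) = (z <= w)%O%:R.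
Proof. by move=> zmu; rewrite /face_coef Phi_chain_mon // mcoeffZ mcoeffX eqxx mulr1. Qed.

(** A face whose support lies in that of [v] is below [w] if and only if it is
    below [v]. *)
Lemma face_coef_face mu v w (a : M) : a \in submodule_pred (face_grading K x (Zn_of mu)) ->
  (v <= w)%O -> supp x v = supp_deg mu -> face_coef v mu a = face_coef w mu a.
Proof.
move=> aM vw vmu; move: a aM; apply: face_grading_ind => [|k a b Ha Hb|s ws].
- by rewrite !face_coef0.
- by rewrite !face_coef_linear Ha Hb.
- rewrite !face_coef_mon //; congr (nat_of_bool _)%:R.
  apply: eq_in_all => y ys; apply/idP/idP => [|yw]; first by move/le_trans; apply.
  rewrite (supp_le P_simplicial x_vertices yw vw) vmu; apply/subsetP => i; rewrite -ws !inE mnmE.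
  by move=> iy; rewrite -has_count; apply/hasP; exists y.
Qed.

Lemma chain_mon_grading z mu : supp x z = supp_deg mu ->
  (chain_mon z mu : M) \in submodule_pred (face_grading K x (Zn_of mu)).
Proof.
move=> zmu; apply/face_gradingP.
have Lz t : [set i | (t < mu i)%N] \subset supp x z.
  by rewrite zmu; apply/subsetP => i; rewrite !inE; exact: leq_ltn_trans.
exists (\prod_(t < mdeg mu) face_var K (face x z [set i | (t < mu i)%N])); last first.
  by rewrite rmorph_prod.
have -> : Zn_of mu = \sum_(t < mdeg mu)
    face_weight x (enum_rank (face x z [set i | (t < mu i)%N])).
  apply/ffunP => i; rewrite sum_ffunE ffunE.
  under eq_bigr => t _.
    rewrite face_weightE enum_rankK (supp_face P_simplicial x_vertices (Lz t)) inE.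
    over.
  rewrite -[LHS]natz -natr_sum; congr _%:R.
  rewrite -(big_mkord xpredT (fun t => ((t < mu i)%N : nat))) (big_cat_nat (leq0n _) (leq_mdeg mu i)) /=.
  rewrite big_nat_cond (eq_bigr (fun=> 1%N)); last by move=> t /andP[/andP[_ ->]].
  rewrite -big_nat_cond sum_nat_const_nat subn0 muln1 big_nat_cond big1 ?addn0 //.
  by move=> t /andP[/andP[mt _] _]; rewrite ltnNge mt.
by apply: poly_piece_prod => t; exact: poly_piece_var.
Qed.

(** Straightening makes the chain monomials of degree [mu] span, with one
    monomial for each face carried by the support of [mu]; the functionals
    [face_coef z mu] are dual to them ([face_coef_chain_mon]), so they are a basis. *)
Lemma face_grading_basis mu (a : M) : a \in submodule_pred (face_grading K x (Zn_of mu)) ->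
  (a : FR) = \sum_(z | supp x z == supp_deg mu) face_proj (face_coef z mu a)%:MP * chain_mon z mu.
Proof.
pose expand (a : FR) : FR :=
  \sum_(z | supp x z == supp_deg mu) face_proj (face_coef z mu a)%:MP * chain_mon z mu.
have expand0 : expand 0 = 0.
  by apply: big1 => z _; rewrite face_coef0 rmorph0 mul0r.
have expandL k u v : expand (face_proj k%:MP * u + v) = face_proj k%:MP * expand u + expand v.
  rewrite /expand mulr_sumr -big_split; apply: eq_bigr => z _ /=.
  by rewrite face_coef_linear mpolyCD mpolyCM rmorphD rmorphM mulrDl mulrA.
move=> aM; rewrite -/(expand a).
move: (a : M) aM; apply: face_grading_ind => [|k u v Ha Hb|s ws].
- by rewrite expand0.
- by rewrite expandL -Ha -Hb.
have expand_chain_mon z0 : supp x z0 = supp_deg mu -> chain_mon z0 mu = expand (chain_mon z0 mu).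
  move=> zmu; rewrite /expand (bigD1 z0) ?zmu //= face_coef_chain_mon // lexx.
  rewrite rmorph1 mul1r big1 ?addr0 // => z /andP[/eqP zs zz0].
  rewrite face_coef_chain_mon //; case: (boolP (z0 <= z)%O) => [zz|_]; last by rewrite rmorph0 mul0r.
  by case/eqP: zz0; apply: (supp_eq P_simplicial x_vertices (lexx z) zz); rewrite zs zmu.
have [r Hr ->] := mon_chain_sum s; rewrite ws in Hr.
elim: r Hr => [|s' r IH] Hr; first by rewrite big_nil expand0.
rewrite !big_cons; have [ps' ws'] := Hr s' (mem_head _ _).
have [-> zmu] := mon_chain_top ps'; rewrite ws' in zmu *.
have {}IH : \sum_(j <- r) mon j = expand (\sum_(j <- r) mon j).
  by apply: IH => t tr; apply: Hr; rewrite inE tr orbT.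
have := expandL 1 (chain_mon (last \bot%O s') mu) (\sum_(j <- r) mon j).
by rewrite mpolyC1 rmorph1 !mul1r -IH -expand_chain_mon.
Qed.

End FaceRing.

(** * Graded free modules *)

Section GradedFree.
Variables (n : nat) (K : fieldType).
Notation A := {mpoly K[n]}.

(** The homogeneous component of degree [beta]. *)
Definition hcomp (beta : Zn n) (p : A) : A :=
  \sum_(m <- msupp p | Zn_of m == beta) p@_m *: 'X_[m].

Lemma mcoeff_hcomp beta p m : (hcomp beta p)@_m = if Zn_of m == beta then p@_m else 0.
Proof.
rewrite /hcomp raddf_sum /=; case: ifP => mb; last first.
  rewrite big1 // => m' m'b; rewrite mcoeffZ mcoeffX; case: eqP => [e|]; rewrite ?mulr0 //.
  by rewrite -e m'b in mb.
rewrite [in RHS](mpolyE p) raddf_sum /= big_mkcond; apply: eq_bigr => m' _.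
rewrite mcoeffZ mcoeffX; case: ifP => // m'b.
by case: eqP => [e|]; rewrite ?mulr0 //; rewrite e mb in m'b.
Qed.

Lemma hcomp_linear beta k p q : hcomp beta (k *: p + q) = k *: hcomp beta p + hcomp beta q.
Proof.
apply/mpolyP => m; rewrite mcoeffD mcoeffZ !mcoeff_hcomp mcoeffD mcoeffZ.
by case: ifP; rewrite // mulr0 addr0.
Qed.

Lemma hcompD beta p q : hcomp beta (p + q) = hcomp beta p + hcomp beta q.
Proof. by have := hcomp_linear beta 1 p q; rewrite !scale1r. Qed.

Lemma gradAP beta (p : A) :
  reflect (forall m, m \in msupp p -> Zn_of m = beta) (p \in submodule_pred (gradA K beta)).
Proof.
apply: (iffP allP) => [H m /H/eqP|H m /H <-]; last by rewrite Zn_unit_sum.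
by rewrite Zn_unit_sum.
Qed.

Lemma hcomp_grad beta p : hcomp beta p \in submodule_pred (gradA K beta).
Proof.
apply/gradAP => m; rewrite mcoeff_msupp mcoeff_hcomp.
by case: ifP => [/eqP//|]; rewrite eqxx.
Qed.

Lemma hcompE beta gamma p : p \in submodule_pred (gradA K gamma) ->
  hcomp beta p = if beta == gamma then p else 0.
Proof.
move=> /gradAP pg; apply/mpolyP => m; rewrite mcoeff_hcomp.
case: (boolP (m \in msupp p)) => [/[dup] mp /pg->|/memN_msupp_eq0 p0].
  by rewrite eq_sym; case: ifP; rewrite ?mcoeff0.
by rewrite p0 !if_same; case: ifP; rewrite ?mcoeff0 // p0.
Qed.

Lemma gradAM beta gamma (p q : A) : p \in submodule_pred (gradA K beta) ->
  q \in submodule_pred (gradA K gamma) -> p * q \in submodule_pred (gradA K (beta + gamma)).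
Proof. exact: poly_pieceM. Qed.

Section FreeModule.
Variables (r : nat) (s : 'I_r -> Zn n).

Lemma free_piece0 beta : free_piece s beta (0 : 'rV[A]_r).
Proof. by move=> j; rewrite mxE poly_piece0. Qed.

Lemma free_pieceD beta (u v : 'rV[A]_r) :
  free_piece s beta u -> free_piece s beta v -> free_piece s beta (u + v).
Proof.
move=> Hu Hv j; rewrite mxE -[u 0 j]scale1r.
exact: (submoduleP (gradA K _)).2 (Hu j) (Hv j).
Qed.

Lemma free_pieceZ beta gamma p (u : 'rV[A]_r) : p \in submodule_pred (gradA K gamma) ->
  free_piece s beta u -> free_piece s (gamma + beta) (p *: u).
Proof. by move=> Hp Hu j; rewrite mxE -addrA gradAM. Qed.

Lemma free_pieceB beta (u v : 'rV[A]_r) :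
  free_piece s beta u -> free_piece s beta v -> free_piece s beta (u - v).
Proof.
move=> Hu Hv j; rewrite !mxE addrC -[- v 0 j]scaleN1r.
exact: (submoduleP (gradA K _)).2 (Hv j) (Hu j).
Qed.

Lemma free_piece_delta j : free_piece s (s j) (delta_mx 0 j : 'rV[A]_r).
Proof.
move=> k; rewrite mxE eqxx /=; case: eqP => [->|_]; last exact: poly_piece0.
by rewrite subrr poly_piece1.
Qed.

Lemma free_piece_sum beta (I : finType) (F : I -> 'rV[A]_r) :
  (forall i, free_piece s beta (F i)) -> free_piece s beta (\sum_i F i).
Proof.
move=> H; elim/big_rec: _ => [|i u _ Hu]; first exact: free_piece0.
exact: free_pieceD.
Qed.

Definition hcomp_row (beta : Zn n) (u : 'rV[A]_r) : 'rV[A]_r :=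
  \row_j hcomp (beta - s j) (u 0 j).

Lemma hcomp_row_piece beta u : free_piece s beta (hcomp_row beta u).
Proof. by move=> j; rewrite mxE hcomp_grad. Qed.

Lemma hcomp_rowE beta gamma u : free_piece s gamma u ->
  hcomp_row beta u = if beta == gamma then u else 0.
Proof.
move=> Hu; apply/rowP => j; rewrite mxE (hcompE _ (Hu j)).
by rewrite (inj_eq (addIr _)); case: ifP; rewrite ?mxE.
Qed.

Lemma hcomp_rowD beta u v : hcomp_row beta (u + v) = hcomp_row beta u + hcomp_row beta v.
Proof. by apply/rowP => j; rewrite !mxE hcompD. Qed.

Lemma free_module_ind (Pr : 'rV[A]_r -> Prop) :
  Pr 0 -> (forall u v, Pr u -> Pr v -> Pr (u + v)) ->
  (forall beta u, free_piece s beta u -> Pr u) -> forall u, Pr u.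
Proof.
move=> P0 PD PH u; rewrite [u]row_sum_delta.
elim/big_rec: _ => // j v _; apply: (PD).
rewrite [u 0 j]mpolyE scaler_suml; elim/big_rec: _ => // m w _; apply: (PD).
apply: (PH (Zn_of m + s j)); apply: free_pieceZ; last exact: free_piece_delta.
rewrite -[_ *: _]addr0; apply: (submoduleP (gradA K _)).2; last exact: poly_piece0.
exact: gradAX.
Qed.

End FreeModule.

Definition is_graded r (s : 'I_r -> Zn n) r' (s' : 'I_r' -> Zn n) (f : 'rV[A]_r -> 'rV[A]_r') :=
  forall beta u, free_piece s beta u -> free_piece s' beta (f u).

Lemma hcomp_row_graded r (s : 'I_r -> Zn n) r' (s' : 'I_r' -> Zn n)
    (f : {linear 'rV[A]_r -> 'rV[A]_r'}) beta u :
  is_graded s s' f -> f (hcomp_row s beta u) = hcomp_row s' beta (f u).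
Proof.
move=> fh; elim/(free_module_ind (s := s)): u => [|u v Hu Hv|gamma u Hu].
- rewrite (_ : hcomp_row s beta 0 = 0) ?raddf0; last first.
    by rewrite (hcomp_rowE _ (free_piece0 s beta)) eqxx.
  by rewrite (hcomp_rowE _ (free_piece0 s' beta)) eqxx.
- by rewrite hcomp_rowD !linearD /= hcomp_rowD Hu Hv.
- rewrite (hcomp_rowE _ Hu) (hcomp_rowE _ (fh _ _ Hu)).
  by case: ifP; rewrite ?raddf0.
Qed.

(** Free modules are projective, in the graded sense. *)
Lemma free_lift r (s : 'I_r -> Zn n) r' (s' : 'I_r' -> Zn n) (W : lmodType A)
    (D : {linear 'rV[A]_r' -> W}) (f : {linear 'rV[A]_r -> W}) :
    (forall j, exists v, free_piece s' (s j) v /\ D v = f (delta_mx 0 j)) ->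
  exists g : {linear 'rV[A]_r -> 'rV[A]_r'}, is_graded s s' g /\ forall u, D (g u) = f u.
Proof.
move=> /choice[v vP]; exists (mulmxr (\matrix_j v j)); split=> [beta u Hu|u] /=.
  rewrite mulmx_sum_row; apply: free_piece_sum => j; rewrite rowK.
  rewrite -[beta](subrK (s j)); apply: free_pieceZ; [exact: Hu|exact: (vP j).1].
rewrite mulmx_sum_row raddf_sum [in RHS](row_sum_delta u) raddf_sum.
by apply: eq_bigr => j _ /=; rewrite rowK !linearZ_LR /= (vP j).2.
Qed.

(** Any preimage of a homogeneous element can be replaced by its homogeneous
    component of the same degree. *)
Lemma free_lift_exact r (s : 'I_r -> Zn n) r' (s' : 'I_r' -> Zn n) r'' (s'' : 'I_r'' -> Zn n)
    (D : {linear 'rV[A]_r' -> 'rV[A]_r''}) (f : {linear 'rV[A]_r -> 'rV[A]_r''}) :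
    is_graded s' s'' D -> is_graded s s'' f -> (forall u, exists v, D v = f u) ->
  exists g : {linear 'rV[A]_r -> 'rV[A]_r'}, is_graded s s' g /\ forall u, D (g u) = f u.
Proof.
move=> Dh fh ex; apply: free_lift => j.
have [v Dv] := ex (delta_mx 0 j); exists (hcomp_row s' (s j) v); split.
  exact: hcomp_row_piece.
rewrite (hcomp_row_graded _ _ Dh) Dv (hcomp_rowE _ (fh _ _ (free_piece_delta s j))).
by rewrite eqxx.
Qed.

End GradedFree.

(** * Independence of Ext from the resolution *)

Lemma dependent_choice (T : nat -> Type) (good : forall p, T p -> Prop)
    (R : forall p, T p -> T p.+1 -> Prop) :
    (exists t, good 0%N t) ->
    (forall p t, good p t -> exists2 t', good p.+1 t' & R p t t') ->
  exists2 s : forall p, T p, good 0%N (s 0%N) & forall p, R p (s p) (s p.+1).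
Proof.
move=> /cid[t0 g0] step.
have step' p (t : {t | good p t}) : {t' : {t' | good p.+1 t'} | R p (sval t) (sval t')}.
  case: t => t gt; have [t' gt' Rt] := cid2 (step p t gt).
  by exists (exist _ t' gt').
pose s := fix s p : {t : T p | good p t} :=
  match p with 0%N => exist _ t0 g0 | q.+1 => sval (step' q (s q)) end.
exists (fun p => sval (s p)) => [//|p].
exact: svalP (step' p (s p)).
Qed.

Section Comparison.
Variables (n : nat) (K : fieldType) (M : lmodType {mpoly K[n]}) (gM : grading M).
Notation A := {mpoly K[n]}.

(** A grading is a mere family of submodules; this supplies the homogeneous
    components needed to lift the augmentation by maps that preserve degrees. *)
Definition independent_grading := forall beta, exists pr : M -> M,
  [/\ forall a b, pr (a + b) = pr a + pr b,
      forall m : M, m \in submodule_pred (gM beta) -> pr m = m &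
      forall gamma (m : M), gamma != beta -> m \in submodule_pred (gM gamma) -> pr m = 0].

Hypothesis gM_ind : independent_grading.

Notation Fr F p := 'rV[A]_(res_rank F p).
Notation sh F p := (@res_shift _ _ _ _ F p).

Lemma res_dd (F : graded_resolution gM) p u : res_d F p (res_d F p.+1 u) = 0.
Proof. by apply/res_exactS; exists u. Qed.

Lemma res_aug_d (F : graded_resolution gM) u : res_aug F (res_d F 0 u) = 0.
Proof. by apply/res_exact0; exists u. Qed.

(** Each component lifts the previous one. The recursion carries along what the
    next lifting needs, namely that boundaries are sent to cycles. *)
Lemma comparison_map (F G : graded_resolution gM) :
  exists phi : forall p, {linear Fr F p -> Fr G p},
    [/\ forall p, is_graded (sh F p) (sh G p) (phi p),
        forall u, res_aug G (phi 0%N u) = res_aug F u &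
        forall p u, res_d G p (phi p.+1 u) = phi p (res_d F p u)].
Proof.
pose good p (f : {linear Fr F p -> Fr G p}) :=
  is_graded (sh F p) (sh G p) f /\
  match p return {linear Fr F p -> Fr G p} -> Prop with
  | 0%N => fun f => forall u, res_aug G (f u) = res_aug F u
  | q.+1 => fun f => forall u, res_d G q (f (res_d F q.+1 u)) = 0
  end f.
pose R p (f : {linear Fr F p -> Fr G p}) (f' : {linear Fr F p.+1 -> Fr G p.+1}) :=
  is_graded (sh F p.+1) (sh G p.+1) f' /\
  forall u, res_d G p (f' u) = f (res_d F p u).
have [||phi [h0 a0] H] := @dependent_choice (fun p => {linear Fr F p -> Fr G p}) good R.
- have [|g [gh gE]] := @free_lift _ _ _ (sh F 0%N) _ (sh G 0%N)
    M (res_aug G) (res_aug F).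
    move=> j; set b := res_shift j; have [v av] := res_aug_surj G (res_aug F (delta_mx 0 j)).
    exists (hcomp_row (sh G 0%N) b v); split; first exact: hcomp_row_piece.
    have [pr [prD pr1 pr0]] := gM_ind b.
    have Fe := res_aug_homog (free_piece_delta K (sh F 0%N) j).
    rewrite -[RHS](pr1 _ Fe) -av.
    have pr00 : pr 0 = 0 by apply: (addrI (pr 0)); rewrite -prD !addr0.
    elim/(free_module_ind (K := K) (s := sh G 0%N)): v {av} => [|u v Hu Hv|gamma u Hu].
    + by rewrite (hcomp_rowE _ (free_piece0 K (sh G 0%N) b)) eqxx (raddf0 (res_aug G)) pr00.
    + by rewrite hcomp_rowD !raddfD prD -Hu -Hv.
    + have au := res_aug_homog Hu; rewrite (hcomp_rowE _ Hu); case: eqP => [e|/eqP ne].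
        by rewrite pr1 // e.
      by rewrite raddf0 (pr0 gamma) // eq_sym.
  by exists g.
- move=> p f [fh fE].
  have [|||g [gh gE]] := @free_lift_exact _ _ _ (sh F p.+1) _
    (sh G p.+1) _ (sh G p) (res_d G p) (f \o res_d F p).
  + exact: res_d_homog.
  + by move=> beta u /res_d_homog/fh.
  + move=> u /=; case: p f fh fE u => [|p] f fh fE u.
      by apply/res_exact0; rewrite fE res_aug_d.
    by apply/res_exactS; rewrite fE.
  exists g => //; split=> // u; rewrite gE /= res_dd raddf0 //.
exists phi; split=> // [[//|p]|p u]; first exact: (H p).1.
exact: (H p).2.
Qed.

(** The same recursion, lifting [theta - h d] instead. *)
Lemma comparison_homotopy (F G : graded_resolution gM)
    (theta : forall p, {linear Fr F p -> Fr G p}) :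
    (forall p, is_graded (sh F p) (sh G p) (theta p)) ->
    (forall u, res_aug G (theta 0%N u) = 0) ->
    (forall p u, res_d G p (theta p.+1 u) = theta p (res_d F p u)) ->
  exists h : forall p, {linear Fr F p -> Fr G p.+1},
    [/\ forall p, is_graded (sh F p) (sh G p.+1) (h p),
        forall u, theta 0%N u = res_d G 0 (h 0%N u) &
        forall p u, theta p.+1 u = res_d G p.+1 (h p.+1 u) + h p (res_d F p u)].
Proof.
move=> th a0 thd.
pose good p (h : {linear Fr F p -> Fr G p.+1}) :=
  [/\ is_graded (sh F p) (sh G p.+1) h,
  match p return {linear Fr F p -> Fr G p.+1} -> Prop with
  | 0%N => fun h => forall u, theta 0%N u = res_d G 0 (h u)
  | q.+1 => fun h => True
  end h & forall u, res_d G p (h (res_d F p u)) = theta p (res_d F p u)].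
pose R p (h : {linear Fr F p -> Fr G p.+1}) (h' : {linear Fr F p.+1 -> Fr G p.+2}) :=
  is_graded (sh F p.+1) (sh G p.+2) h' /\
  forall u, theta p.+1 u = res_d G p.+1 (h' u) + h (res_d F p u).
have [||h [h0 E0 _] H] := @dependent_choice (fun p => {linear Fr F p -> Fr G p.+1}) good R.
- have [|||g [gh gE]] := @free_lift_exact _ _ _ (sh F 0%N) _
    (sh G 1%N) _ (sh G 0%N) (res_d G 0) (theta 0%N).
  + exact: res_d_homog.
  + exact: th.
  + by move=> u; apply/res_exact0.
  by exists g; split.
- move=> p h [hh _ hE].
  have [|||g [gh gE]] := @free_lift_exact _ _ _ (sh F p.+1) _
    (sh G p.+2) _ (sh G p.+1) (res_d G p.+1)
    (theta p.+1 \- (h \o res_d F p)).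
  + exact: res_d_homog.
  + move=> beta u Hu; apply: free_pieceB; first exact: th.
    by apply: hh; exact: res_d_homog.
  + by move=> u; apply/res_exactS; rewrite /= raddfB /= thd hE subrr.
  exists g; last by split=> // u; rewrite gE /= subrK.
  split=> // u; rewrite gE /= res_dd raddf0 subr0 //.
exists h; split=> // [[//|p]|p u]; first exact: (H p).1.
exact: (H p).2.
Qed.

Section ExtMap.
Variables (N : lmodType A) (gN : grading N) (alpha : Zn n).
Notation oN := (Defs.restrict (@mpolyC n K) N).

Lemma hom_deg_comp (F G : graded_resolution gM) p q (f : Fr G q -> oN)
    (phi : {linear Fr F p -> Fr G q}) :
    is_graded (sh F p) (sh G q) phi ->
  hom_deg gN alpha f -> hom_deg (F := F) gN alpha (f \o phi).
Proof.
move=> ph [fL fd]; split=> [a u v /=|beta u Hu]; first by rewrite linearP fL.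
by apply: fd; exact: ph.
Qed.

Lemma linear_fun0 (U V : lmodType A) (f : U -> V) : linear f -> f 0 = 0.
Proof. by move=> fL; have := fL (-1) 0 0; rewrite scaler0 addr0 scaleN1r addNr. Qed.

Lemma linear_funD (U V : lmodType A) (f : U -> V) u v : linear f -> f (u + v) = f u + f v.
Proof. by move=> fL; have := fL 1 u v; rewrite !scale1r. Qed.

(** With theta = d h + h d, the cocycle [f] kills the first term, and the second
    one gives the coboundary of [f \o h]. *)
Lemma ext_homotopy (F : graded_resolution gM) (theta : forall p, {linear Fr F p -> Fr F p}) p
    (f : Fr F p -> oN) :
    (forall p, is_graded (sh F p) (sh F p) (theta p)) ->
    (forall u, res_aug F (theta 0%N u) = 0) ->
    (forall p u, res_d F p (theta p.+1 u) = theta p (res_d F p u)) ->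
    f \in ext_cocycles (F := F) gN alpha (p := p) ->
  (f \o theta p : Fr F p -> oN) \in ext_coboundaries (F := F) gN alpha (p := p).
Proof.
move=> th a0 thd /asboolP[fh fd]; have fL := fh.1.
have [h [hh h0 hS]] := comparison_homotopy th a0 thd.
case: p f fh fd fL => [|p] f fh fd fL; apply/asboolP.
  by apply: functional_extensionality_dep => u /=; rewrite h0 fd.
exists (f \o h p); first exact: hom_deg_comp.
apply: functional_extensionality_dep => u /=.
by rewrite hS (linear_funD _ _ fL) fd add0r.
Qed.

Lemma ext_coboundaries_comp (F G : graded_resolution gM) (phi : forall p, {linear Fr F p -> Fr G p}) p
    (f : Fr G p -> oN) :
    (forall p, is_graded (sh F p) (sh G p) (phi p)) ->
    (forall p u, res_d G p (phi p.+1 u) = phi p (res_d F p u)) ->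
    f \in ext_coboundaries (F := G) gN alpha (p := p) ->
  (f \o phi p : Fr F p -> oN) \in ext_coboundaries (F := F) gN alpha (p := p).
Proof.
move=> ph pd; case: p f => [|p] f /asboolP.
  by move=> ->; apply/asboolP; apply: functional_extensionality_dep.
move=> [g gh ->]; apply/asboolP; exists (g \o phi p); first exact: hom_deg_comp.
by apply: functional_extensionality_dep => u /=; rewrite pd.
Qed.

(** The comparison maps in the two directions are inverse up to homotopy. *)
Theorem Ext_resolution_iso (F G : graded_resolution gM) p :
  lmod_iso (Ext F gN alpha p) (Ext G gN alpha p).
Proof.
have [phi [phih phia phid]] := comparison_map F G.
have [psi [psih psia psid]] := comparison_map G F.
pose thF q : {linear Fr F q -> Fr F q} := (psi q \o phi q) \- idfun.
pose thG q : {linear Fr G q -> Fr G q} := (phi q \o psi q) \- idfun.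
have thFh q : is_graded (sh F q) (sh F q) (thF q).
  by move=> beta u Hu; apply: free_pieceB => //; apply/psih/phih.
have thGh q : is_graded (sh G q) (sh G q) (thG q).
  by move=> beta u Hu; apply: free_pieceB => //; apply/phih/psih.
have coc (H H' : graded_resolution gM) (xi : forall p, {linear Fr H p -> Fr H' p}) (f : Fr H' p -> oN) :
    (forall p, is_graded (sh H p) (sh H' p) (xi p)) ->
    (forall p u, res_d H' p (xi p.+1 u) = xi p (res_d H p u)) ->
    f \in ext_cocycles (F := H') gN alpha (p := p) ->
    (f \o xi p : Fr H p -> oN) \in ext_cocycles (F := H) gN alpha (p := p).
  move=> xh xd /asboolP[fh fd]; apply/asboolP; split; first exact: hom_deg_comp.
  by move=> u /=; rewrite -xd fd.
apply: (@subquot_iso _ _ _ _ _ _ _ (fun f : Fr F p -> oN => (f \o psi p : Fr G p -> oN))).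
- by [].
- by move=> f; exact: coc.
- move=> f fZ; split=> [|fB]; first exact: ext_coboundaries_comp.
  have -> : f = (-1) *: (f \o thF p) + ((f \o psi p) \o phi p).
    apply: functional_extensionality_dep => u.
    have fL : linear (f : Fr F p -> N) by case/asboolP: fZ => -[].
    rewrite -[RHS]/(-1 *: (f (thF p u)) + f (psi p (phi p u))) scaleN1r.
    apply/esym/eqP; rewrite addrC subr_eq; apply/eqP.
    rewrite -[RHS]/((f u : N) + f (thF p u)) -(linear_funD _ _ fL) /=.
    by rewrite addrC subrK.
  apply: (@ext_coboundaries_closed _ _ _ _ F _ gN alpha p).2.
    apply: ext_homotopy => // [u|q u]; rewrite /= raddfB /= ?psia ?phia ?subrr //.
    by rewrite psid phid.
  exact: ext_coboundaries_comp.
- move=> g gZ; exists (g \o phi p); first exact: coc.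
  have gL : linear (g : Fr G p -> N) by case/asboolP: gZ => -[].
  have -> : (g \o phi p) \o psi p - g = (g \o thG p : Fr G p -> oN).
    apply: functional_extensionality_dep => u.
    rewrite -[LHS]/((g (phi p (psi p u)) : oN) - g u); apply/eqP; rewrite subr_eq; apply/eqP.
    rewrite -[RHS]/((g (thG p u) : N) + g u) -(linear_funD _ _ gL) /=.
    by rewrite subrK.
  apply: ext_homotopy => // [u|q u]; rewrite /= raddfB /= ?psia ?phia ?psia ?subrr //.
  by rewrite phid psid.
Qed.

End ExtMap.
End Comparison.

(** * The Koszul resolution *)

Section Koszul.
Variables (n : nat) (K : fieldType) (l : nat) (l_gt0 : (0 < l)%N).
Notation A := {mpoly K[n]}.
Implicit Types (i j k : 'I_n) (p q : A) (s : {set 'I_n}) (g : {set 'I_n} -> A) (beta : Zn n).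

Definition xpow j : 'X_{1..n} := (U_(j) *+ l)%MM.

Lemma xpowE j : 'X_[xpow j] = 'X_j ^+ l :> A.
Proof. by rewrite /xpow mpolyXn. Qed.

Lemma xpow_coord j i : xpow j i = if j == i then l else 0%N.
Proof. by rewrite /xpow mulmnE mnm1E; case: eqP; rewrite ?mul1n. Qed.

Lemma xpow_le j (m : 'X_{1..n}) : (l <= m j)%N -> (m = (m - xpow j) + xpow j)%MM.
Proof.
move=> lm; apply/mnmP => i; rewrite mnmDE mnmBE xpow_coord.
by case: eqP => [<-|_]; rewrite ?subnK // subn0 addn0.
Qed.

(** Quotient and remainder in the division by the monomial ['X_j ^+ l]. *)
Definition xquo j p : A :=
  \sum_(m <- msupp p) p@_m *: (if (l <= m j)%N then 'X_[m - xpow j] else 0).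

Lemma mcoeff_xquo j p (m : 'X_{1..n}) : (xquo j p)@_m = p@_(m + xpow j).
Proof.
rewrite /xquo raddf_sum /= [in RHS](mpolyE p) raddf_sum /=; apply: eq_bigr => m' _.
rewrite !mcoeffZ mcoeffX; congr (_ * _); case: (leqP l (m' j)) => lm.
  by rewrite mcoeffX {2}(xpow_le lm) (inj_eq (@addIm _ _)).
rewrite mcoeff0; case: eqP => // e.
by move: lm; rewrite e mnmDE xpow_coord eqxx ltnNge leq_addl.
Qed.

Lemma xquo_linear j a p q : xquo j (a *: p + q) = a *: xquo j p + xquo j q.
Proof. by apply/mpolyP => m; rewrite mcoeffD mcoeffZ !mcoeff_xquo mcoeffD mcoeffZ. Qed.

Lemma xquo0 j : xquo j 0 = 0.
Proof. by rewrite /xquo msupp0 big_nil. Qed.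

Lemma xquoK j p : xquo j ('X_j ^+ l * p) = p.
Proof. by apply/mpolyP => m; rewrite mcoeff_xquo mulrC -xpowE addmC mcoeffMX. Qed.

Lemma xquoX j (m : 'X_{1..n}) :
  xquo j 'X_[m] = if (l <= m j)%N then 'X_[m - xpow j] else 0.
Proof. by rewrite /xquo msuppX big_seq1 mcoeffX eqxx scale1r. Qed.

Lemma xquoM i j p : i != j -> xquo j ('X_i ^+ l * p) = 'X_i ^+ l * xquo j p.
Proof.
move=> ij; elim/mpoly_ind_lin: p => [|a p q Hp Hq|m].
- by rewrite mulr0 xquo0 mulr0.
- by rewrite mulrDr -scalerAr !xquo_linear Hp Hq mulrDr -scalerAr.
rewrite -xpowE -mpolyXD !xquoX mnmDE xpow_coord (negbTE ij) add0n.
case: ifP => lm; last by rewrite mulr0.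
rewrite -mpolyXD; congr 'X_[_]; apply/mnmP => k; rewrite !(mnmDE, mnmBE) addnBA //.
by rewrite xpow_coord; case: eqP => [<-|].
Qed.

Definition xrem j p : A := p - 'X_j ^+ l * xquo j p.

Lemma xrem_linear j a p q : xrem j (a *: p + q) = a *: xrem j p + xrem j q.
Proof. by rewrite /xrem xquo_linear mulrDr -scalerAr scalerBr opprD addrACA. Qed.

Lemma xremM i j p : i != j -> xrem j ('X_i ^+ l * p) = 'X_i ^+ l * xrem j p.
Proof. by move=> ij; rewrite /xrem xquoM // mulrBr mulrCA. Qed.

Lemma xrem_pow j p : xrem j ('X_j ^+ l * p) = 0.
Proof. by rewrite /xrem xquoK subrr. Qed.

(** Remainder modulo the [l]-th powers of the first [m] variables. *)
Fixpoint xrems (m : nat) p : A :=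
  if m is m'.+1 then (if insub m' is Some j then xrem j (xrems m' p) else xrems m' p)
  else p.

Lemma xremsS j p : xrems j.+1 p = xrem j (xrems j p).
Proof. by rewrite /= insubT //= => jn; congr (xrem _ _); exact: val_inj. Qed.

Lemma xrems_linear m a p q : xrems m (a *: p + q) = a *: xrems m p + xrems m q.
Proof.
elim: m => //= m ->; case: (insub m) => // j; exact: xrem_linear.
Qed.

Lemma xrems0 m : xrems m 0 = 0.
Proof. by have := xrems_linear m (-1) 0 0; rewrite scaler0 addr0 scaleN1r addNr. Qed.

Lemma xremsM m i p : (m <= i)%N -> xrems m ('X_i ^+ l * p) = 'X_i ^+ l * xrems m p.
Proof.
elim: m => //= m IH mi; rewrite IH ?(ltnW mi) //; case: insubP => // j _ jm.
by rewrite xremM // -val_eqE /= jm neq_ltn mi orbT.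
Qed.

Lemma xrems_pow m i p : (i < m)%N -> xrems m ('X_i ^+ l * p) = 0.
Proof.
elim: m => // m IH; rewrite ltnS leq_eqVlt => /predU1P[<-|im].
  by rewrite xremsS xremsM // xrem_pow.
rewrite /= IH //; case: (insub m) => // j.
by have := xrem_linear j (-1) 0 0; rewrite scaler0 addr0 scaleN1r addNr.
Qed.

Lemma xrems_telescope m p : (m <= n)%N ->
  \sum_(i < n | (i < m)%N) 'X_i ^+ l * xquo i (xrems i p) = p - xrems m p.
Proof.
elim: m => [|m IH] mn; first by rewrite big_pred0 // subrr.
pose j := Ordinal mn; rewrite (bigD1 j) //.
rewrite (eq_bigl (fun i : 'I_n => (i < m)%N)); last first.
  by move=> i; rewrite -val_eqE /= ltnS; case: ltngtP.
rewrite IH ?(ltnW mn) //; have -> : xrems m.+1 p = xrem j (xrems m p) by exact: (xremsS j p).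
by rewrite /xrem opprB addrCA.
Qed.

(** The Koszul differential acts on families indexed by all sets of variables,
    so that their sizes need not be tracked. *)
Definition koszul g s : A :=
  \sum_(i | i \notin s) ksign K i s *: ('X_i ^+ l * g (i |: s)).

Lemma eq_koszul g g' s : (forall i, i \notin s -> g (i |: s) = g' (i |: s)) ->
  koszul g s = koszul g' s.
Proof. by move=> e; apply: eq_bigr => i /e->. Qed.

Lemma ksign_anti i k s : i \notin s -> k \notin s -> i != k ->
  ksign K i s * ksign K k (i |: s) = - (ksign K k s * ksign K i (k |: s)).
Proof.
move=> iS kS ik; rewrite !ksign_setU1 // mulrCA [in RHS]mulrCA [ksign K k s * _]mulrC.
case: (ltngtP i k) => [||/val_inj e]; last by rewrite e eqxx in ik.
  by rewrite expr1 expr0 mulN1r mul1r.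
by rewrite expr1 expr0 mulN1r mul1r opprK.
Qed.

Lemma koszul_koszul g s : koszul (koszul g) s = 0.
Proof.
pose T i k : A := (ksign K i s * ksign K k (i |: s)) *:
  ('X_i ^+ l * 'X_k ^+ l * g (k |: (i |: s))).
have TA i k : i \notin s -> k \notin s -> i != k -> T i k = - T k i.
  by move=> iS kS ik; rewrite /T ksign_anti // scaleNr ['X_i ^+ l * _]mulrC setUCA.
transitivity (\sum_(i | i \notin s) \sum_(k | (k \notin s) && (k != i)) T i k).
  apply: eq_bigr => i iS; rewrite mulr_sumr scaler_sumr.
  apply: eq_big => k; first by rewrite in_setU1 negb_or andbC.
  by move=> _; rewrite -scalerAr scalerA mulrA.
(* The sum is split according to the order of the two indices: being equal to
   its own opposite would not make it vanish in characteristic 2. *)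
pose S1 := \sum_(i | i \notin s) \sum_(k | (k \notin s) && (i < k)%N) T i k.
transitivity (S1 + \sum_(i | i \notin s) \sum_(k | (k \notin s) && (k < i)%N) T i k).
  rewrite -big_split; apply: eq_bigr => i iS /=.
  rewrite (bigID (fun k : 'I_n => (i < k)%N)) /=; congr (_ + _); apply: eq_bigl => k.
    by rewrite -andbA -val_eqE /=; congr (_ && _); case: ltngtP.
  by rewrite -andbA -val_eqE /=; congr (_ && _); case: ltngtP.
rewrite [X in _ + X](exchange_big_dep (fun k => k \notin s)) /=; last by move=> i k _ /andP[].
rewrite -big_split big1 //= => k kS.
rewrite [X in _ + X](eq_big (fun i => (i \notin s) && (k < i)%N) (fun i => - T k i)).
- by rewrite sumrN subrr.
- by move=> i; rewrite kS.
- by move=> i /andP[iS /andP[_ ki]]; apply: TA => //; rewrite -val_eqE /= neq_ltn ki orbT.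
Qed.

Definition kmin s : option 'I_n := [pick j in s | [forall k in s, (j <= k)%N]].

Lemma kminP s j : j \in s -> (forall k, k \in s -> (j <= k)%N) -> kmin s = Some j.
Proof.
move=> js jmin; rewrite /kmin; case: pickP => [k /andP[ks /forall_inP kmin]|/(_ j)].
  by congr Some; apply/val_inj/anti_leq; rewrite kmin // jmin.
by rewrite js; move/negbT/negP; case; apply/forall_inP.
Qed.

Lemma kmin_ex s : s != set0 -> exists2 j, j \in s & forall k, k \in s -> (j <= k)%N.
Proof.
by move=> /set0Pn[i is_]; case: (arg_minnP (fun k : 'I_n => val k) is_) => j js jm; exists j.
Qed.

(** Contraction towards the least variable, which divides by [xquo] after
    discarding the multiples of the smaller ones. *)
Definition khomotopy g s : A :=
  if kmin s is Some j then xquo j (xrems j (g (s :\ j))) else 0.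

(** In the first term, the variables below the minimum of [s] contribute a
    telescoping sum. The minimum contributes the rest in the second term, where
    smaller variables vanish by [xrems_pow]. Larger variables occur in both
    terms with opposite signs, since the minimum is removed before one of the
    signs is taken. *)
Lemma khomotopyP g s :
  koszul (khomotopy g) s + khomotopy (koszul g) s =
  g s - (if s == set0 then xrems n (g set0) else 0).
Proof.
have low (j : nat) : (j <= n)%N -> (forall i, i \in s -> (j <= i)%N) ->
    \sum_(i | (i \notin s) && (i < j)%N)
      ksign K i s *: ('X_i ^+ l * khomotopy g (i |: s)) = g s - xrems j (g s).
  move=> jn js; rewrite -xrems_telescope //.
  have E (i : 'I_n) : (i \notin s) && (i < j)%N = (i < j)%N.
    by case: (boolP (i \in s)) => //= /js; rewrite leqNgt => /negbTE->.
  rewrite (eq_bigl _ _ E); apply: eq_bigr => i ij.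
  have iS : i \notin s by apply/negP => /js; rewrite leqNgt ij.
  have -> : ksign K i s = 1.
    rewrite /ksign (_ : [set _ in _ | _] = set0) ?cards0 ?expr0 //.
    apply/setP => k; rewrite !inE; apply/negbTE; apply/negP => /andP[/js jk ki].
    by have := leq_trans ki (ltnW (leq_trans ij jk)); rewrite ltnn.
  rewrite scale1r /khomotopy (@kminP _ i) ?setU11 ?setU1K // => k.
  by rewrite in_setU1 => /predU1P[->//|/js jk]; exact: ltnW (leq_trans ij jk).
have [s0|s0] := eqVneq s set0.
  rewrite {2}/khomotopy (_ : kmin s = None) ?addr0; last first.
    by rewrite s0 /kmin; case: pickP => // j; rewrite inE.
  rewrite -s0 -(low n) // => [|i]; last by rewrite s0 inE.
  by apply: eq_bigl => i; rewrite ltn_ord andbT.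
have [j js jm] := kmin_ex s0; rewrite subr0.
pose Lq p := xquo j (xrems j p).
have LqL a p q : Lq (a *: p + q) = a *: Lq p + Lq q by rewrite /Lq xrems_linear xquo_linear.
have Lq0 : Lq 0 = 0 by have := LqL (-1) 0 0; rewrite scaler0 addr0 scaleN1r addNr.
have LqD p q : Lq (p + q) = Lq p + Lq q by have := LqL 1 p q; rewrite !scale1r.
have LqZ a p : Lq (a *: p) = a *: Lq p by have := LqL a p 0; rewrite Lq0 !addr0.
rewrite {2}/khomotopy (kminP js jm) -/(Lq _) {2}/koszul (bigD1 j) /=; last first.
  by rewrite !inE eqxx.
have -> : ksign K j (s :\ j) = 1.
  rewrite /ksign (_ : [set _ in _ | _] = set0) ?cards0 ?expr0 //.
  apply/setP => k; rewrite !inE; apply/negbTE; apply/negP => /andP[/andP[_ /jm jk]].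
  by rewrite ltnNge jk.
rewrite scale1r setD1K // LqD {1}/Lq xremsM // xquoK.
rewrite /koszul (bigID (fun i : 'I_n => (i < j)%N)) /= low //; last exact: ltnW.
rewrite addrACA subrK -[RHS]addr0; congr (_ + _).
rewrite (big_morph Lq LqD Lq0).
rewrite [X in _ + X](eq_bigl (fun i => i \notin s)); last first.
  move=> i; rewrite !inE; case: (i =P j) => [->|_]; first by rewrite js.
  by rewrite andbT.
rewrite [X in _ + X](bigID (fun i : 'I_n => (i < j)%N)) /= [X in _ + (X + _)]big1 ?add0r; last first.
  by move=> i /andP[_ ij]; rewrite LqZ /Lq xrems_pow // xquo0 scaler0.
rewrite -big_split big1 //= => i /andP[iS ij].
have ji : (j < i)%N.
  by rewrite ltn_neqAle leqNgt ij andbT; apply: contraNneq iS => /val_inj <-.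
have nij : i != j by apply: contraNneq iS => ->.
rewrite /khomotopy; have -> : kmin (i |: s) = Some j.
  apply: kminP; first by rewrite in_setU1 js orbT.
  by move=> k; rewrite in_setU1 => /predU1P[->|/jm//]; exact: ltnW.
have -> : (i |: s) :\ j = i |: (s :\ j).
  by apply/setP => k; rewrite !inE; case: (k =P i) => [->|]; rewrite ?nij.
rewrite LqZ /Lq xremsM ?(ltnW ji) // xquoM //.
have -> : ksign K i s = - ksign K i (s :\ j).
  by rewrite -[in LHS](setD1K js) ksign_setU1 ?inE ?eqxx // ji expr1 mulN1r.
by rewrite scaleNr addNr.
Qed.

Definition ksets (m : nat) : {set {set 'I_n}} := [set s : {set 'I_n} | #|s| == m].

(** Rows are handled as families vanishing outside the sets of size [m], which
    spares changes of index. *)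
Definition row_fun m (u : 'rV[A]_#|ksets m|) s : A :=
  \sum_(c | enum_val c == s) u 0 c.

Definition fun_row m g : 'rV[A]_#|ksets m| := \row_c g (enum_val c).

Lemma row_funE m (u : 'rV[A]_#|ksets m|) c : row_fun u (enum_val c) = u 0 c.
Proof. by apply: big_pred1 => c'; rewrite (inj_eq enum_val_inj). Qed.

Lemma row_fun_out m (u : 'rV[A]_#|ksets m|) s : #|s| != m -> row_fun u s = 0.
Proof.
move=> sm; apply: big_pred0 => c; apply: contraNF sm => /eqP <-.
by have := enum_valP c; rewrite inE.
Qed.

Lemma row_fun_linear m a (u v : 'rV[A]_#|ksets m|) s :
  row_fun (a *: u + v) s = a * row_fun u s + row_fun v s.
Proof.
by rewrite /row_fun mulr_sumr -big_split; apply: eq_bigr => c _; rewrite !mxE.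
Qed.

Lemma kset_index m s : #|s| = m -> exists c : 'I_#|ksets m|, enum_val c = s.
Proof.
move=> sm; have sk : s \in ksets m by rewrite inE sm.
by exists (enum_rank_in sk s); rewrite enum_rankK_in.
Qed.

Lemma fun_rowK m g s : #|s| = m -> row_fun (fun_row m g) s = g s.
Proof. by move=> /kset_index[c <-]; rewrite row_funE mxE. Qed.

Definition koszul_d m (u : 'rV[A]_#|ksets m.+1|) : 'rV[A]_#|ksets m| :=
  fun_row m (koszul (row_fun u)).

Lemma koszul_d_linear m : linear (@koszul_d m).
Proof.
move=> a u v; apply/rowP => c; rewrite !mxE /koszul mulr_sumr -big_split.
apply: eq_bigr => i _ /=; rewrite row_fun_linear mulrDr scalerDr; congr (_ + _).
by rewrite -scalerAr mulrCA.
Qed.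
HB.instance Definition _ m := GRing.isLinear.Build A _ _ _ (@koszul_d m) (@koszul_d_linear m).

Definition kshift s : Zn n := Zn_of (\sum_(i in s) xpow i)%MM.

Lemma kshift_coord s i : kshift s i = (if i \in s then l else 0%N)%:Z.
Proof.
rewrite ffunE mnm_sumE; congr (Posz _); case: (boolP (i \in s)) => is_.
  rewrite (bigD1 i) //= xpow_coord eqxx big1 ?addn0 // => k /andP[_ ki].
  by rewrite xpow_coord (negbTE ki).
rewrite big1 // => k ks; rewrite xpow_coord; case: eqP => // e.
by rewrite -e ks in is_.
Qed.

Lemma kshiftU i s : i \notin s -> kshift (i |: s) = Zn_of (xpow i) + kshift s.
Proof. by move=> iS; rewrite /kshift big_setU1 //= Zn_ofD. Qed.

Lemma gradA_scale beta a p : p \in submodule_pred (gradA K beta) ->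
  a *: p \in submodule_pred (gradA K beta).
Proof.
by move=> Hp; rewrite -[_ *: _]addr0; apply: (submoduleP (gradA K _)).2; rewrite ?poly_piece0.
Qed.

Lemma gradA_sum beta (I : finType) (P : pred I) (F : I -> A) :
  (forall c, P c -> F c \in submodule_pred (gradA K beta)) ->
  \sum_(c | P c) F c \in submodule_pred (gradA K beta).
Proof.
move=> H; elim/big_rec: _ => [|i p /H Hi Hp]; first exact: poly_piece0.
by rewrite -[F i]scale1r; apply: (submoduleP (gradA K _)).2.
Qed.

Lemma row_fun_grad m beta (u : 'rV[A]_#|ksets m|) s :
  free_piece (fun c => kshift (enum_val c)) beta u ->
  row_fun u s \in submodule_pred (gradA K (beta - kshift s)).
Proof. by move=> Hu; apply: gradA_sum => c /eqP <-; exact: Hu. Qed.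

Lemma koszul_d_graded m beta u :
  free_piece (fun c : 'I_#|ksets m.+1| => kshift (enum_val c)) beta u ->
  free_piece (fun c : 'I_#|ksets m| => kshift (enum_val c)) beta (koszul_d u).
Proof.
move=> Hu c; rewrite mxE; apply: gradA_sum => i iS; apply: gradA_scale.
rewrite -xpowE (_ : beta - _ = Zn_of (xpow i) + (beta - kshift (i |: enum_val c))).
  by apply: gradAM; [exact: gradAX|exact: row_fun_grad].
by rewrite kshiftU // opprD addrCA addNKr.
Qed.

Definition koszul_aug (u : 'rV[A]_#|ksets 0|) : power_quot n K l :=
  power_quot_proj l (row_fun u set0).

Lemma power_quot_projL a p q : power_quot_proj l (a * p + q) =
  (a *: (power_quot_proj l p : power_quot n K l) + power_quot_proj l q : power_quot n K l).
Proof.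
rewrite /power_quot_proj raddfD; congr (_ + _).
by rewrite -[RHS]/(quot_scale a (\pi_(quot_mod (power_ideal n K l)) (p : A^o))) pi_quot_scale.
Qed.

Lemma koszul_aug_linear : linear koszul_aug.
Proof. by move=> a u v; rewrite /koszul_aug row_fun_linear power_quot_projL. Qed.
HB.instance Definition _ := GRing.isLinear.Build A _ _ _ koszul_aug koszul_aug_linear.

Lemma power_quot_proj_eq0 p :
  power_quot_proj l p = 0 :> power_quot n K l <-> p \in submodule_pred (power_ideal n K l).
Proof.
have := quot_modE (power_ideal n K l) (p : A^o) 0; rewrite subr0 => <-.
by rewrite [X in _ == X]raddf0; split=> [H|/eqP]; [apply/eqP|].
Qed.

Lemma power_ideal_xrems p : p \in submodule_pred (power_ideal n K l) -> xrems n p = 0.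
Proof.
move=> /asboolP[s Hs ->]; elim: s Hs => [|c s IH] Hs; first by rewrite big_nil xrems0.
have [i ci] := Hs c (mem_head _ _); rewrite big_cons ci.
rewrite -[_ *: _]/(c.1 * 'X_i ^+ l) mulrC -[_ * c.1]scale1r xrems_linear xrems_pow //.
by rewrite scaler0 add0r IH // => e es; apply: Hs; rewrite inE es orbT.
Qed.

Lemma xpow_power_ideal i p : 'X_i ^+ l * p \in submodule_pred (power_ideal n K l).
Proof.
apply/asboolP; exists [:: (p, 'X_i ^+ l)]; first by move=> c; rewrite inE => /eqP->; exists i.
by rewrite big_seq1 mulrC.
Qed.

Lemma eq_row_fun m (u v : 'rV[A]_#|ksets m|) : (forall s, #|s| = m -> row_fun u s = row_fun v s) -> u = v.
Proof.
move=> H; apply/rowP => c; rewrite -!row_funE; apply: H.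
by have := enum_valP c; rewrite inE => /eqP.
Qed.

Lemma koszul_d_fun m (u : 'rV[A]_#|ksets m.+1|) s : row_fun (koszul_d u) s = koszul (row_fun u) s.
Proof.
have [sm|sm] := eqVneq #|s| m; first by rewrite fun_rowK.
rewrite row_fun_out // /koszul big1 // => i iS.
by rewrite row_fun_out ?mulr0 ?scaler0 // cardsU1 iS eqSS.
Qed.

(** Every set is nonempty in positive degree. In degree 0 the contraction misses
    the remainder modulo all powers, which is what membership in the ideal
    controls ([power_ideal_xrems]). *)
Lemma koszul_d_homotopy m (u : 'rV[A]_#|ksets m|) :
  (forall s, koszul (row_fun u) s = 0) -> (m = 0%N -> xrems n (row_fun u set0) = 0) ->
  koszul_d (fun_row m.+1 (khomotopy (row_fun u))) = u.
Proof.
move=> k0 u0; apply: eq_row_fun => s sm; rewrite koszul_d_fun.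
rewrite (@eq_koszul _ (khomotopy (row_fun u))); last first.
  by move=> i iS; rewrite fun_rowK // cardsU1 iS sm.
have := khomotopyP (row_fun u) s.
have -> : khomotopy (koszul (row_fun u)) s = 0.
  by rewrite /khomotopy; case: (kmin s) => // j; rewrite k0 xrems0 xquo0.
rewrite addr0 => ->; case: eqP => [s0|]; last by rewrite subr0.
by rewrite u0 ?subr0 // -sm s0 cards0.
Qed.

Lemma koszul_exact0 u : koszul_aug u = 0 <-> exists v, koszul_d v = u.
Proof.
rewrite /koszul_aug; split=> [/power_quot_proj_eq0/power_ideal_xrems u0|[v <-]].
  exists (fun_row 1 (khomotopy (row_fun u))); apply: koszul_d_homotopy => // s.
  rewrite /koszul big1 // => i iS; rewrite row_fun_out ?mulr0 ?scaler0 //.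
  by rewrite cardsU1 iS.
apply/power_quot_proj_eq0; rewrite koszul_d_fun /koszul.
elim/big_rec: _ => [|i p _ Hp]; first exact: (submoduleP (power_ideal n K l)).1.
rewrite scalerAr -[_ * _]mul1r.
exact: (submoduleP (power_ideal n K l)).2 1 _ _ (xpow_power_ideal _ _) Hp.
Qed.

Lemma koszul_exactS m u : @koszul_d m u = 0 <-> exists v, koszul_d v = u.
Proof.
split=> [u0|[v <-]].
  exists (fun_row m.+2 (khomotopy (row_fun u))); apply: koszul_d_homotopy => // s.
  by rewrite -koszul_d_fun u0; apply: big1 => c _; rewrite mxE.
apply: eq_row_fun => s sm; rewrite koszul_d_fun (@eq_koszul _ (koszul (row_fun v))).
  by rewrite koszul_koszul; apply/esym/big1 => c _; rewrite mxE.
by move=> i iS; rewrite koszul_d_fun.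
Qed.

Definition koszul_resolution : graded_resolution (@power_quot_grading n K l).
Proof.
refine (@Build_graded_resolution n K _ (@power_quot_grading n K l) (fun m => #|ksets m|)
  (fun m c => kshift (enum_val c)) (fun m => @koszul_d m) koszul_aug
  koszul_d_graded _ _ koszul_exact0 koszul_exactS).
- move=> beta u Hu; apply/asboolP; exists (row_fun u set0) => //.
  have := row_fun_grad set0 Hu; rewrite (_ : kshift set0 = 0) ?subr0 //.
  by apply/ffunP => i; rewrite kshift_coord inE ffunE.
- move=> q; exists (fun_row 0 (fun=> repr q)).
  by rewrite -[LHS]/(power_quot_proj l _) fun_rowK ?cards0 // /power_quot_proj reprK.
Defined.

Lemma hcompM beta m (p : A) : hcomp beta ('X_[m] * p) = 'X_[m] * hcomp (beta - Zn_of m) p.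
Proof.
have h0 b : hcomp b 0 = 0 :> A by rewrite /hcomp msupp0 big_nil.
elim/mpoly_ind_lin: p => [|a p q Hp Hq|m'].
- by rewrite mulr0 !h0 mulr0.
- by rewrite mulrDr -scalerAr !hcomp_linear Hp Hq mulrDr -scalerAr.
rewrite -mpolyXD !(hcompE _ (gradAX _ _)) Zn_ofD subr_eq [Zn_of m + _]addrC.
by case: eqP; rewrite ?mulr0 ?mpolyXD.
Qed.

Lemma hcomp_power_ideal beta p : p \in submodule_pred (power_ideal n K l) ->
  hcomp beta p \in submodule_pred (power_ideal n K l).
Proof.
move=> /asboolP[s Hs ->]; elim: s Hs => [|c s IH] Hs.
  rewrite big_nil /hcomp msupp0 big_nil; exact: (submoduleP (power_ideal n K l)).1.
have [i ci] := Hs c (mem_head _ _); rewrite big_cons ci.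
rewrite -[_ *: _]/(c.1 * 'X_i ^+ l) hcompD mulrC -xpowE hcompM -[_ * hcomp _ _]mul1r.
apply: ((submoduleP (power_ideal n K l)).2 1); first by rewrite xpowE xpow_power_ideal.
by apply: IH => e es; apply: Hs; rewrite inE es orbT.
Qed.

(** The ideal of powers is generated by monomials, so that the quotient
    inherits homogeneous components. *)
Lemma power_quot_independent : independent_grading (@power_quot_grading n K l).
Proof.
move=> beta.
pose pi (p : A) : power_quot n K l := power_quot_proj l p.
have piD p q : pi (p + q) = pi p + pi q by exact: raddfD.
have piK m : pi (repr m) = m by exact: reprK.
have pi_eq p q : pi p = pi q <-> p - q \in submodule_pred (power_ideal n K l).
  have <- := quot_modE (power_ideal n K l) (p : A^o) q.
  by split=> [H|/eqP]; [apply/eqP|].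
have hB p q : hcomp beta (p - q) = hcomp beta p - hcomp beta q.
  by rewrite addrC -scaleN1r hcomp_linear scaleN1r addrC.
have prE p : pi (hcomp beta (repr (pi p))) = pi (hcomp beta p).
  by apply/pi_eq; rewrite -hB; apply: hcomp_power_ideal; apply/pi_eq; rewrite piK.
exists (fun m => pi (hcomp beta (repr m))); split.
- by move=> a b; rewrite -[a]piK -[b]piK -piD !prE hcompD piD.
- by move=> _ /asboolP[p pb ->]; rewrite -/(pi p) prE (hcompE _ pb) eqxx.
- move=> gamma _ gb /asboolP[p pb ->]; rewrite -/(pi p) prE (hcompE _ pb) eq_sym (negbTE gb).
  by rewrite /pi /power_quot_proj; exact: raddf0.
Qed.

End Koszul.

Lemma big_setU_disjoint (R : Type) (idx : R) (op : Monoid.com_law idx) (I : finType)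
    (S S' : {set I}) (F : I -> R) : [disjoint S & S'] ->
  \big[op/idx]_(i in S :|: S') F i =
  op (\big[op/idx]_(i in S) F i) (\big[op/idx]_(i in S') F i).
Proof. by move=> SS'; rewrite -bigU //; apply: eq_bigl => i; rewrite !inE. Qed.

Section KoszulBasis.
Variables (n : nat) (K : fieldType) (l : nat).
Notation A := {mpoly K[n]}.

Definition kbasis m (s : {set 'I_n}) : 'rV[A]_#|ksets n m| :=
  fun_row m (fun t => (t == s)%:R).

Lemma kbasis_delta m (c : 'I_#|ksets n m|) : delta_mx 0 c = kbasis m (enum_val c).
Proof.
by apply/rowP => c'; rewrite !mxE eqxx /= (inj_eq enum_val_inj).
Qed.

Lemma kbasis_piece m s : free_piece (fun c => kshift l (enum_val c)) (kshift l s) (kbasis m s).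
Proof.
move=> c; rewrite mxE; case: eqP => [->|_]; last exact: poly_piece0.
by rewrite subrr poly_piece1.
Qed.

Lemma koszul_d_basis m (s : {set 'I_n}) : #|s| = m.+1 ->
  koszul_d l (kbasis m.+1 s) =
  \sum_(i in s) (ksign K i (s :\ i) *: 'X_i ^+ l) *: kbasis m (s :\ i).
Proof.
move=> sm; apply: eq_row_fun => t tm; rewrite koszul_d_fun.
have rD (I : finType) (p : pred I) (F : I -> A) (G : I -> 'rV[A]_#|ksets n m|) :
    row_fun (\sum_(i | p i) F i *: G i) t = \sum_(i | p i) F i * row_fun (G i) t.
  elim/big_rec2: _ => [|i u v _ <-]; first by rewrite /row_fun big1 // => c _; rewrite mxE.
  by rewrite row_fun_linear.
rewrite rD /koszul big_mkcond [RHS]big_mkcond; apply: eq_bigr => i _.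
case: (boolP (i \in t)) => it /=; case: (boolP (i \in s)) => is_ //.
- rewrite fun_rowK //; case: eqP => [e|]; last by rewrite mulr0.
  by move: it; rewrite e !inE eqxx.
- rewrite !fun_rowK ?cardsU1 ?it ?tm //.
  have -> : (i |: t == s) = (t == s :\ i).
    by apply/eqP/eqP => [<-|->]; rewrite ?setU1K ?setD1K.
  by case: eqP => [->|]; rewrite ?mulr1 // !mulr0 scaler0.
- rewrite fun_rowK ?cardsU1 ?it ?tm //; case: eqP => [e|]; last by rewrite mulr0 scaler0.
  by rewrite -e setU11 in is_.
Qed.

End KoszulBasis.

(** * Ext of a module with coordinates indexed by faces *)

Section ExtFaces.
Variables (n : nat) (K : fieldType).
Variables (d : Order.disp_t) (P : finBPOrderType d) (P_simplicial : simplicial_poset P).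
Variables (x : 'I_n -> P) (x_vertices : vertex_labelling x).
Variables (l : nat) (l_gt0 : (0 < l)%N).
Notation A := {mpoly K[n]}.

Variables (N : lmodType A) (gN : grading N) (cf : P -> 'X_{1..n} -> N -> K).
Notation oN := (Defs.restrict (@mpolyC n K) N).

(** All that the computation uses of the face ring. In degree [mu], an element is
    a function on the faces carried by the support of [mu]; [cf w mu] evaluates
    it on the face of [w] with that support, which is why multiplication by a
    variable of [w] leaves the value unchanged. *)
Record face_coordinates : Prop := FaceCoordinates {
  gN_neg : forall (beta : Zn n) i (a : oN), beta i < 0 -> a \in submodule_pred (gN beta) -> a = 0;
  gN_scale : forall (beta gamma : Zn n) p (a : oN), p \in submodule_pred (gradA K gamma) ->
    a \in submodule_pred (gN beta) ->
    (p *: (a : N) : oN) \in submodule_pred (gN (gamma + beta));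
  cf_linear : forall w mu k (a b : oN), cf w mu (k *: a + b : oN) = k * cf w mu a + cf w mu b;
  cf_inj : forall mu (a : oN), a \in submodule_pred (gN (Zn_of mu)) ->
    (forall w, supp x w = supp_deg mu -> cf w mu a = 0) -> a = 0;
  cf_surj : forall mu (c : P -> K), exists2 a : oN, a \in submodule_pred (gN (Zn_of mu)) &
    forall w, supp x w = supp_deg mu -> cf w mu a = c w;
  cf_face : forall mu v w (a : oN), a \in submodule_pred (gN (Zn_of mu)) ->
    (v <= w)%O -> supp x v = supp_deg mu -> cf v mu a = cf w mu a;
  cf_pow : forall w mu i (a : N), i \in supp x w ->
    cf w (mu + xpow l i)%MM ('X_i ^+ l *: a) = cf w mu a
}.

Hypothesis H : face_coordinates.
Variable alpha : Zn n.

Notation B := [set j | (- l%:Z < alpha j) && (alpha j < 0)].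
Notation C := [set j | alpha j == - l%:Z].
Notation D := [set j | 0 < alpha j].
Notation T := (P *p P)%type.
Notation G := (koszul_resolution n K l).
Notation Fr m := ('rV[A]_#|ksets n m|).
Notation kd m := (@koszul_d n K l m).

Lemma cf0 w mu : cf w mu 0 = 0.
Proof.
have := cf_linear H w mu (-1) (0 : oN) (0 : oN).
by rewrite scaler0 addr0 mulN1r addNr.
Qed.

Lemma cfD w mu (a b : oN) : cf w mu (a + b : oN) = cf w mu a + cf w mu b.
Proof. by have := cf_linear H w mu 1 a b; rewrite scale1r mul1r. Qed.

Lemma cfZ w mu k (a : N) : cf w mu (k%:MP *: a) = k * cf w mu a.
Proof.
have := cf_linear H w mu k (a : oN) 0; rewrite cf0 !addr0 => <-.
by congr (cf w mu _).
Qed.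

Lemma gN0 beta : (0 : oN) \in submodule_pred (gN beta).
Proof. exact: (submoduleP (gN beta)).1. Qed.

Definition hdeg m (F : Fr m -> oN) := hom_deg (F := G) gN alpha (p := m) F.

Lemma hdeg_linear m (F : Fr m -> oN) : hdeg F -> linear (F : Fr m -> N).
Proof. by case. Qed.

Lemma hdeg_basis m (F : Fr m -> oN) s : hdeg F ->
  F (kbasis K m s) \in submodule_pred (gN (kshift l s + alpha)).
Proof. by move=> [_ Fd]; apply: Fd; exact: kbasis_piece. Qed.

Lemma hdeg_ext m (F F' : Fr m -> oN) : linear (F : Fr m -> N) -> linear (F' : Fr m -> N) ->
  (forall s : {set 'I_n}, #|s| = m -> F (kbasis K m s) = F' (kbasis K m s)) -> F = F'.
Proof.
move=> FL F'L E; apply: functional_extensionality_dep => u; rewrite [u]row_sum_delta.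
elim/big_rec: _ => [|c v _ Ev]; first by rewrite (linear_fun0 FL) (linear_fun0 F'L).
rewrite FL F'L Ev kbasis_delta E //.
by have := enum_valP c; rewrite inE => /eqP.
Qed.

Lemma hdeg_comp m (F : Fr m -> oN) : hdeg F -> hdeg (F \o kd m).
Proof.
move=> [FL Fd]; split=> [a u v /=|beta u Hu /=]; first by rewrite koszul_d_linear FL.
exact/Fd/koszul_d_graded.
Qed.

Lemma kshift_alpha s i : (kshift l s + alpha) i = alpha i + (if i \in s then l else 0%N)%:Z.
Proof. by rewrite ffunE kshift_coord addrC. Qed.

(** The coordinate [j] of the degree of a value stays negative even when the
    generator adds [l] to it. *)
Lemma ext_low m (F : Fr m -> oN) : (exists j, alpha j < - l%:Z) -> hdeg F -> F = 0.
Proof.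
move=> [j aj] Fh; apply: hdeg_ext; first exact: hdeg_linear.
  by move=> a u v; rewrite scaler0 addr0.
move=> s sm; apply: (gN_neg H (i := j) _ (hdeg_basis s Fh)).
rewrite kshift_alpha; case: ifP => _; last by rewrite addr0 (lt_trans aj) // oppr_lt0 ltz_nat.
by rewrite -ltrBrDr sub0r.
Qed.

Lemma ext_low_zero m : (exists j, alpha j < - l%:Z) -> lmod_zero (Ext G gN alpha m).
Proof.
move=> low; apply: subquot_zero => f /asboolP[fh _].
rewrite (ext_low low fh); exact: (ext_coboundaries_closed _ _ _ _).1.
Qed.

Hypothesis alpha_ge : forall j, - l%:Z <= alpha j.

(** The degree of the value at the generator [s] of a cochain of degree [alpha];
    it has no negative coordinate when [s] contains [B :|: C]. *)
Definition gen_degree (s : {set 'I_n}) : 'X_{1..n} := Zn_mnm (kshift l s + alpha).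

Lemma gen_degree_ge0 (s : {set 'I_n}) i : B :|: C \subset s -> 0 <= (kshift l s + alpha) i.
Proof.
move=> /subsetP BCs; rewrite kshift_alpha; case: ifP => is_.
  by rewrite -lerBlDr sub0r.
rewrite addr0 leNgt; apply/negP => ai; move/negP: is_; apply; apply: BCs.
by rewrite !inE ai andbT lt_neqAle alpha_ge andbT eq_sym; case: eqP.
Qed.

Lemma gen_degreeK (s : {set 'I_n}) : B :|: C \subset s -> Zn_of (gen_degree s) = kshift l s + alpha.
Proof. by move=> BCs; apply: Zn_mnmK => i; exact: gen_degree_ge0. Qed.

Lemma hdeg_basis0 m (F : Fr m -> oN) (s : {set 'I_n}) : hdeg F -> ~~ (B :|: C \subset s) ->
  F (kbasis K m s) = 0.
Proof.
move=> Fh /subsetPn[j jBC js]; apply: (gN_neg H (i := j) _ (hdeg_basis s Fh)).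
rewrite kshift_alpha (negbTE js) addr0; move: jBC; rewrite !inE => /orP[/andP[]//|/eqP->].
by rewrite oppr_lt0 ltz_nat.
Qed.

(** Adding [l] makes the coordinates of [B] positive and those of [C] zero;
    elsewhere a zero coordinate becomes positive exactly on [s]. *)
Lemma supp_gen_degree (s : {set 'I_n}) : B :|: C \subset s ->
  supp_deg (gen_degree s) = (B :|: D) :|: (s :\: (B :|: C)).
Proof.
move=> BCs; apply/setP => i; rewrite inE.
have -> : (0 < gen_degree s i)%N = (0 < Zn_of (gen_degree s) i) by rewrite ffunE ltz_nat.
rewrite gen_degreeK // kshift_alpha.
have := alpha_ge i; have := subsetP BCs i; rewrite !inE.
case: (ltrgt0P (alpha i)) => ai; rewrite ?andbF ?andbT /=.
- by move=> _ _; rewrite ltr_wpDr.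
- case: (ltrgtP (- l%:Z) (alpha i)) => // al /=.
    by move=> ->// _; rewrite -ltrBlDr sub0r.
  by move=> ->// _; rewrite -al addNr ltxx.
- rewrite ?ai add0r.
  have -> : (0 == - l%:Z) = false by rewrite eq_sym oppr_eq0 eqz_nat eqn0Ngt l_gt0.
  by case: (i \in s) => //= _ _; rewrite ltz_nat.
Qed.

Section Link.
Variables (z : P) (zBD : supp x z = B :|: D).
Notation Q := (interval_link x z D C).
Notation tau := (link_supp x z).

Lemma D_sub_supp : D \subset supp x z.
Proof. by rewrite zBD subsetUr. Qed.

Lemma C_disj_supp : [disjoint supp x z & C].
Proof.
rewrite zBD; apply/pred0P => i; rewrite !inE; apply/negbTE; apply/negP.
move=> /andP[/orP[/andP[al _]|al] /eqP e]; move: al; rewrite e ?ltxx // oppr_gt0 ltz_nat.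
by rewrite ltn0.
Qed.

Let L := interval_link_labelling P_simplicial x_vertices D_sub_supp C_disj_supp.

(** The generator of the Koszul complex that corresponds to [q]. Generators that
    miss a label of [B :|: C] have values in degrees with a negative
    coordinate, where the module vanishes. *)
Definition koszul_set (q : T) : {set 'I_n} := (B :|: C) :|: tau q.

Lemma tau_disj q i : q \in Q -> i \in tau q -> i \notin B :|: C.
Proof.
move=> Qq iq.
have : i \in supp x q.2.
  by rewrite -(link_supp_out P_simplicial x_vertices D_sub_supp Qq) inE iq.
move: (Qq); rewrite in_interval_link => /and3P[_ _ /pred0P/(_ i)/= qC] iq2.
have iC : i \notin C by move: qC; rewrite iq2 /= => ->.
apply/negP => /setUP[iB|]; last by rewrite (negbTE iC).
have : i \in tau q :&: supp x z by rewrite in_setI iq zBD in_setU iB.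
rewrite (link_supp_in P_simplicial x_vertices D_sub_supp Qq).
move/(subsetP (interval_link_fst P_simplicial x_vertices D_sub_supp Qq)).
move: iB; rewrite !inE => /andP[_ a0] /(lt_trans a0); by rewrite ltxx.
Qed.

Lemma disjoint_tau q : q \in Q -> [disjoint B :|: C & tau q].
Proof.
move=> Qq; rewrite -setI_eq0; apply/eqP/setP => i; rewrite in_setI in_set0.
by apply/negbTE; apply/negP => /andP[iBC /(tau_disj Qq)]; rewrite iBC.
Qed.

Lemma card_koszul_set q : q \in Q -> #|koszul_set q| = (#|B| + #|C| + #|tau q|)%N.
Proof.
move=> Qq; rewrite /koszul_set cardsU (_ : _ :&: _ = set0) ?cards0 ?subn0; last first.
  by apply/eqP; rewrite setI_eq0; exact: disjoint_tau.
congr (_ + _)%N; rewrite cardsU (_ : B :&: C = set0) ?cards0 ?subn0 //.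
by apply/setP => i; rewrite !inE; case: eqP => [->|]; rewrite ?ltxx ?andbF.
Qed.

Lemma supp_koszul_set q : q \in Q -> supp_deg (gen_degree (koszul_set q)) = supp x q.2.
Proof.
move=> Qq; rewrite supp_gen_degree ?subsetUl // -zBD.
rewrite -(link_supp_out P_simplicial x_vertices D_sub_supp Qq) setUC; congr (_ :|: _).
apply/setP => i; rewrite in_setD [i \in koszul_set q]in_setU.
by case: (boolP (i \in tau q)) => [/(tau_disj Qq)->|]; rewrite ?orbT ?orbF ?andNb.
Qed.

Lemma koszul_set_facet q k : q \in Q -> k \in tau q ->
  koszul_set (lfacet Q ((\bot%O, z) : T) tau q k) = koszul_set q :\ k.
Proof.
move=> Qq kq; have [_ _ tf] := lfacetP L k Qq.
rewrite /koszul_set tf; apply/setP => i; rewrite in_setU in_setD1 in_setD1 [in RHS]in_setU.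
by case: (eqVneq i k) => [->|//] /=; rewrite orbF (negbTE (tau_disj Qq kq)).
Qed.

Section Cochain.
Variable (O : rel T) (O_orientation : orientation Q ((\bot%O, z) : T) O).

(** The product accounts for the labels of [B :|: C], which take part in the
    signs of the Koszul complex but are absent from the poset. *)
Definition esign q : K := osign Q ((\bot%O, z) : T) tau K O q *
  \prod_(k in tau q) ksign K k (B :|: C).

Lemma esign_sq q : esign q * esign q = 1.
Proof.
rewrite /esign mulrACA osign_sq mul1r -big_split big1 // => k _.
exact: ksign_sq.
Qed.

Definition cochain_of m (F : Fr m -> oN) : {ffun T -> K^o} := [ffun q =>
  if (q \in Q) && (#|koszul_set q| == m) then
    (esign q : K) * cf q.2 (gen_degree (koszul_set q)) (F (kbasis K m (koszul_set q))) else 0].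

Lemma ksignU k (S S' : {set 'I_n}) : [disjoint S & S'] ->
  ksign K k (S :|: S') = ksign K k S * ksign K k S'.
Proof. by move=> SS'; rewrite /ksign !sign_card big_setU_disjoint. Qed.

Lemma cf_sum w mu (I : finType) (p : pred I) (F : I -> oN) :
  cf w mu (\sum_(i | p i) F i) = \sum_(i | p i) cf w mu (F i).
Proof. by apply: big_morph; [exact: cfD|exact: cf0]. Qed.

(** Both differentials are sums over the label that is removed. Removing a label
    of [B :|: C] gives a generator with zero value. For a label [k] of [q], the
    coordinate of [q] at a multiple of ['X_k ^+ l] is the coordinate of the
    facet opposite to [k]. *)
Lemma cochain_of_d m (F : Fr m -> oN) : hdeg F ->
  cochain_of (F \o kd m : Fr m.+1 -> oN) =
  coboundary Q ((\bot%O, z) : T) O (cochain_of F).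
Proof.
move=> Fh; have FL := hdeg_linear Fh; apply/ffunP => q.
case: (boolP (q \in Q)) => Qq; last by rewrite coboundary_out // ffunE (negbTE Qq).
pose os := osign Q ((\bot%O, z) : T) tau K O q.
have os_sq : os * os = 1 by exact: osign_sq.
suff E : os * cochain_of (F \o kd m : Fr m.+1 -> oN) q =
    os * coboundary Q ((\bot%O, z) : T) O (cochain_of F) q.
  by rewrite -[LHS]mul1r -[RHS]mul1r -os_sq -!mulrA E.
rewrite /os.
rewrite (osign_coboundary L O_orientation) // ffunE Qq /=.
case: ifP => [/eqP qm|/negP qm]; last first.
  rewrite mulr0 big1 // => k kq; have [Qf _ _] := lfacetP L k Qq.
  rewrite ffunE Qf koszul_set_facet //=; case: eqP => [fm|_]; last by rewrite !mulr0.
  by case: qm; have := cardsD1 k (koszul_set q); rewrite fm inE kq orbT => ->.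
rewrite {1}/esign !mulrA osign_sq mul1r koszul_d_basis //.
pose t i : oN := (ksign K i (koszul_set q :\ i) *: 'X_i ^+ l) *:
  (F (kbasis K m (koszul_set q :\ i)) : N).
have -> : F (\sum_(i in koszul_set q) (ksign K i (koszul_set q :\ i) *: 'X_i ^+ l) *:
      kbasis K m (koszul_set q :\ i)) = \sum_(i in koszul_set q) t i.
  elim/big_rec2: _ => [|i u v _ <-]; first exact: linear_fun0.
  by rewrite FL.
have -> : cf q.2 (gen_degree (koszul_set q)) (\sum_(i in koszul_set q) t i) =
    \sum_(i in tau q) cf q.2 (gen_degree (koszul_set q)) (t i).
  rewrite cf_sum (big_setU_disjoint _ _ (disjoint_tau Qq)) /= big1 ?add0r // => i iBC.
  rewrite /t (hdeg_basis0 Fh) ?scaler0 ?cf0 //.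
  by apply/subsetPn; exists i => //; rewrite in_setD1 eqxx.
rewrite mulr_sumr; apply: eq_bigr => k kq; rewrite {}/t.
have [Qf fq tf] := lfacetP L k Qq; set y := lfacet _ _ _ _ _ in Qf fq tf *.
have sy : koszul_set y = koszul_set q :\ k by exact: koszul_set_facet.
have kc : k \in koszul_set q by rewrite in_setU kq orbT.
have ym : #|koszul_set q :\ k| = m.
  by have := cardsD1 k (koszul_set q); rewrite kc qm add1n => -[].
have BCy : B :|: C \subset koszul_set y by exact: subsetUl.
have BCq : B :|: C \subset koszul_set q by exact: subsetUl.
have kq2 : k \in supp x q.2.
  by rewrite -(link_supp_out P_simplicial x_vertices D_sub_supp Qq) inE kq.
have dq : gen_degree (koszul_set q) = (gen_degree (koszul_set y) + xpow l k)%MM.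
  apply: Zn_of_inj; rewrite Zn_ofD !gen_degreeK // sy -[in LHS](setD1K kc) kshiftU ?inE ?eqxx //.
  by rewrite -addrA addrC.
rewrite ffunE Qf sy ym eqxx /= -[_ *: 'X_k ^+ l]mul_mpolyC -scalerA cfZ dq (cf_pow H) //.
rewrite -sy -(cf_face H (v := y.2)) ?supp_koszul_set //; last first.
- by move: fq; rewrite Order.ProdOrder.leEprod => /andP[].
- by rewrite gen_degreeK //; exact: hdeg_basis.
rewrite sy !mulrA; congr (_ * _); rewrite /esign tf -!mulrA.
rewrite [osign _ _ _ _ _ _ * (osign _ _ _ _ _ _ * _)]mulrA osign_sq mul1r.
rewrite (big_setD1 k) //=.
have -> : koszul_set q :\ k = (B :|: C) :|: (tau q :\ k).
  by rewrite -sy /koszul_set tf.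
rewrite [ksign K k (_ :|: _ :|: _)]ksignU; last by apply: disjointWr (disjoint_tau Qq); exact: subsetDl.
by rewrite [ksign K k (_ :\ k) * _]mulrC mulrACA ksign_sq mul1r mulrC.
Qed.

Lemma cochain_of_linear m a (F F' : Fr m -> oN) :
  cochain_of (a *: F + F') = a *: cochain_of F + cochain_of F'.
Proof.
apply/ffunP => q; rewrite !ffunE; case: ifP => _; last by rewrite scaler0 addr0.
rewrite -[X in cf _ _ X]/(a *: F _ + F' _ : oN) (cf_linear H) mulrDr.
by congr (_ + _); rewrite mulrCA.
Qed.

Lemma cochain_of0 m : cochain_of (0 : Fr m -> oN) = 0.
Proof. by apply/ffunP => q; rewrite !ffunE cf0 mulr0 if_same. Qed.

Lemma cochain_of_cochain m (F : Fr m -> oN) :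
  cochain Q ((\bot%O, z) : T) (m%:Z - #|B|%:Z - #|C|%:Z - 1) (cochain_of F).
Proof.
move=> q; rewrite ffunE; case: ifP => [/andP[Qq /eqP qm] _|]; last by rewrite eqxx.
split=> //; rewrite (rank_labelling L) // subrK -qm card_koszul_set //.
by rewrite -addnA PoszD [(#|B| : int) + _]addrC addrK PoszD addrC addKr.
Qed.

End Cochain.
End Link.

Lemma D_disj_BC i : i \in D -> i \notin B :|: C.
Proof.
rewrite !inE => a0; apply/negP => /orP[/andP[_ /(lt_trans a0)]|/eqP e].
  by rewrite ltxx.
by move: a0; rewrite e oppr_gt0 ltz_nat.
Qed.

(** Whatever [s] is, the support of [w] contains all of [D]. The labels of [D]
    that lie in [s] are recorded by the first component instead, which explains
    the factor [interval x (face x z D)]. *)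
Lemma interval_link_ex (s : {set 'I_n}) w : B :|: C \subset s -> supp x w = supp_deg (gen_degree s) ->
  let z := face x w (B :|: D) in let q := (face x w (s :&: D), w) : T in
  [/\ supp x z = B :|: D, q \in interval_link x z D C & koszul_set z q = s].
Proof.
move=> BCs; rewrite supp_gen_degree // => sw /=; have DB := @D_disj_BC.
set bd := B :|: D in sw *.
have bdw : bd \subset supp x w by rewrite sw subsetUl.
have Dbd : D \subset bd by rewrite subsetUr.
have Dw : D \subset supp x w := subset_trans Dbd bdw.
have sDw : s :&: D \subset supp x w := subset_trans (subsetIr _ _) Dw.
have zs := supp_face P_simplicial x_vertices bdw.
have us := supp_face P_simplicial x_vertices sDw.
have zw := face_le P_simplicial x_vertices bdw.
have uw := face_le P_simplicial x_vertices sDw.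
split=> //.
  rewrite in_interval_link /= zw (face_face P_simplicial x_vertices) //.
  rewrite (le_face P_simplicial x_vertices) // us subsetIr /=.
  rewrite disjoint_sym -setI_eq0; apply/eqP/setP => i; rewrite in_setI in_set0 sw.
  apply/negbTE; apply/negP => /andP[iC /setUP[|/setDP[_]]]; last by rewrite in_setU iC orbT.
  move=> ibd; have : i \in supp x (face x w bd) by rewrite zs.
  by have /pred0P/(_ i)/= := C_disj_supp zs; rewrite iC andbT => ->.
rewrite /koszul_set /link_supp /= us zs sw; apply/setP => i.
rewrite !(in_setU, in_setI, in_setD).
have := subsetP BCs i; rewrite /bd !in_setU.
case: (i \in B) => /=; first by move=> ->.
case: (i \in C) => /=; first by move=> ->.
by move=> _; case: (i \in D); case: (i \in s).
Qed.

Lemma interval_link_unique z (q : T) : supp x z = B :|: D -> q \in interval_link x z D C ->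
  z = face x q.2 (B :|: D) /\ q = (face x q.2 (koszul_set z q :&: D), q.2).
Proof.
move=> zBD Qq; move: (Qq); rewrite in_interval_link => /and3P[q1 zq2 _].
have Dz := D_sub_supp zBD; have q1D := interval_link_fst P_simplicial x_vertices Dz Qq.
have q1z := le_trans q1 (face_le P_simplicial x_vertices Dz).
split; first by rewrite -zBD (face_eq P_simplicial x_vertices).
rewrite [LHS]surjective_pairing; congr (_, _).
have -> : koszul_set z q :&: D = supp x q.1.
  apply/setP => i; rewrite in_setI [i \in koszul_set _ _]in_setU [i \in link_supp _ _ _]in_setU in_setD.
  have := subsetP q1D i; have := subsetP Dz i; have := @D_disj_BC i.
  case: (i \in D) => /=; last by rewrite andbF; case: (i \in supp x q.1) => // _ _ /(_ isT).
  by move=> /(_ isT)/negbTE-> /(_ isT)->; rewrite andbT orbF.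
by rewrite (face_eq P_simplicial x_vertices) // (le_trans q1z).
Qed.

Section Main.
Variable O : P -> rel T.
Hypothesis O_orientation : forall z, supp x z = B :|: D ->
  orientation (interval_link x z D C) ((\bot%O, z) : T) (O z).

Lemma cochain_of_inj m (F F' : Fr m -> oN) : hdeg F -> hdeg F' ->
  (forall z, supp x z = B :|: D -> cochain_of z (O z) F = cochain_of z (O z) F') -> F = F'.
Proof.
move=> Fh F'h E; apply: hdeg_ext; try exact: hdeg_linear.
move=> s sm; case: (boolP (B :|: C \subset s)) => BCs; last by rewrite !hdeg_basis0.
have gF := hdeg_basis s Fh; have gF' := hdeg_basis s F'h.
pose a : oN := -1 *: F' (kbasis K m s) + F (kbasis K m s).
suff a0 : a = 0.
  by apply/eqP; rewrite -subr_eq0 addrC -scaleN1r; apply/eqP.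
apply: (cf_inj H (mu := gen_degree s)) => [|w wsupp].
  by rewrite gen_degreeK //; exact: (submoduleP (gN _)).2.
rewrite (cf_linear H) mulN1r addrC; apply/eqP; rewrite subr_eq0; apply/eqP.
have [zs qQ qs] := interval_link_ex BCs wsupp; set z := face _ _ _ in zs qQ qs.
set q := (_, w) in qQ qs.
have Eq : esign z (O z) q * cf w (gen_degree s) (F (kbasis K m s)) =
    esign z (O z) q * cf w (gen_degree s) (F' (kbasis K m s)).
  by have /ffunP/(_ q) := E z zs; rewrite !ffunE qQ qs sm eqxx.
by rewrite -[LHS]mul1r -[RHS]mul1r -(esign_sq z (O z) q) -[LHS]mulrA -[RHS]mulrA Eq.
Qed.

Lemma cochain_of_surj m (c : P -> {ffun T -> K^o}) :
    (forall z, supp x z = B :|: D ->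
       cochain (interval_link x z D C) ((\bot%O, z) : T) (m%:Z - #|B|%:Z - #|C|%:Z - 1) (c z)) ->
  exists2 F : Fr m -> oN, hdeg F &
    forall z, supp x z = B :|: D -> cochain_of z (O z) F = c z.
Proof.
move=> cc.
have ex (s : {set 'I_n}) : exists a : oN, a \in submodule_pred (gN (kshift l s + alpha)) /\
    (B :|: C \subset s -> forall w, supp x w = supp_deg (gen_degree s) ->
      let z := face x w (B :|: D) in let q := (face x w (s :&: D), w) : T in
      cf w (gen_degree s) a = esign z (O z) q * c z q).
  case: (boolP (B :|: C \subset s)) => BCs; last by exists 0; split=> //; exact: gN0.
  have [a ga aE] := cf_surj H (gen_degree s) (fun w => esign (face x w (B :|: D))
    (O (face x w (B :|: D))) (face x w (s :&: D), w) * c (face x w (B :|: D)) (face x w (s :&: D), w)).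
  by exists a; split=> [|_ w /aE//]; rewrite -gen_degreeK.
have [a aP] := choice ex.
pose F (u : Fr m) : oN := \sum_i (u 0 i *: (a (enum_val i) : N) : oN).
have FL : linear (F : Fr m -> N).
  move=> k u v; rewrite /F -[RHS]/(k *: (\sum_i u 0 i *: (a (enum_val i) : N)) +
    \sum_i v 0 i *: (a (enum_val i) : N)) scaler_sumr -big_split /=.
  by apply: eq_bigr => i _; rewrite !mxE scalerDl scalerA.
have Fh : hdeg F.
  split=> // beta u Hu; rewrite /F; elim/big_rec: _ => [|i b _ gb]; first exact: gN0.
  rewrite -[_ *: _]scale1r; apply: (submoduleP (gN _)).2 => //.
  have -> : beta + alpha = (beta - kshift l (enum_val i)) + (kshift l (enum_val i) + alpha).
    by rewrite addrA subrK.
  by apply: (gN_scale H); [exact: Hu|exact: (aP _).1].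
have Fe (s : {set _}) : #|s| = m -> F (kbasis K m s) = a s.
  move=> /kset_index[i <-]; rewrite /F (bigD1 i) //= mxE eqxx scale1r big1 ?addr0 // => j ji.
  by rewrite mxE (inj_eq enum_val_inj) (negbTE ji) scale0r.
exists F => // z zs; apply/ffunP => q; rewrite ffunE.
have LQ := interval_link_labelling P_simplicial x_vertices (D_sub_supp zs) (C_disj_supp zs).
case: (boolP (q \in interval_link x z D C)) => Qq /=; last first.
  by apply/eqP; rewrite eq_sym; apply: contraNT Qq => /(cc z zs)[].
case: eqP => [qm|qm]; last first.
  apply/eqP; rewrite eq_sym; apply/negPn/negP => /(cc z zs)[_].
  rewrite (rank_labelling LQ) // subrK => /esym/eqP; rewrite !subr_eq => /eqP e.
  case: qm; apply/eqP; rewrite -eqz_nat e (card_koszul_set zs) // !PoszD.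
  by rewrite -addrA addrC [#|C|%:Z + _]addrC.
have BCq : B :|: C \subset koszul_set z q by exact: subsetUl.
rewrite (Fe _ qm) ((aP _).2 BCq) ?supp_koszul_set //.
have [<- <-] := interval_link_unique zs Qq.
by rewrite mulrA esign_sq mul1r.
Qed.

(** By [cochain_of_inj] and [cochain_of_surj], the maps [cochain_of z] identify
    the Koszul cochains with the direct sum of the simplicial ones. *)
Theorem koszul_ext_iso m :
  lmod_iso (Ext G gN alpha m)
    (dirsum (fun z : {z : P | supp x z == B :|: D} =>
       reduced_cohomology (interval_link x (val z) D C) ((\bot%O, val z) : T)
         K (O (val z)) (m%:Z - #|B|%:Z - #|C|%:Z - 1))).
Proof.
pose I := {z : P | supp x z == B :|: D}.
have zP (z : I) : supp x (val z) = B :|: D by apply/eqP; exact: (valP z).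
pose ext (c : I -> {ffun T -> K^o}) (z : P) : {ffun T -> K^o} :=
  if insub z is Some z' then c z' else 0.
have extE c (z : I) : ext c (val z) = c z by rewrite /ext valK.
have extI c (Pr : P -> {ffun T -> K^o} -> Prop) : (forall z, Pr (val z) (c z)) ->
    forall z, supp x z = B :|: D -> Pr z (ext c z).
  by move=> Hc z /eqP zs; have := Hc (Sub z zs); rewrite -extE SubK.
have degS k : k.+1%:Z - #|B|%:Z - #|C|%:Z - 1 - 1 = k%:Z - #|B|%:Z - #|C|%:Z - 1.
  rewrite intS [1 + _]addrC -!addrA; congr (_ + _).
  by rewrite addrCA; congr (_ + _); rewrite addrCA.
have dd k (F : Fr k -> oN) (z : P) : supp x z = B :|: D -> hdeg F ->
    cochain_of z (O z) (F \o kd k) = coboundary (interval_link x z D C) ((\bot%O, z) : T) (O z) (cochain_of z (O z) F).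
  by move=> zs Fh; apply: cochain_of_d => //; exact: O_orientation.
apply: (@subquot_dirsum_iso _ _ I (fun=> {ffun T -> K^o}) _ _ _ _
  (fun z F => cochain_of (val z) (O (val z)) F)).
- by move=> z a F F'; exact: cochain_of_linear.
- move=> F /asboolP[Fh dF] z; apply/asboolP; split; first exact: cochain_of_cochain.
  rewrite -dd //; have -> : F \o kd m = 0 by apply: functional_extensionality_dep => u; exact: dF.
  exact: cochain_of0.
- case: m => [|m] F /asboolP[Fh dF]; split.
  + by move=> /asboolP-> z; rewrite cochain_of0; exact: (submoduleP (Submodule _)).1.
  + move=> HB; apply/asboolP; apply: cochain_of_inj => //; first exact: hom_deg0.
    move=> z zs; rewrite cochain_of0; have := HB (Sub z (introT eqP zs)); rewrite !SubK.
    (* There are no simplicial cochains below degree -1. *)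
    move=> /asboolP[e Ce ->]; have -> : e = 0; last by rewrite coboundary0.
    apply/ffunP => q; rewrite ffunE; apply/eqP/negPn/negP => /Ce[_ e_rank].
    have : 0 <= (rank (interval_link x z D C) ((\bot%O, z) : T) q)%:Z by [].
    by rewrite e_rank subrK sub0r -!opprD -!PoszD oppr_ge0 lez_nat addn1.
  + move=> /asboolP[g gh ->] z; apply/asboolP; exists (cochain_of (val z) (O (val z)) g).
      rewrite degS; exact: cochain_of_cochain.
    by rewrite -dd.
  + move=> HB.
    have /choice[e eP] : forall z : I, exists e, cochain (interval_link x (val z) D C)
        ((\bot%O, val z) : T) (m%:Z - #|B|%:Z - #|C|%:Z - 1) e /\
        cochain_of (val z) (O (val z)) F =
        coboundary (interval_link x (val z) D C) ((\bot%O, val z) : T) (O (val z)) e.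
      by move=> z; have /asboolP[e] := HB z; rewrite degS => Ce ->; exists e.
    have [|g gh gE] := @cochain_of_surj m (ext e).
      exact: (extI e (fun z ez => cochain (interval_link x z D C) ((\bot%O, z) : T) _ ez) (fun z => (eP z).1)).
    apply/asboolP; exists g => //; apply: cochain_of_inj => //; first exact: hdeg_comp.
    move=> z zs; rewrite dd // gE //.
    exact: (extI e (fun z ez => cochain_of z (O z) F = coboundary (interval_link x z D C) ((\bot%O, z) : T) (O z) ez) (fun z => (eP z).2)).
- move=> c cZ.
  have [|F Fh FE] := @cochain_of_surj m (ext c).
    apply: (extI c (fun z cz => cochain (interval_link x z D C) ((\bot%O, z) : T) _ cz)).
    by move=> z; have /asboolP[] := cZ z.
  exists F; last by move=> z; rewrite FE // extE subrr; exact: (submoduleP (Submodule _)).1.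
  have F0 : (F \o kd m : Fr m.+1 -> oN) = 0.
    apply: cochain_of_inj; [exact: hdeg_comp|exact: hom_deg0|].
    move=> z zs; rewrite dd // cochain_of0 FE //.
    apply: (extI c (fun z cz => coboundary (interval_link x z D C) ((\bot%O, z) : T) (O z) cz = 0)) => // z'.
    by have /asboolP[] := cZ z'.
  by apply/asboolP; split=> // u; rewrite -[LHS]/((F \o kd m) u) F0.
Qed.

End Main.
End ExtFaces.

(** * Ext with values in the face ring *)

Section FaceRingCoordinates.
Variables (n : nat) (K : fieldType).
Variables (d : Order.disp_t) (P : finBPOrderType d) (P_simplicial : simplicial_poset P).
Variables (x : 'I_n -> P) (x_vertices : vertex_labelling x).
Variables (l : nat) (l_gt0 : (0 < l)%N).
Notation A := {mpoly K[n]}.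
Notation S := {mpoly K[#|P|]}.
Notation FR := (face_ring K P).
Notation M := (Defs.restrict (@mpolyC n K) (face_module K x)).

Lemma vertex_piece gamma (p : A) : p \in submodule_pred (gradA K gamma) ->
  mmap (@mpolyC #|P| K) (fun i => face_var K (x i)) p
    \in submodule_pred (poly_piece K (face_weight x) gamma).
Proof.
move: p; apply: poly_piece_ind => [|k p q Hp Hq|m <-].
- by rewrite mmap0 poly_piece0.
- rewrite mmapD mmapZ mul_mpolyC.
  exact: (submoduleP (poly_piece K (face_weight x) gamma)).2.
rewrite mmapX; apply: poly_piece_prod => i; apply: poly_pieceXn.
rewrite (_ : Zn_unit i = face_weight x (enum_rank (x i))); first exact: poly_piece_var.
rewrite face_weight_supp; apply/ffunP => j.
by rewrite !ffunE mnmE (supp_vertex x_vertices) inE natz.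
Qed.

Lemma face_grading_scale (beta gamma : Zn n) p (a : M) :
  p \in submodule_pred (gradA K gamma) ->
  a \in submodule_pred (face_grading K x beta) ->
  (p *: (a : face_module K x) : M) \in submodule_pred (face_grading K x (gamma + beta)).
Proof.
move=> pg /face_gradingP[q qb ->]; apply/face_gradingP.
exists (mmap (@mpolyC #|P| K) (fun i => face_var K (x i)) p * q).
  exact: poly_pieceM (vertex_piece pg) qb.
by rewrite face_module_scale rmorphM.
Qed.

Lemma face_coef_scaleD w mu k (a b : M) :
  face_coef x w mu (k *: a + b : M) = k * face_coef x w mu a + face_coef x w mu b.
Proof. by rewrite scaleME; exact: face_coef_linear. Qed.

Lemma face_coef_eq0 mu (a : M) : a \in submodule_pred (face_grading K x (Zn_of mu)) ->
  (forall w, supp x w = supp_deg mu -> face_coef x w mu a = 0) -> a = 0.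
Proof.
move=> aM a0; have E := face_grading_basis P_simplicial x_vertices aM.
have : (a : FR) = 0 by rewrite E big1 // => z /eqP/a0->; rewrite rmorph0 mul0r.
exact: id.
Qed.

Lemma face_coef_surj mu (c : P -> K) :
  exists2 a : M, a \in submodule_pred (face_grading K x (Zn_of mu)) &
    forall w, supp x w = supp_deg mu -> face_coef x w mu a = c w.
Proof.
pose part (r : seq P) : FR :=
  \sum_(z <- r | supp x z == supp_deg mu) face_proj (c z)%:MP * chain_mon K x z mu.
have part_cons z r : supp x z == supp_deg mu ->
    (part (z :: r) : M) = c z *: (chain_mon K x z mu : M) + (part r : M).
  by move=> zs; rewrite scaleME /part big_cons zs.
have grad r : (part r : M) \in submodule_pred (face_grading K x (Zn_of mu)).
  elim: r => [|z r IH]; first by rewrite /part big_nil; exact: (submoduleP (face_grading K x _)).1.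
  case: (boolP (supp x z == supp_deg mu)) => zs; last by rewrite /part big_cons (negbTE zs).
  rewrite part_cons //; apply: (submoduleP (face_grading K x _)).2 => //.
  by apply: chain_mon_grading => //; exact/eqP.
exists (part (index_enum P)) => // w ws.
have face_coef_part r : face_coef x w mu (part r) =
    \sum_(z <- r | supp x z == supp_deg mu) c z * (z <= w)%O%:R.
  elim: r => [|z r IH]; first by rewrite /part !big_nil face_coef0.
  rewrite big_cons; case: ifP => zs; last by rewrite /part big_cons zs.
  by rewrite part_cons // face_coef_scaleD IH (face_coef_chain_mon K P_simplicial x_vertices) //; exact/eqP.
rewrite face_coef_part (bigD1 w) ?ws //= lexx mulr1 big1 ?addr0 // => z /andP[/eqP zs zw].
case: (boolP (z <= w)%O) => [zlw|_]; last by rewrite mulr0.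
by case/eqP: zw; apply: (supp_eq P_simplicial x_vertices zlw (lexx w)); rewrite zs ws.
Qed.

Lemma face_coef_pow w mu i (a : face_module K x) : i \in supp x w ->
  face_coef x w (mu + xpow l i)%MM ('X_i ^+ l *: a) = face_coef x w mu a.
Proof.
move=> iw; rewrite /face_coef (Phi_var P_simplicial x_vertices) // iw -xpowE.
by rewrite mulrC addmC mcoeffMX.
Qed.

Lemma face_ring_coordinates : face_coordinates x l (face_grading K x) (face_coef x (K := K)).
Proof.
split.
- exact: face_grading_neg.
- exact: face_grading_scale.
- exact: face_coef_scaleD.
- exact: face_coef_eq0.
- exact: face_coef_surj.
- by move=> mu v w a aM vw vmu; exact: face_coef_face.
- exact: face_coef_pow.
Qed.

End FaceRingCoordinates.

Theorem theorem3p1 (K : fieldType)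
    (K_infinite : infinite_set (@classical_sets.setT K))
    (d : Order.disp_t) (P : finBPOrderType d) (P_simplicial : simplicial_poset P)
    (n : nat) (x : 'I_n -> P) (x_vertices : vertex_labelling x)
    (l : nat) (l_gt0 : (0 < l)%N) (alpha : Zn n)
    (F : graded_resolution (@power_quot_grading n K l)) :
  let B := [set j | (- l%:Z < alpha j) && (alpha j < 0)] in
  let C := [set j | alpha j == - l%:Z] in
  let D := [set j | 0 < alpha j] in
  let E p := Ext F (@face_grading n K d P x) alpha p in
  [/\ (forall j, - l%:Z <= alpha j) ->
      forall O : P -> rel (P *p P)%type,
        (forall z, supp x z = B :|: D ->
           orientation (interval_link x z D C) (\bot%O, z) (O z)) ->
        forall p : nat,
          lmod_iso (E p)
            (dirsum (fun z : {z : P | supp x z == B :|: D} =>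
               reduced_cohomology (interval_link x (val z) D C) (\bot%O, val z)
                 K (O (val z)) (p%:Z - #|B|%:Z - #|C|%:Z - 1))),
      (exists j, alpha j < - l%:Z) -> forall p : nat, lmod_zero (E p) &
      D != set0 -> forall p : nat, lmod_zero (E p)].
Proof.
move=> B C D E.
have coords := face_ring_coordinates K P_simplicial x_vertices l_gt0.
have EG p := Ext_resolution_iso (@power_quot_independent n K l) (face_grading K x)
  alpha F (koszul_resolution n K l) p.
have part1 : (forall j, - l%:Z <= alpha j) ->
      forall O : P -> rel (P *p P)%type,
        (forall z, supp x z = B :|: D ->
           orientation (interval_link x z D C) (\bot%O, z) (O z)) ->
        forall p : nat,
          lmod_iso (E p)
            (dirsum (fun z : {z : P | supp x z == B :|: D} =>
               reduced_cohomology (interval_link x (val z) D C) (\bot%O, val z)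
                 K (O (val z)) (p%:Z - #|B|%:Z - #|C|%:Z - 1))).
  move=> alpha_ge O O_or p; apply: lmod_iso_trans (EG p) _.
  exact: (koszul_ext_iso P_simplicial x_vertices l_gt0 coords alpha_ge O_or p).
have part2 : (exists j, alpha j < - l%:Z) -> forall p : nat, lmod_zero (E p).
  move=> low p; apply: lmod_iso_zero (EG p) _.
  exact: (ext_low_zero l_gt0 coords low).
split=> // /set0Pn[i0 i0D] p.
have [alpha_ge|/existsNP[j /negP]] := pselect (forall j, - l%:Z <= alpha j); last first.
  by rewrite -ltNge => aj; apply: part2; exists j.
have zP z : supp x z = B :|: D ->
    boolean_labelling (interval_link x z D C) ((\bot%O, z) : (P *p P)%type) (link_supp x z).
  by move=> zs; apply: interval_link_labelling => //; [exact: D_sub_supp zs|exact: C_disj_supp zs].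
pose O (z : P) (a a' : (P *p P)%type) := (a == a') ||
  [exists i in link_supp x z a, [exists j in link_supp x z a', (i < j)%N]].
have O_or z : supp x z = B :|: D -> orientation (interval_link x z D C) (\bot%O, z) (O z).
  by move=> zs; exact: labelling_orientation (zP z zs).
apply: lmod_iso_zero (part1 alpha_ge O O_or p) _ => u.
apply: functional_extensionality_dep => z.
have zs : supp x (val z) = B :|: D by exact/eqP/(valP z).
apply: (cone_cohomology0 (zP _ zs) (O_or _ zs) (i0 := i0)) => q Qq iq.
by apply: interval_link_cone => //; exact: D_sub_supp zs.
Qed.
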